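(* Let $M\models\mathrm{PA}$ be an arbitrary countable model. Then there exist an $\omega_1$-like elementary extension $M'\succ M$ and a full syntactically regular satisfaction class $S\subset (M')^2$ on $M'$.
   Context: $\mathscr{L}_{\mathrm{PA}}$ is the language of arithmetic with $0,S,+,\times,=$; formulae are built with $\neg,\wedge,\vee,\exists,\forall$. Syntax is formalised in $\mathrm{PA}$ in the standard way; for $M\models\mathrm{PA}$, $\mathrm{Form}_{\mathscr{L}_{\mathrm{PA}}}(M)$, $\mathrm{Term}_{\mathscr{L}_{\mathrm{PA}}}(M)$, $\mathrm{ClTermSeq}_{\mathscr{L}_{\mathrm{PA}}}(M)$ are the sets of elements of $M$ which $M$ regards as (codes of) arithmetical formulae, terms, and sequences of closed terms (nonstandard ones included). $\mathrm{Asn}(\phi)$ is the set of $\phi$-assignments: (codes in $M$ of) functions from variables to elements of $M$ whose domain contains the free variables of $\phi$. $t^{\alpha}$ is the value of a term $t$ under $\alpha$, $t^{\circ}$ the value of a closed term, $\overline{t^{\circ}}$ the sequence of values of a sequence $\bar t$ of closed terms. $\phi[\alpha]$ is the sentence obtained by substituting the numeral of $\alpha(v)$ for every free variable $v$ of $\phi$. $\alpha\sim_v\beta$ means that $\alpha,\beta$ agree except possibly on $v$ (which need not be in their domains). $\omega_1$-like: a model $M\models\mathrm{PA}$ is $\omega_1$-like if $|M|=\aleph_1$ but every proper initial segment of $M$ is countable. Satisfaction classes. Let $S\subset M^2$ and $\phi\in\mathrm{Form}_{\mathscr{L}_{\mathrm{PA}}}(M)$. $S$ is compositional at $\phi$ if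 for every $\alpha\in\mathrm{Asn}(\phi)$, $(\phi,\alpha)\in S$ iff one of the following holds: $\phi=(s=t)$ for some terms $s,t$ of $M$ and $s^{\alpha}=t^{\alpha}$; $\phi=\neg\psi$ and $(\psi,\alpha)\notin S$; $\phi=\psi\vee\eta$ and ($(\psi,\alpha)\in S$ or $(\eta,\alpha)\in S$); $\phi=\psi\wedge\eta$ and $(\psi,\alpha),(\eta,\alpha)\in S$; $\phi=\exists v\,\psi$ and $(\psi,\beta)\in S$ for some $\beta\in\mathrm{Asn}(\psi)$ with $\beta\sim_v\alpha$; $\phi=\forall v\,\psi$ and $(\psi,\beta)\in S$ for all $\beta\in\mathrm{Asn}(\psi)$ with $\beta\sim_v\alpha$. $S\subset M^2$ is a satisfaction class on $M$ if there is $D\subset\mathrm{Form}_{\mathscr{L}_{\mathrm{PA}}}(M)$ such that: $D$ is closed under direct subformulae; $S$ is compositional at every $\phi\in D$; for every $\phi\in D$ and $\alpha\in\mathrm{Asn}(\phi)$, $(\phi,\alpha)\in S$ or $(\neg\phi,\alpha)\in S$; and for every $\phi$, if $(\phi,\alpha)\in S$ or $(\neg\phi,\alpha)\in S$ for some $\alpha$, then $\phi\in D$. The maximal such $D$ is the domain $\mathrm{dom}(S)$. $S$ is full if $\mathrm{dom}(S)=\mathrm{Form}_{\mathscr{L}_{\mathrm{PA}}}(M)$. Syntactic template. For a formula $\phi$, its syntactic template $\widehat\phi$ is the unique formula such that: (1) $\widehat\phi$ differs from $\phi$ only by term substitution and renaming bound variables; (2) $\widehat\phi$ contains no complex (non-variable)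 terms containing only free variables; (3) $\widehat\phi$ contains no closed terms; (4) every free variable occurs in $\widehat\phi$ at most once; (5) every bound variable in $\widehat\phi$ is quantified over only once; (6) the choice of free and bound variables makes $\widehat\phi$ minimal (in code) with these properties. (I.e. each maximal term occurrence containing no bound variable is replaced by its own fresh free variable.) Syntactic regularity. For $\phi,\psi\in\mathrm{Form}_{\mathscr{L}_{\mathrm{PA}}}(M)$, $\alpha\in\mathrm{Asn}(\phi)$, $\beta\in\mathrm{Asn}(\psi)$, write $(\phi,\alpha)\sim(\psi,\beta)$ if $\widehat\phi=\widehat\psi$ and there are $\bar s,\bar t\in\mathrm{ClTermSeq}_{\mathscr{L}_{\mathrm{PA}}}(M)$ with $\overline{s^{\circ}}=\overline{t^{\circ}}$ such that $\widehat\phi(\bar s)$ differs from $\phi[\alpha]$ only by renaming bound variables and $\widehat\psi(\bar t)$ differs from $\psi[\beta]$ only by renaming bound variables. A satisfaction class $S$ is syntactically regular if $(\phi,\alpha)\sim(\psi,\beta)$ implies that $(\phi,\alpha)\in S$ iff $(\psi,\beta)\in S$. *)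

(* Defs.v *)
(* Models are structures for the language 0, S, +, * in which PA holds in the
   sense of Tarski.  The syntax internal to a model M is arithmetised: each
   internal notion is a predicate on M whose quantifiers range over elements of
   M only (quantification over the finite types unop, binop, quant is a finite
   disjunction), i.e. it is the interpretation in M of an arithmetical formula,
   so that for nonstandard M it also applies to nonstandard codes. *)
From mathcomp Require Import all_boot.
From mathcomp Require Import boolp classical_sets functions cardinality wochoice.

Set Implicit Arguments.
Unset Strict Implicit.
Unset Printing Implicit Defensive.

Local Open Scope classical_set_scope.

Record arith := Arith {
  carrier :> Type;
  zero : carrier;
  succ : carrier -> carrier;
  add : carrier -> carrier -> carrier;
  mul : carrier -> carrier -> carrier }.

Arguments zero {_}.

Inductive tm : Type :=
| TVar of nat | TZero | TSucc of tm | TAdd of tm & tm | TMul of tm & tm.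

Inductive fm : Type :=
| FEq of tm & tm | FNeg of fm | FAnd of fm & fm | FOr of fm & fm
| FEx of nat & fm | FAll of nat & fm.

Definition FImp p q := FOr (FNeg p) q.

Fixpoint tm_subst (v : nat) (s t : tm) : tm :=
  match t with
  | TVar i => if i == v then s else TVar i
  | TZero => TZero
  | TSucc t1 => TSucc (tm_subst v s t1)
  | TAdd t1 t2 => TAdd (tm_subst v s t1) (tm_subst v s t2)
  | TMul t1 t2 => TMul (tm_subst v s t1) (tm_subst v s t2)
  end.

(* Does not rename bound variables, hence to be used only for terms s with no
   variable other than v: these cannot be captured at a free occurrence of v. *)
Fixpoint fm_subst (v : nat) (s : tm) (p : fm) : fm :=
  match p with
  | FEq t1 t2 => FEq (tm_subst v s t1) (tm_subst v s t2)
  | FNeg p1 => FNeg (fm_subst v s p1)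
  | FAnd p1 p2 => FAnd (fm_subst v s p1) (fm_subst v s p2)
  | FOr p1 p2 => FOr (fm_subst v s p1) (fm_subst v s p2)
  | FEx i p1 => FEx i (if i == v then p1 else fm_subst v s p1)
  | FAll i p1 => FAll i (if i == v then p1 else fm_subst v s p1)
  end.

Definition upd (M : Type) (e : nat -> M) (v : nat) (a : M) : nat -> M :=
  fun i => if i == v then a else e i.

Fixpoint tm_val (M : arith) (e : nat -> M) (t : tm) : M :=
  match t with
  | TVar i => e i
  | TZero => zero
  | TSucc t1 => succ (tm_val e t1)
  | TAdd t1 t2 => add (tm_val e t1) (tm_val e t2)
  | TMul t1 t2 => mul (tm_val e t1) (tm_val e t2)
  end.

Fixpoint sat (M : arith) (e : nat -> M) (p : fm) : Prop :=
  match p with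
  | FEq s t => tm_val e s = tm_val e t
  | FNeg p1 => ~ sat e p1
  | FAnd p1 p2 => sat e p1 /\ sat e p2
  | FOr p1 p2 => sat e p1 \/ sat e p2
  | FEx v p1 => exists a, sat (upd e v a) p1
  | FAll v p1 => forall a, sat (upd e v a) p1
  end.

(* Axioms are understood as universally closed, see models_PA. *)
Inductive PA : fm -> Prop :=
| PA_S0 : PA (FNeg (FEq (TSucc (TVar 0)) TZero))
| PA_Sinj : PA (FImp (FEq (TSucc (TVar 0)) (TSucc (TVar 1)))
                     (FEq (TVar 0) (TVar 1)))
| PA_add0 : PA (FEq (TAdd (TVar 0) TZero) (TVar 0))
| PA_addS : PA (FEq (TAdd (TVar 0) (TSucc (TVar 1)))
                    (TSucc (TAdd (TVar 0) (TVar 1))))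
| PA_mul0 : PA (FEq (TMul (TVar 0) TZero) TZero)
| PA_mulS : PA (FEq (TMul (TVar 0) (TSucc (TVar 1)))
                    (TAdd (TMul (TVar 0) (TVar 1)) (TVar 0)))
| PA_induction p v :
    PA (FImp (FAnd (fm_subst v TZero p)
                   (FAll v (FImp p (fm_subst v (TSucc (TVar v)) p))))
             (FAll v p)).

Definition models_PA (M : arith) : Prop :=
  forall p, PA p -> forall e : nat -> M, sat e p.

Definition elementary (M N : arith) (f : M -> N) : Prop :=
  forall p (e : nat -> M), sat e p <-> sat (f \o e) p.

Definition lt_of (M : arith) (x y : M) : Prop := exists z, add x (succ z) = y.
Definition le_of (M : arith) (x y : M) : Prop := exists z, add x z = y.

(* T is equinumerous with the ordinal omega_1: it is uncountable and carries a
   (reflexive) well-order all of whose proper initial segments are countable. *)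
Definition card_aleph1 (T : Type) : Prop :=
  ~ countable [set: T] /\
  exists R : rel T, well_order R /\ forall x, countable [set y | R y x].

Definition initial_segment (M : arith) (I : set M) : Prop :=
  forall x y, I x -> le_of y x -> I y.

Definition omega1_like (M : arith) : Prop :=
  [/\ models_PA M, card_aleph1 M &
      forall I : set M, initial_segment I -> I <> setT -> countable I].

Inductive unop := USucc | UNeg.
Inductive binop := BAdd | BMul | BEq | BAnd | BOr.
Inductive quant := QEx | QAll.

Section Internal.
Variable M : arith.
Implicit Types (a b c i j k l n s t u x y z : M) (e f F : M).

Definition num (n : nat) : M := iter n (@succ M) zero.

(* The injective pairing (x + y)^2 + x. *)
Definition pr x y : M := add (mul (add x y) (add x y)) x.

(* x belongs to the finite set coded by s = (b, (c, d)): x < b and the Goedel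
   beta modulus 1 + (x + 1) d divides c. *)
Definition elem x s : Prop :=
  exists b c d q, [/\ s = pr b (pr c d), lt_of x b &
                      c = mul q (succ (mul (succ x) d))].

(* A finite set has many codes; the least one represents it.  The empty set
   is represented by zero. *)
Definition least_code s : Prop :=
  forall u, lt_of u s -> ~ (forall x, elem x u <-> elem x s).

Definition elem2 x y s : Prop := elem (pr x y) s.
Definition elem3 x y z s : Prop := elem (pr x (pr y z)) s.

Definition is_fun f : Prop :=
  [/\ least_code f,
      forall u, elem u f -> exists x y, u = pr x y &
      forall x y z, elem2 x y f -> elem2 x z f -> y = z].

Definition is_seq l f : Prop :=
  is_fun f /\ forall i, (exists y, elem2 i y f) <-> lt_of i l.

(* Recursion on codes: x satisfies the rule when it belongs to a coded finite
   set all of whose elements are justified by the rule from elements of that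
   set.  In every rule below the syntactic (or, for numeral, numeric) argument
   of a premise is smaller than that of the conclusion, so that by induction
   in M such a set amounts to a derivation. *)
Definition rec1 (Phi : (M -> Prop) -> M -> Prop) x : Prop :=
  exists F, elem x F /\ forall u, elem u F -> Phi (elem^~ F) u.

Definition rec2 (Phi : (M -> M -> Prop) -> M -> M -> Prop) x y : Prop :=
  exists F, elem2 x y F /\
    forall u v, elem2 u v F -> Phi (fun u' v' => elem2 u' v' F) u v.

Definition rec3 (Phi : (M -> M -> M -> Prop) -> M -> M -> M -> Prop) x y z
    : Prop :=
  exists F, elem3 x y z F /\
    forall u v w, elem3 u v w F ->
      Phi (fun u' v' w' => elem3 u' v' w' F) u v w.

(* Codes of expressions.  The positive tags make each code greater than those
   of its components.  Variables are indexed by arbitrary elements of M, and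
   a variable is identified with its index outside terms. *)
Definition var i : M := pr (num 1) i.
Definition zer : M := pr (num 2) zero.
Definition un (o : unop) a : M :=
  pr (num (match o with USucc => 3 | UNeg => 4 end)) a.
Definition bin (o : binop) a b : M :=
  pr (num (match o with
           | BAdd => 5 | BMul => 6 | BEq => 7 | BAnd => 8 | BOr => 9
           end)) (pr a b).
Definition qu (q : quant) i a : M :=
  pr (num (match q with QEx => 10 | QAll => 11 end)) (pr i a).

Definition Term : M -> Prop := rec1 (fun X x =>
  [\/ exists i, x = var i,
      x = zer,
      exists2 a, x = un USucc a & X a |
      exists a b, (x = bin BAdd a b \/ x = bin BMul a b) /\ X a /\ X b]).

Definition Form : set M := rec1 (fun X x =>
  [\/ exists a b, [/\ x = bin BEq a b, Term a & Term b],
      exists2 a, x = un UNeg a & X a,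
      exists a b, (x = bin BAnd a b \/ x = bin BOr a b) /\ X a /\ X b |
      exists q i a, x = qu q i a /\ X a]).

(* The variable v_i occurs free in the term or formula x. *)
Definition free i : M -> Prop := rec1 (fun X x =>
  [\/ x = var i,
      exists o a, x = un o a /\ X a,
      exists o a b, x = bin o a b /\ (X a \/ X b) |
      exists q j a, [/\ x = qu q j a, j <> i & X a]]).

(* t occurs as a subexpression of x. *)
Definition subexpr t : M -> Prop := rec1 (fun X x =>
  [\/ x = t,
      exists o a, x = un o a /\ X a,
      exists o a b, x = bin o a b /\ (X a \/ X b) |
      exists q j a, x = qu q j a /\ X a]).

(* n is the total weight of x, where wv weighs the variable j standing in a
   term and wq weighs the variable j standing next to a quantifier. *)
Definition weight (wv wq : M -> M -> Prop) : M -> M -> Prop :=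
  rec2 (fun X x n =>
    [\/ exists2 j, x = var j & wv j n,
        x = zer /\ n = zero,
        exists o a, x = un o a /\ X a n |
        (exists o a b n1 n2,
           [/\ x = bin o a b, X a n1, X b n2 & n = add n1 n2]) \/
        (exists q j a n1 n2,
           [/\ x = qu q j a, wq j n1, X a n2 & n = add n1 n2])]).

Definition delta i j n : Prop :=
  (j = i /\ n = num 1) \/ (j <> i /\ n = zero).

(* v_i occurs n times in x, occurrences next to quantifiers included. *)
Definition occurrences i : M -> M -> Prop := weight (delta i) (delta i).

(* v_i is quantified over n times in x. *)
Definition quantifications i : M -> M -> Prop :=
  weight (fun _ n => n = zero) (delta i).

Definition ClTerm t : Prop := Term t /\ forall i, ~ free i t.

Definition ClTermSeq s : Prop :=
  exists l, is_seq l s /\ forall k t, elem2 k t s -> ClTerm t.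

(* The term t has value a, where rho i b says that v_i has value b. *)
Definition value (rho : M -> M -> Prop) : M -> M -> Prop :=
  rec2 (fun X t a =>
    [\/ exists2 i, t = var i & rho i a,
        t = zer /\ a = zero,
        exists t' a', [/\ t = un USucc t', X t' a' & a = succ a'] |
        exists t1 t2 a1 a2, [/\ X t1 a1, X t2 a2 &
          (t = bin BAdd t1 t2 /\ a = add a1 a2) \/
          (t = bin BMul t1 t2 /\ a = mul a1 a2)]]).

Definition asn_value al : M -> M -> Prop := value (fun i a => elem2 i a al).

Definition cl_value : M -> M -> Prop := value (fun _ _ => False).

(* r is the sequence of values of the sequence s of closed terms. *)
Definition seq_value s r : Prop :=
  exists l, [/\ is_seq l s, is_seq l r &
    forall k t a, elem2 k t s -> elem2 k a r -> cl_value t a].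

Definition Asn phi : set M := fun al =>
  is_fun al /\ forall i, free i phi -> exists a, elem2 i a al.

Definition agree_off i al be : Prop :=
  forall j a, j <> i -> (elem2 j a al <-> elem2 j a be).

Definition numeral : M -> M -> Prop := rec2 (fun X a t =>
  (a = zero /\ t = zer) \/
  (exists a' t', [/\ a = succ a', t = un USucc t' & X a' t'])).

(* y results from x by replacing each free v_i by the t with sigma i t, where
   b codes the set of variables bound so far.  Bound variables are not renamed:
   used only when sigma yields closed terms. *)
Definition subst_under (sigma : M -> M -> Prop) : M -> M -> M -> Prop :=
  rec3 (fun X b x y =>
    [\/ exists2 i, x = var i &
          (elem i b /\ y = var i) \/ (~ elem i b /\ sigma i y),
        x = zer /\ y = zer,
        exists o a a', [/\ x = un o a, y = un o a' & X b a a'] |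
        (exists o a1 a2 a1' a2',
           [/\ x = bin o a1 a2, y = bin o a1' a2', X b a1 a1' & X b a2 a2']) \/
        (exists q i a a' b',
           [/\ x = qu q i a, y = qu q i a',
               forall j, elem j b' <-> j = i \/ elem j b & X b' a a'])]).

Definition subst (sigma : M -> M -> Prop) : M -> M -> Prop :=
  subst_under sigma zero.

(* th is phi[al]. *)
Definition subst_asn phi al th : Prop :=
  subst (fun i t => exists2 a, elem2 i a al & numeral a t) phi th.

Definition extend e i k e' : Prop :=
  forall j m, elem2 j m e' <-> (j = i /\ m = k) \/ (j <> i /\ elem2 j m e).

(* Up to renaming of bound variables, y results from x by the capture-avoiding
   replacement of each free v_i by the t with sigma i t.  The context
   (k, (e, f)) holds the number k of enclosing quantifiers and the maps e, f
   sending each variable bound in x, respectively in y, to the depth of the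
   quantifier that binds it. *)
Definition inst_under (sigma : M -> M -> Prop) : M -> M -> M -> Prop :=
  rec3 (fun X c x y => exists k e f, c = pr k (pr e f) /\
    [\/ exists2 i, x = var i &
          (exists m j, [/\ elem2 i m e, y = var j & elem2 j m f]) \/
          [/\ forall m, ~ elem2 i m e, sigma i y &
              forall j m, free j y -> ~ elem2 j m f],
        x = zer /\ y = zer,
        exists o a a', [/\ x = un o a, y = un o a' & X c a a'] |
        (exists o a1 a2 a1' a2',
           [/\ x = bin o a1 a2, y = bin o a1' a2', X c a1 a1' & X c a2 a2']) \/
        (exists q i j a a' e' f',
           x = qu q i a /\ y = qu q j a' /\ extend e i k e' /\
           extend f j k f' /\ X (pr (succ k) (pr e' f')) a a')]).

Definition inst (sigma : M -> M -> Prop) : M -> M -> Prop :=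
  inst_under sigma (pr zero (pr zero zero)).

Definition alpha_equiv : M -> M -> Prop := inst (fun i y => y = var i).

(* phi is obtained from tau by substituting terms for free variables and
   renaming bound variables. *)
Definition term_instance tau phi : Prop :=
  exists sg, [/\ is_fun sg, forall i t, elem2 i t sg -> Term t &
                 inst (fun i t => elem2 i t sg) tau phi].

(* The conditions on the syntactic template apart from minimality.  A free
   variable occurring at most once is not bound anywhere, so "free variable of
   tau" needs no reference to a position in tau. *)
Definition template_shape phi tau : Prop :=
  Form tau /\
  [/\ term_instance tau phi,
      forall t, Term t -> subexpr t tau -> (exists i, free i t) ->
        (forall i, free i t -> free i tau) -> exists i, t = var i,
      forall t, Term t -> subexpr t tau -> ~ ClTerm t,
      forall i, free i tau -> exists2 n, occurrences i tau n & le_of n (num 1) &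
      forall i, exists2 n, quantifications i tau n & le_of n (num 1)].

Definition template phi tau : Prop :=
  template_shape phi tau /\
  forall tau', lt_of tau' tau -> ~ template_shape phi tau'.

(* e lists the l free variables of tau in increasing order. *)
Definition free_vars tau l e : Prop :=
  [/\ is_seq l e,
      forall i, free i tau <-> exists k, elem2 k i e &
      forall k k' i i', elem2 k i e -> elem2 k' i' e ->
        lt_of k k' -> lt_of i i'].

(* th is tau(s): the k-th entry of s replaces the k-th free variable of tau. *)
Definition subst_seq tau s th : Prop :=
  exists l e, [/\ free_vars tau l e, is_seq l s &
    subst (fun i t => exists2 k, elem2 k i e & elem2 k t s) tau th].

Definition presents tau s phi al : Prop :=
  exists th th', [/\ subst_seq tau s th, subst_asn phi al th' &
                     alpha_equiv th th'].

(* (phi, al) ~ (psi, be). *)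
Definition similar phi al psi be : Prop :=
  exists tau, [/\ template phi tau, template psi tau &
    exists s t, [/\ ClTermSeq s, ClTermSeq t,
      exists2 r, seq_value s r & seq_value t r,
      presents tau s phi al & presents tau t psi be]].

Implicit Types (S : M -> M -> Prop) (D : set M).

Definition compositional S phi : Prop :=
  forall al, Asn phi al ->
    (S phi al <->
     (exists s t, [/\ Term s, Term t, phi = bin BEq s t &
        exists2 a, asn_value al s a & asn_value al t a]) \/
     (exists2 psi, phi = un UNeg psi & ~ S psi al) \/
     (exists psi eta, phi = bin BOr psi eta /\ (S psi al \/ S eta al)) \/
     (exists psi eta, phi = bin BAnd psi eta /\ (S psi al /\ S eta al)) \/
     (exists v psi, phi = qu QEx v psi /\
        exists be, [/\ Asn psi be, agree_off v be al & S psi be]) \/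
     (exists v psi, phi = qu QAll v psi /\
        forall be, Asn psi be -> agree_off v be al -> S psi be)).

Definition direct_subformula psi phi : Prop :=
  [\/ phi = un UNeg psi,
      exists eta, phi = bin BAnd psi eta \/ phi = bin BAnd eta psi,
      exists eta, phi = bin BOr psi eta \/ phi = bin BOr eta psi |
      exists q v, phi = qu q v psi].

Definition admissible_domain S D : Prop :=
  [/\ D `<=` Form,
      forall phi psi, D phi -> direct_subformula psi phi -> D psi,
      forall phi, D phi -> compositional S phi,
      forall phi al, D phi -> Asn phi al -> S phi al \/ S (un UNeg phi) al &
      forall phi, (exists al, S phi al \/ S (un UNeg phi) al) -> D phi].

Definition satisfaction_class S : Prop := exists D, admissible_domain S D.

Definition is_dom S D : Prop :=
  admissible_domain S D /\ forall D', admissible_domain S D' -> D' `<=` D.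

Definition full S : Prop := is_dom S Form.

Definition syntactically_regular S : Prop :=
  forall phi psi al be, Form phi -> Form psi -> Asn phi al -> Asn psi be ->
    similar phi al psi be -> (S phi al <-> S psi be).

End Internal.

(* Main.v *)
(* The class is built along a chain of countable end extensions.  So that each
   step is possible, the structures interpret, besides arithmetic, a constant c
   and, for all definable predicates B0 and B1, the iteration T(0) = empty,
   T(i+1) = B0 or (B1 and Tarski's clauses for T(i)), where i < c.  If c = n is
   standard, this is definable in M; an ultraproduct of these structures is an
   elementary extension of M in which c is nonstandard, while induction holds
   for the richer language.  Iterations below c are then definable predicates.
   A satisfaction class is only required to agree with a definable predicate
   around every definable family of formulas that is finite at standard levels.
   At some nonstandard level such a family has fewer than c members; by the
   pigeonhole principle iteration on these members becomes stationary, i.e.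
   compositional, and two definable truth predicates can be amalgamated along a
   level at which neither family grows.  Predicates invariant under similarity
   stay so under iteration, which gives regularity.  In a countable structure
   there are countably many families, so a class given on an initial part can
   be extended to all formulas.  The ultrapower by definable functions modulo a
   cohesive ultrafilter is a conservative end extension: definable families of
   the extension have definable traces, hence the class survives the step, and
   Zorn's lemma yields an uncountable union of countable initial segments. *)
From Stdlib Require Import Ring.
From mathcomp Require Import all_boot.
From mathcomp Require Import boolp classical_sets functions cardinality wochoice filter.
Require Import Defs.

Set Implicit Arguments.
Unset Strict Implicit.
Unset Printing Implicit Defensive.

Local Open Scope classical_set_scope.

(** * A language extending arithmetic *)

Inductive ltm := LV of nat | LZ | LC | LS of ltm | LA of ltm & ltm | LM of ltm & ltm.

(* De Bruijn formulas.  Substitution is a constructor, and [LIt p q] stands for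
   a predicate obtained by iterating the clauses of truth, see [itT]. *)
Inductive lf :=
| LEq of ltm & ltm | LNeg of lf | LAnd of lf & lf | LEx of lf
| LSub of seq ltm & nat & lf | LIt of lf & lf.

Definition sc (T : Type) (a : T) (e : nat -> T) : nat -> T :=
  fun i => if i is k.+1 then e k else a.

Definition sh (T : Type) (k : nat) (e : nat -> T) : nat -> T := fun i => e (i + k).

Fixpoint lval (N : arith) (c : N) (e : nat -> N) (t : ltm) : N :=
  match t with
  | LV i => e i
  | LZ => zero
  | LC => c
  | LS t => succ (lval c e t)
  | LA s t => add (lval c e s) (lval c e t)
  | LM s t => mul (lval c e s) (lval c e t)
  end.

(** The terms fill the first places and the other variables are shifted by [k], so one constructor
    covers instantiation, weakening and reindexing. *)
Definition senv (N : arith) (c : N) (ts : seq ltm) k (e : nat -> N) : nat -> N :=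
  fun i => if i < size ts then lval c e (nth LZ ts i) else e (i - size ts + k).

Fixpoint tbnd (t : ltm) : nat :=
  match t with
  | LV i => i.+1
  | LZ | LC => 0
  | LS t => tbnd t
  | LA s t | LM s t => maxn (tbnd s) (tbnd t)
  end.

(** Places 0, 1, 2 of [LIt p q] hold the stage, the code and the assignment, while [p] and [q] see
    only the last two; this shifts the bound by one. *)
Fixpoint bnd (p : lf) : nat :=
  match p with
  | LEq s t => maxn (tbnd s) (tbnd t)
  | LNeg p => bnd p
  | LAnd p q => maxn (bnd p) (bnd q)
  | LEx p => (bnd p).-1
  | LSub ts k p => maxn (foldr maxn 0 (map tbnd ts)) (bnd p + k)
  | LIt p q => (maxn 2 (maxn (bnd p) (bnd q))).+1
  end.

(** [LIt] gets no clause here: its meaning enters through the sentences shared with the finite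
    stages. [Sat_dep] makes up for the missing clause when an environment is altered beyond finitely
    many places. *)
Record pre := Pre {
  car :> arith;
  cc : car;
  Sat : lf -> (nat -> car) -> Prop;
  Sat_eq : forall s t e, Sat (LEq s t) e <-> lval cc e s = lval cc e t;
  Sat_neg : forall p e, Sat (LNeg p) e <-> ~ Sat p e;
  Sat_and : forall p q e, Sat (LAnd p q) e <-> Sat p e /\ Sat q e;
  Sat_ex : forall p e, Sat (LEx p) e <-> exists a, Sat p (sc a e);
  Sat_sub : forall ts k p e, Sat (LSub ts k p) e <-> Sat p (senv cc ts k e);
  Sat_dep : forall p e e', (forall i, i < bnd p -> e i = e' i) -> Sat p e -> Sat p e' }.

Arguments cc {_}.
Arguments Sat {_}.

Lemma lval_dep (N : arith) (c : N) t e e' :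
  (forall i, i < tbnd t -> e i = e' i) -> lval c e t = lval c e' t.
Proof.
elim: t => //=.
- by move=> i H; apply: H.
- by move=> t IH H; rewrite IH.
- move=> s IHs t IHt H; rewrite IHs ?IHt // => i Hi; apply: H; rewrite leq_max Hi ?orbT //.
- move=> s IHs t IHt H; rewrite IHs ?IHt // => i Hi; apply: H; rewrite leq_max Hi ?orbT //.
Qed.

Lemma senv_dep (N : arith) (c : N) ts k e e' b :
  (forall i, i < maxn (foldr maxn 0 (map tbnd ts)) (b + k) -> e i = e' i) ->
  forall i, i < b -> senv c ts k e i = senv c ts k e' i.
Proof.
move=> H i Hi; rewrite /senv; case: ifP => his.
- apply: lval_dep => j Hj; apply: H; rewrite leq_max; apply/orP; left.
  apply: (leq_trans Hj); elim: ts i his {Hi Hj} => //= t ts IH [|i] /=; first by rewrite leq_maxl.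
  by move=> /IH {}IH; apply: (leq_trans IH); rewrite leq_maxr.
- apply: H; rewrite leq_max; apply/orP; right.
  by rewrite ltn_add2r; apply: (leq_ltn_trans (leq_subr _ _)).
Qed.

(** * Classes of definable predicates *)

(* A class of predicates of environments, uniform in a family of structures and
   closed under first-order operations; quantifiers act on variable 0. *)
Record cls (J : Type) (N : J -> arith) := Cls {
  cD : (forall j, (nat -> N j) -> Prop) -> Prop;
  cT : (forall j, (nat -> N j) -> N j) -> Prop;
  cD_eq : forall s t, cT s -> cT t -> cD (fun j e => s j e = t j e);
  cD_not : forall P, cD P -> cD (fun j e => ~ P j e);
  cD_and : forall P Q, cD P -> cD Q -> cD (fun j e => P j e /\ Q j e);
  cD_ex : forall P : forall j, (nat -> N j) -> N j -> Prop,
    cD (fun j e => P j (sh 1 e) (e 0)) -> cD (fun j e => exists x, P j e x);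
  cT_var : forall k, cT (fun j e => e k);
  cT_sh : forall k t, cT t -> cT (fun j e => t j (sh k e));
  cT_zero : cT (fun j e => zero);
  cT_succ : forall s, cT s -> cT (fun j e => succ (s j e));
  cT_add : forall s t, cT s -> cT t -> cT (fun j e => add (s j e) (t j e));
  cT_mul : forall s t, cT s -> cT t -> cT (fun j e => mul (s j e) (t j e)) }.

Section Closure.
Variables (J : Type) (N : J -> arith) (K : cls N).
Implicit Types P Q R : forall j, (nat -> N j) -> Prop.
Implicit Types s t : forall j, (nat -> N j) -> N j.

Lemma cD_ext P Q : (forall j e, P j e <-> Q j e) -> cD K P -> cD K Q.
Proof.
move=> H; suff -> : P = Q by [].
by apply: functional_extensionality_dep => j; apply/funext => e; apply/propext.
Qed.

Lemma cD_false : cD K (fun j e => False).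
Proof.
apply: (@cD_ext (fun j e => zero = zero /\ ~ zero = zero :> N j)).
  by move=> j e; split=> // -[_ []].
by apply: cD_and; [|apply: cD_not]; apply: cD_eq; apply: cT_zero.
Qed.

Lemma cD_true : cD K (fun j e => True).
Proof. by apply: (@cD_ext (fun j e => ~ False)) => [j e|]; [tauto|apply/cD_not/cD_false]. Qed.

Lemma cD_const (C : Prop) : cD K (fun _ _ => C).
Proof.
have [h|h] := EM C.
  by apply: cD_ext cD_true => j e; split.
by apply: cD_ext cD_false => j e; split.
Qed.

Lemma cD_or P Q : cD K P -> cD K Q -> cD K (fun j e => P j e \/ Q j e).
Proof.
move=> HP HQ; apply: (@cD_ext (fun j e => ~ (~ P j e /\ ~ Q j e))).
  move=> j e; split; last tauto.
  by move=> H; have [?|?] := EM (P j e); [left|have [?|?] := EM (Q j e); [right|case: H]].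
by apply/cD_not/cD_and; apply: cD_not.
Qed.

Lemma cD_imp P Q : cD K P -> cD K Q -> cD K (fun j e => P j e -> Q j e).
Proof.
move=> HP HQ; apply: (@cD_ext (fun j e => ~ P j e \/ Q j e)).
  by move=> j e; split; [tauto|have [?|?] := EM (P j e); tauto].
by apply: cD_or => //; apply: cD_not.
Qed.

Lemma cD_iff P Q : cD K P -> cD K Q -> cD K (fun j e => P j e <-> Q j e).
Proof. by move=> HP HQ; apply: cD_and; apply: cD_imp. Qed.

Lemma cD_all (P : forall j, (nat -> N j) -> N j -> Prop) :
  cD K (fun j e => P j (sh 1 e) (e 0)) -> cD K (fun j e => forall x, P j e x).
Proof.
move=> H; apply: (@cD_ext (fun j e => ~ exists x, ~ P j e x)); last by apply/cD_not/cD_ex/cD_not.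
move=> j e; split; last by move=> H' [x]; apply.
by move=> H' x; apply: contrapT => Hx; apply: H'; exists x.
Qed.

Lemma cD_ex2 (P Q : forall j, (nat -> N j) -> N j -> Prop) :
  cD K (fun j e => exists x, P j e x /\ Q j e x) -> cD K (fun j e => exists2 x, P j e x & Q j e x).
Proof. by apply: cD_ext => j e; split; [case=> x []|case=> x]; exists x. Qed.

Lemma cD_and3 P Q R : cD K P -> cD K Q -> cD K R ->
  cD K (fun j e => [/\ P j e, Q j e & R j e]).
Proof.
move=> HP HQ HR; apply: (@cD_ext (fun j e => P j e /\ (Q j e /\ R j e))).
  by move=> j e; split; [case=> ? []|case].
by do 2?apply: cD_and.
Qed.

Lemma cD_and4 P Q R P' : cD K P -> cD K Q -> cD K R -> cD K P' ->
  cD K (fun j e => [/\ P j e, Q j e, R j e & P' j e]).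
Proof.
move=> HP HQ HR HP'; apply: (@cD_ext (fun j e => (P j e /\ Q j e) /\ (R j e /\ P' j e))).
  by move=> j e; split; [case=> -[? ?] []|case].
by do 2?apply: cD_and.
Qed.

Lemma cD_or3 P Q R : cD K P -> cD K Q -> cD K R ->
  cD K (fun j e => [\/ P j e, Q j e | R j e]).
Proof.
move=> HP HQ HR; apply: (@cD_ext (fun j e => P j e \/ (Q j e \/ R j e))).
  move=> j e; split; last by case; tauto.
  by case=> [|[]] ?; [apply: Or31|apply: Or32|apply: Or33].
by do 2?apply: cD_or.
Qed.

Lemma cD_or4 P Q R P' : cD K P -> cD K Q -> cD K R -> cD K P' ->
  cD K (fun j e => [\/ P j e, Q j e, R j e | P' j e]).
Proof.
move=> HP HQ HR HP'; apply: (@cD_ext (fun j e => (P j e \/ Q j e) \/ (R j e \/ P' j e))).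
  move=> j e; split; last by case; tauto.
  by case=> -[] ?; [apply: Or41|apply: Or42|apply: Or43|apply: Or44].
by do 2?apply: cD_or.
Qed.

Lemma cD_unop (P : unop -> forall j, (nat -> N j) -> Prop) :
  cD K (P USucc) -> cD K (P UNeg) -> cD K (fun j e => exists o, P o j e).
Proof.
move=> H1 H2; apply: cD_ext (cD_or H1 H2) => j e; split.
  by case=> ?; [exists USucc|exists UNeg].
by case=> -[]; tauto.
Qed.

Lemma cD_binop (P : binop -> forall j, (nat -> N j) -> Prop) :
  (forall o, cD K (P o)) -> cD K (fun j e => exists o, P o j e).
Proof.
move=> H; apply: cD_ext (cD_or (H BAdd) (cD_or (H BMul) (cD_or (H BEq) (cD_or (H BAnd) (H BOr))))).
move=> j e; split; last by case=> -[]; tauto.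
by case=> [?|[?|[?|[?|?]]]]; [exists BAdd|exists BMul|exists BEq|exists BAnd|exists BOr].
Qed.

Lemma cD_quant (P : quant -> forall j, (nat -> N j) -> Prop) :
  cD K (P QEx) -> cD K (P QAll) -> cD K (fun j e => exists o, P o j e).
Proof.
move=> H1 H2; apply: cD_ext (cD_or H1 H2) => j e; split.
  by case=> ?; [exists QEx|exists QAll].
by case=> -[]; tauto.
Qed.

Lemma cT_num n : cT K (fun j e => num (N j) n).
Proof. by elim: n => [|n IH]; [apply: cT_zero|apply: cT_succ IH]. Qed.

(** Passing below a quantifier shifts the environment; no other change of environment occurs while a
    predicate is being unfolded. *)
Definition shf (w : forall j, (nat -> N j) -> (nat -> N j)) :=
  exists k, w = fun j e => sh k e.

(* Predicates of elements (with parameters in the environment) whose instances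
   at terms stay in the class, also below quantifiers. *)
Definition cP1 (X : forall j, (nat -> N j) -> N j -> Prop) :=
  forall w t, shf w -> cT K t -> cD K (fun j e => X j (w j e) (t j e)).
Definition cP2 (X : forall j, (nat -> N j) -> N j -> N j -> Prop) :=
  forall w t1 t2, shf w -> cT K t1 -> cT K t2 ->
  cD K (fun j e => X j (w j e) (t1 j e) (t2 j e)).
Definition cP3 (X : forall j, (nat -> N j) -> N j -> N j -> N j -> Prop) :=
  forall w t1 t2 t3, shf w -> cT K t1 -> cT K t2 -> cT K t3 ->
  cD K (fun j e => X j (w j e) (t1 j e) (t2 j e) (t3 j e)).

Lemma shf_id : shf (fun j e => e).
Proof.
by exists 0; apply: functional_extensionality_dep => j; apply/funext => e; apply/funext => i;
  rewrite /sh addn0.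
Qed.

Lemma cT_shf w t : shf w -> cT K t -> cT K (fun j e => t j (w j e)).
Proof. by case=> k ->; apply: cT_sh. Qed.

Lemma shf_comp w w' : shf w -> shf w' -> shf (fun j e => w j (w' j e)).
Proof.
case=> k -> [l ->]; exists (k + l).
by apply: functional_extensionality_dep => j; apply/funext => e; apply/funext => i; rewrite /sh addnA.
Qed.

Lemma shf_sh w k : shf w -> shf (fun j e => sh k (w j e)).
Proof.
case=> l ->; exists (k + l).
by apply: functional_extensionality_dep => j; apply/funext => e; apply/funext => i; rewrite /sh addnA.
Qed.

End Closure.

Lemma sh_sh (T : Type) k l (e : nat -> T) : sh k (sh l e) = sh (k + l) e.
Proof. by apply/funext => i; rewrite /sh addnA. Qed.

Lemma sh1_sc (T : Type) (a : T) (e : nat -> T) : sh 1 (sc a e) = e.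
Proof. by apply/funext => i; rewrite /sh addn1. Qed.

Lemma sc_sh1 (T : Type) (e : nat -> T) : sc (e 0) (sh 1 e) = e.
Proof. by apply/funext => -[|i] //=; rewrite /sh addn1. Qed.

(** Definability is proved by recursion on the displayed form of a predicate. The hooks are
    redefined as new classes and new atomic predicates become available. *)
Ltac dhook := fail.
Ltac dthook := fail.
Ltac dsh := cbn beta; first [ assumption | simple apply shf_id
  | simple apply shf_sh; dsh
  | match goal with
    | H : shf ?w |- shf (fun j e => ?w j (@?u j e)) => apply (@shf_comp _ _ w u); [exact H|dsh]
    end ].
Ltac dterm := cbn beta; first
  [ simple apply cT_zero | simple apply cT_succ; dterm
  | simple apply cT_add; dterm | simple apply cT_mul; dterm
  | simple apply cT_num
  | refine (cT_var _ _) | assumption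
  | match goal with
    | H : cT _ ?t |- cT _ (fun j e => ?t j (@?w j e)) => apply (@cT_shf _ _ _ w t); [dsh|exact H]
    | H : shf ?w |- cT ?K (fun j e => ?w j (@?u j e) ?k) =>
      apply (@cT_shf _ _ K (fun j e => w j (u j e)) (fun j e => e k)); [dsh|simple apply cT_var]
    end
  | dthook
  | progress (unfold pr, var, zer, un, bin, qu); dterm ].
Ltac datom := first
  [ match goal with
    | H : cP1 _ _ |- _ => simple eapply H; [dsh|dterm]
    | H : cP2 _ _ |- _ => simple eapply H; [dsh|dterm|dterm]
    | H : cP3 _ _ |- _ => simple eapply H; [dsh|dterm|dterm|dterm]
    end
  | dhook ].
Ltac dt := cbn beta;
  lazymatch goal with
  | |- cD _ (fun j e => True) => simple apply cD_true
  | |- cD _ (fun j e => False) => simple apply cD_false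
  | |- cD _ (fun j e => ~ _) => simple apply cD_not; dt
  | |- cD _ (fun j e => _ /\ _) => simple apply cD_and; dt
  | |- cD _ (fun j e => _ \/ _) => simple apply cD_or; dt
  | |- cD _ (fun j e => _ <-> _) => simple apply cD_iff; dt
  | |- cD _ (fun j e => and3 _ _ _) => simple apply cD_and3; dt
  | |- cD _ (fun j e => and4 _ _ _ _) => simple apply cD_and4; dt
  | |- cD _ (fun j e => or3 _ _ _) => simple apply cD_or3; dt
  | |- cD _ (fun j e => or4 _ _ _ _) => simple apply cD_or4; dt
  | |- cD _ (fun j e => @ex unop _) => simple apply cD_unop; dt
  | |- cD _ (fun j e => @ex binop _) => simple apply cD_binop; case; dt
  | |- cD _ (fun j e => @ex quant _) => simple apply cD_quant; dt
  | |- cD _ (fun j e => @ex _ _) => simple apply cD_ex; dt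
  | |- cD _ (fun j e => @ex2 _ _ _) => simple apply cD_ex2; dt
  | |- cD _ (fun j e => @?A j e -> @?B j e) => simple apply cD_imp; dt
  | |- cD _ (fun j e => forall x, _) => simple apply cD_all; dt
  | |- cD _ (fun j e => @eq binop _ _) => simple apply cD_const
  | |- cD _ (fun j e => @eq _ _ _) => simple apply cD_eq; dterm
  | |- cT _ _ => dterm
  | |- _ => first [ datom
     | progress (unfold elem2, elem3, elem, lt_of, le_of, least_code, is_fun, is_seq,
         delta, extend, agree_off, direct_subformula, rec1, rec2, rec3); dt ]
  end.

Fixpoint lren (f : nat -> nat) (t : ltm) : ltm :=
  match t with
  | LV i => LV (f i) | LZ => LZ | LC => LC
  | LS t => LS (lren f t) | LA s t => LA (lren f s) (lren f t) | LM s t => LM (lren f s) (lren f t)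
  end.

Lemma lval_ren (N : arith) (c : N) f t e : lval c e (lren f t) = lval c (e \o f) t.
Proof. by elim: t => //= [t ->|s -> t ->|s -> t ->]. Qed.

Definition pcat (N : arith) (l : seq N) (e : nat -> N) : nat -> N :=
  fun i => if i < size l then nth zero l i else e (i - size l).

Lemma pcat_nil (N : arith) (e : nat -> N) : pcat [::] e = e.
Proof. by apply/funext => i; rewrite /pcat subn0. Qed.

Lemma pcat_cons (N : arith) a (l : seq N) (e : nat -> N) : pcat (a :: l) e = sc a (pcat l e).
Proof. by apply/funext => -[|i]. Qed.

Lemma pcat_rcons (N : arith) a (l : seq N) (e : nat -> N) : pcat (rcons l a) e = pcat l (sc a e).
Proof.
apply/funext => i; rewrite /pcat size_rcons nth_rcons ltnS.
case: ltngtP => hi //; last by rewrite hi subnn.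
by rewrite -(subnKC hi) addSn subSS !addKn subSn ?leq_addr // addKn.
Qed.

(** * Predicates defined by one formula in all structures *)

Section UniformClass.

Let ud (P : forall N : pre, (nat -> N) -> Prop) : Prop :=
  exists q, forall N e, P N e <-> Sat q e.
Let ut (t : forall N : pre, (nat -> N) -> N) : Prop :=
  exists u, forall N e, t N e = lval cc e u.

(** A single formula without parameters serves every structure, so these are the statements that can
    be carried from one structure to another. *)
Definition UD : cls car.
Proof.
exists ud ut.
- by move=> s t [u hu] [v hv]; exists (LEq u v) => N e; rewrite Sat_eq hu hv.
- by move=> P [q hq]; exists (LNeg q) => N e; rewrite Sat_neg hq.
- by move=> P Q [q hq] [r hr]; exists (LAnd q r) => N e; rewrite Sat_and hq hr.
- move=> P [q hq]; exists (LEx q) => N e; rewrite Sat_ex; split=> -[x hx]; exists x.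
    by apply/hq; rewrite sh1_sc.
  by move/hq: hx; rewrite sh1_sc.
- by move=> k; exists (LV k).
- move=> k t [u hu]; exists (lren (addn^~ k) u) => N e; rewrite hu lval_ren.
  by congr (lval _ _ u); apply/funext.
- by exists LZ.
- by move=> s [u hu]; exists (LS u) => N e; rewrite hu.
- by move=> s t [u hu] [v hv]; exists (LA u v) => N e; rewrite hu hv.
- by move=> s t [u hu] [v hv]; exists (LM u v) => N e; rewrite hu hv.
Defined.

Lemma UD_spec P : cD UD P <-> exists q, forall (N : pre) e, P N e <-> Sat q e.
Proof. by []. Qed.

Lemma UT_cc : cT UD (fun N e => cc).
Proof. by exists LC. Qed.

Lemma UD_sub (ts : seq (forall N : pre, (nat -> N) -> N)) w p :
  shf w -> (forall t, List.In t ts -> cT UD t) ->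
  cD UD (fun N e => Sat p (pcat [seq t N e | t <- ts] (w N e))).
Proof.
case=> k -> H.
have [us hus] : exists us : seq ltm, forall (N : pre) e, [seq t N e | t <- ts] = [seq lval cc e u | u <- us].
  elim: ts H => [|t ts IH] H; first by exists [::].
  have [|us hus] := IH; first by move=> t' ?; apply: H; right.
  have [|u hu] := H t; first by left.
  by exists (u :: us) => N e /=; rewrite hu hus.
exists (LSub us k p) => N e; rewrite Sat_sub hus.
suff -> : senv cc us k e = pcat [seq lval cc e u | u <- us] (sh k e) by [].
by apply/funext => i; rewrite /senv /pcat size_map; case: ifP => // hi; rewrite (nth_map LZ).
Qed.

Lemma UD_P1 p : cP1 UD (fun N e x => Sat p (sc x e)).
Proof.
move=> w t hw ht; apply: cD_ext (UD_sub (ts := [:: t]) p hw _) => [N e|t' /= [<-|[]] //].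
by rewrite /= pcat_cons pcat_nil.
Qed.

Lemma UD_P2 p : cP2 UD (fun N e x y => Sat p (sc x (sc y e))).
Proof.
move=> w t1 t2 hw h1 h2.
apply: cD_ext (UD_sub (ts := [:: t1; t2]) p hw _) => [N e|t' /= [<-|[<-|[]]] //].
by rewrite /= !pcat_cons pcat_nil.
Qed.

Lemma UD_P3 p : cP3 UD (fun N e x y z => Sat p (sc x (sc y (sc z e)))).
Proof.
move=> w t1 t2 t3 hw h1 h2 h3.
apply: cD_ext (UD_sub (ts := [:: t1; t2; t3]) p hw _) => [N e|t' /= [<-|[<-|[<-|[]]]] //].
by rewrite /= !pcat_cons pcat_nil.
Qed.

End UniformClass.

Ltac dthook ::= simple apply UT_cc.
Ltac dhook ::= first [simple eapply UD_P1 | simple eapply UD_P2 | simple eapply UD_P3];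
  [dsh|dterm..].

(** * Predicates definable with parameters in one structure *)

Section ParametricClass.
Variable N : pre.
Implicit Types (l : seq N) (e : nat -> N).

Let dd (P : unit -> (nat -> N) -> Prop) : Prop :=
  exists l q, forall e, P tt e <-> Sat q (pcat l e).
Let dtm (t : unit -> (nat -> N) -> N) : Prop :=
  exists l u, forall e, t tt e = lval cc (pcat l e) u.

Let shiftr l1 l2 e : pcat l2 e = pcat (l1 ++ l2) e \o (fun i => i + size l1).
Proof.
apply/funext => i /=; rewrite /pcat size_cat.
rewrite [i + _]addnC ltn_add2l subnDl nth_cat -ltn_subRL subnn ltn0 addKn.
by [].
Qed.

Let shiftl l1 l2 e :
  pcat l1 e = pcat (l1 ++ l2) e \o (fun i => if i < size l1 then i else i + size l2).
Proof.
apply/funext => i /=; rewrite /pcat size_cat nth_cat.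
case: ifP => hi; first by rewrite hi (leq_trans hi) ?leq_addr.
by rewrite ltn_add2r hi subnDr.
Qed.

Let dtm2 (f : N -> N -> N) (op : ltm -> ltm -> ltm) s t :
  (forall e u v, lval cc e (op u v) = f (lval cc e u) (lval cc e v)) ->
  dtm s -> dtm t -> dtm (fun j e => f (s j e) (t j e)).
Proof.
move=> hop [l1 [u1 h1]] [l2 [u2 h2]]; exists (l1 ++ l2).
exists (op (lren (fun i => if i < size l1 then i else i + size l2) u1) (lren (fun i => i + size l1) u2)).
by move=> e; rewrite hop !lval_ren -shiftr -shiftl h1 h2.
Qed.

Let subr l1 l2 e p : Sat (LSub [::] (size l1) p) (pcat (l1 ++ l2) e) <-> Sat p (pcat l2 e).
Proof.
rewrite Sat_sub (shiftr l1 l2 e).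
suff -> : senv cc [::] (size l1) (pcat (l1 ++ l2) e) = pcat (l1 ++ l2) e \o (fun i => i + size l1) by [].
by apply/funext => i; rewrite /senv /= subn0.
Qed.

Let subl l1 l2 e p :
  Sat (LSub (mkseq LV (size l1)) (size l1 + size l2) p) (pcat (l1 ++ l2) e) <-> Sat p (pcat l1 e).
Proof.
rewrite Sat_sub (shiftl l1 l2 e).
suff -> : senv cc (mkseq LV (size l1)) (size l1 + size l2) (pcat (l1 ++ l2) e) = 
   pcat (l1 ++ l2) e \o (fun i => if i < size l1 then i else i + size l2) by [].
apply/funext => i; rewrite /senv /= size_mkseq; case: ifP => hi; first by rewrite nth_mkseq.
by rewrite addnA subnK // leqNgt hi.
Qed.

(** Parameters stand before the variables. Combining two predicates concatenates their parameter
    lists and reindexes; below a quantifier the bound variable, met at place 0, has to be moved past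
    the parameters. *)
Definition Dn : cls (fun _ : unit => car N).
Proof.
exists dd dtm.
- move=> s t [l1 [u1 h1]] [l2 [u2 h2]]; exists (l1 ++ l2).
  exists (LEq (lren (fun i => if i < size l1 then i else i + size l2) u1) (lren (fun i => i + size l1) u2)).
  by move=> e; rewrite Sat_eq !lval_ren -shiftr -shiftl h1 h2.
- by move=> P [l [q hq]]; exists l, (LNeg q) => e; rewrite Sat_neg hq.
- move=> P Q [l1 [q1 h1]] [l2 [q2 h2]]; exists (l1 ++ l2).
  exists (LAnd (LSub (mkseq LV (size l1)) (size l1 + size l2) q1) (LSub [::] (size l1) q2)) => e.
  by rewrite Sat_and subl subr h1 h2.
- move=> P [l [q hq]]; exists l.
  exists (LEx (LSub (rcons (mkseq (fun i => LV i.+1) (size l)) (LV 0)) (size l).+1 q)) => e.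
  rewrite Sat_ex.
  have E x : pcat l (sc x e) = senv cc (rcons (mkseq (fun i => LV i.+1) (size l)) (LV 0)) (size l).+1
      (sc x (pcat l e)).
    apply/funext => i; rewrite /senv size_rcons size_mkseq nth_rcons size_mkseq ltnS.
    case: (ltngtP i (size l)) => hi.
    + by rewrite nth_mkseq //= /pcat hi.
    + rewrite -(subnKC hi); set k := i - _.
      have -> : (size l).+1 + k - (size l).+1 + (size l).+1 = (k + size l).+1 by rewrite addKn addnS.
      rewrite /= /pcat ltnNge (leq_trans (leqnSn _)) ?leq_addr //= ltnNge leq_addl /= addnK.
      by rewrite addSn -addnS addKn.
    + by rewrite hi /pcat ltnn subnn.
  split=> -[x hx]; exists x; first by rewrite Sat_sub -E; apply/hq; rewrite sh1_sc.
  by move: hx; rewrite Sat_sub -E => /hq; rewrite sh1_sc.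
- by move=> k; exists [::], (LV k) => e; rewrite /= pcat_nil.
- move=> k t [l [u hu]]; exists l, (lren (fun i => if i < size l then i else i + k) u) => e.
  rewrite hu lval_ren; congr (lval _ _ u); apply/funext => i /=; rewrite /pcat /sh.
  case: ifP => hi; first by rewrite hi.
  by move/negbT: hi; rewrite -leqNgt => hi; rewrite ltnNge (leq_trans hi) ?leq_addr //= addnBAC.
- by exists [::], LZ.
- by move=> s [l [u hu]]; exists l, (LS u) => e; rewrite hu.
- by move=> s t; apply: (dtm2 (op := LA)).
- by move=> s t; apply: (dtm2 (op := LM)).
Defined.

Lemma Dn_spec P : cD Dn P <-> exists l q, forall e, P tt e <-> Sat q (pcat l e).
Proof. by []. Qed.

Lemma DT_const a : cT Dn (fun _ _ => a).
Proof. by exists [:: a], (LV 0). Qed.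

Definition D1 (A : N -> Prop) := cD Dn (fun _ e => A (e 0)).
Definition D2 (A : N -> N -> Prop) := cD Dn (fun _ e => A (e 0) (e 1)).
Definition D3 (A : N -> N -> N -> Prop) := cD Dn (fun _ e => A (e 0) (e 1) (e 2)).

(** A quantified variable equated with the term stands in for a substitution into the defining
    formula. *)
Lemma D1_app A (t : unit -> (nat -> N) -> N) : D1 A -> cT Dn t -> cD Dn (fun j e => A (t j e)).
Proof.
move=> hA ht; apply: (@cD_ext _ _ _ (fun j e => exists x, x = t j e /\ A x)).
  by move=> j e; split; [case=> x [->]|exists (t j e)].
apply: cD_ex; apply: cD_and => //; apply: cD_eq; first exact: cT_var.
by apply: (cT_shf (w := fun j e => sh 1 e)) => //; dsh.
Qed.

Lemma D2_app A (s t : unit -> (nat -> N) -> N) :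
  D2 A -> cT Dn s -> cT Dn t -> cD Dn (fun j e => A (s j e) (t j e)).
Proof.
move=> hA hs ht.
apply: (@cD_ext _ _ _ (fun j e => exists y x, (x = s j e /\ y = t j e) /\ A x y)).
  by move=> j e; split; [case=> x [y [[-> ->]]]|exists (t j e), (s j e)].
do 2!apply: cD_ex; apply: cD_and => //; do 1?apply: cD_and; apply: cD_eq;
  try exact: (cT_var _ 0); try exact: (cT_var _ 1).
all: have hw : shf (N := fun _ : unit => car N) (fun j e => sh 1 (sh 1 e)) by dsh.
all: first [exact (cT_shf hw hs) | exact (cT_shf hw ht)].
Qed.

Lemma D3_app A (s t u : unit -> (nat -> N) -> N) :
  D3 A -> cT Dn s -> cT Dn t -> cT Dn u -> cD Dn (fun j e => A (s j e) (t j e) (u j e)).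
Proof.
move=> hA hs ht hu.
apply: (@cD_ext _ _ _ (fun j e => exists z y x, (x = s j e /\ y = t j e /\ z = u j e) /\ A x y z)).
  by move=> j e; split; [case=> x [y [z [[-> [-> ->]]]]]|exists (u j e), (t j e), (s j e)].
do 3!apply: cD_ex; apply: cD_and => //; do 2?apply: cD_and; apply: cD_eq;
  try exact: (cT_var _ 0); try exact: (cT_var _ 1); try exact: (cT_var _ 2).
all: have hw : shf (N := fun _ : unit => car N) (fun j e => sh 1 (sh 1 (sh 1 e))) by dsh.
all: first [exact (cT_shf hw hs) | exact (cT_shf hw ht) | exact (cT_shf hw hu)].
Qed.

End ParametricClass.

Global Opaque UD Dn.

(** * Arithmetic in a model of induction *)

(** Induction is required for all predicates of the extended language, iterations included: the
    counting arguments on stages of an iteration rest on it. *)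
Record ipre (N : pre) : Prop := IPre {
  ax_S0 : forall x : N, succ x <> zero;
  ax_Sinj : forall x y : N, succ x = succ y -> x = y;
  ax_add0 : forall x : N, add x zero = x;
  ax_addS : forall x y : N, add x (succ y) = succ (add x y);
  ax_mul0 : forall x : N, mul x zero = zero;
  ax_mulS : forall x y : N, mul x (succ y) = add (mul x y) x;
  ax_ind : forall A : N -> Prop, D1 A -> A zero -> (forall x, A x -> A (succ x)) -> forall x, A x }.

Ltac dthook ::= first [simple apply UT_cc | simple apply DT_const].
Ltac dhook ::= first
  [ match goal with
    | H : D1 _ |- _ => apply (D1_app H); dterm
    | H : D2 _ |- _ => apply (D2_app H); dterm
    | H : D3 _ |- _ => apply (D3_app H); dterm
    end
  | simple eapply UD_P1; [dsh|dterm..] | simple eapply UD_P2; [dsh|dterm..]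
  | simple eapply UD_P3; [dsh|dterm..] ].
Ltac ddt := unfold D1, D2, D3; dt.

Declare Scope arith_scope.
Notation "x ⊕ y" := (add x y) (at level 50, left associativity) : arith_scope.
Notation "x ⊗ y" := (mul x y) (at level 40, left associativity) : arith_scope.
Notation "x ≺ y" := (lt_of x y) (at level 70) : arith_scope.
Notation "x ≼ y" := (le_of x y) (at level 70) : arith_scope.
Local Open Scope arith_scope.

Section Arith.
Variable N : pre.
Hypothesis HN : ipre N.
Implicit Types x y z a b c d m s t u v : N.
Local Notation "0" := (@zero (car N)) : arith_scope.
Local Notation "1" := (num N 1) : arith_scope.
Local Notation S := succ.

Let addn0 := ax_add0 HN.
Let addnS := ax_addS HN.
Let muln0 := ax_mul0 HN.
Let mulnS := ax_mulS HN.

Lemma N_ind (A : N -> Prop) : D1 A -> A 0 -> (forall x, A x -> A (S x)) -> forall x, A x.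
Proof. exact: (ax_ind HN). Qed.

Let add0n x : 0 ⊕ x = x.
Proof.
move: x; apply: N_ind => [||x IH]; [by ddt|exact: addn0|].
by rewrite addnS IH.
Qed.

Let addSn x y : S x ⊕ y = S (x ⊕ y).
Proof.
move: y; apply: N_ind => [||y IH]; first by ddt.
  by rewrite !addn0.
by rewrite !addnS IH.
Qed.

Lemma N_addC x y : x ⊕ y = y ⊕ x.
Proof.
move: y; apply: N_ind => [||y IH]; first by ddt.
  by rewrite addn0 add0n.
by rewrite addnS addSn IH.
Qed.

Lemma N_addA x y z : x ⊕ (y ⊕ z) = (x ⊕ y) ⊕ z.
Proof.
move: z; apply: N_ind => [||z IH]; first by ddt.
  by rewrite !addn0.
by rewrite !addnS IH.
Qed.

Let mul0n x : 0 ⊗ x = 0.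
Proof.
move: x; apply: N_ind => [||x IH]; [by ddt|exact: muln0|].
by rewrite mulnS IH addn0.
Qed.

Let mulSn x y : S x ⊗ y = x ⊗ y ⊕ y.
Proof.
move: y; apply: N_ind => [||y IH]; first by ddt.
  by rewrite !muln0 addn0.
by rewrite !mulnS IH !addnS -!N_addA [y ⊕ x]N_addC.
Qed.

Lemma N_mulC x y : x ⊗ y = y ⊗ x.
Proof.
move: y; apply: N_ind => [||y IH]; first by ddt.
  by rewrite muln0 mul0n.
by rewrite mulnS mulSn IH.
Qed.

Lemma N_mulDl x y z : (x ⊕ y) ⊗ z = x ⊗ z ⊕ y ⊗ z.
Proof.
move: z; apply: N_ind => [||z IH]; first by ddt.
  by rewrite !muln0 addn0.
rewrite !mulnS IH -!N_addA; congr (_ ⊕ _).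
by rewrite N_addC -N_addA; congr (_ ⊕ _); rewrite N_addC.
Qed.

Lemma N_mulA x y z : x ⊗ (y ⊗ z) = (x ⊗ y) ⊗ z.
Proof.
move: z; apply: N_ind => [||z IH]; first by ddt.
  by rewrite !muln0.
by rewrite !mulnS -IH ![x ⊗ _]N_mulC N_mulDl.
Qed.

Lemma N_semiring : semi_ring_theory 0 1 (@add N) (@mul N) eq.
Proof.
split.
- exact: add0n.
- exact: N_addC.
- exact: N_addA.
- by move=> x; rewrite mulSn mul0n add0n.
- exact: mul0n.
- exact: N_mulC.
- exact: N_mulA.
- exact: N_mulDl.
Qed.

Lemma succE x : S x = x ⊕ 1.
Proof. by rewrite /= addnS addn0. Qed.

Add Ring Nring : N_semiring.

Ltac nring := rewrite ?succE; ring.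

Lemma add_cancel z x y : z ⊕ x = z ⊕ y -> x = y.
Proof.
move: z; apply: N_ind => [||z IH]; first by ddt.
  by rewrite !add0n.
by rewrite !addSn => /(ax_Sinj HN).
Qed.

Lemma add_eq0 x y : x ⊕ y = 0 -> x = 0.
Proof.
move: y; apply: N_ind => [||y _]; [by ddt|by rewrite addn0|].
by rewrite addnS => /(ax_S0 HN).
Qed.

Lemma zero_or_succ x : x = 0 \/ exists y, x = S y.
Proof. by move: x; apply: N_ind => [||x _]; [ddt|left|right; exists x]. Qed.

Lemma lt_irr x : ~ x ≺ x.
Proof. by case=> z; rewrite -{2}(addn0 x) => /add_cancel/(ax_S0 HN). Qed.

Lemma le_refl x : x ≼ x. Proof. by exists 0. Qed.

Lemma le_trans y x z : x ≼ y -> y ≼ z -> x ≼ z.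
Proof. by case=> u <- [v <-]; exists (u ⊕ v); rewrite N_addA. Qed.

Lemma ltW x y : x ≺ y -> x ≼ y.
Proof. by case=> z <-; exists (S z). Qed.

Lemma le0 x : 0 ≼ x. Proof. by exists x. Qed.

Lemma lt0S x : 0 ≺ S x. Proof. by exists x. Qed.

Lemma lt0 x : ~ x ≺ 0.
Proof. by case=> z; rewrite addnS => /(ax_S0 HN). Qed.

Lemma leS x y : x ≺ S y <-> x ≼ y.
Proof.
by split=> -[z]; [rewrite addnS => /(ax_Sinj HN)|move=> <-]; exists z; rewrite ?addnS.
Qed.

Lemma ltS x : x ≺ S x. Proof. exact/leS/le_refl. Qed.

Lemma ltSle x y : x ≺ y <-> S x ≼ y.
Proof. by split=> -[z <-]; exists z; rewrite ?addnS addSn. Qed.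

Lemma lt_le_trans y x z : x ≺ y -> y ≼ z -> x ≺ z.
Proof. by rewrite !ltSle; apply: le_trans. Qed.

Lemma le_lt_trans y x z : x ≼ y -> y ≺ z -> x ≺ z.
Proof. by rewrite -!leS => xy /ltSle; apply: lt_le_trans. Qed.

Lemma lt_trans y x z : x ≺ y -> y ≺ z -> x ≺ z.
Proof. by move/ltW; apply: le_lt_trans. Qed.

Lemma le_eq x y : x ≼ y -> x = y \/ x ≺ y.
Proof.
by case=> z <-; have [->|[w ->]] := zero_or_succ z; [left; rewrite addn0|right; exists w].
Qed.

Lemma lt_total x y : x ≺ y \/ y ≼ x.
Proof.
move: x; apply: N_ind => [||x [/ltSle/le_eq [<-|h]|h]]; first by ddt.
- by have [->|[z ->]] := zero_or_succ y; [right; apply: le_refl|left; apply: lt0S].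
- by right; apply: le_refl.
- by left.
- by right; apply: le_trans h _; apply/ltW/ltS.
Qed.

Lemma le_total x y : x ≼ y \/ y ≼ x.
Proof. by have [/ltW|] := lt_total x y; [left|right]. Qed.

Lemma le_anti x y : x ≼ y -> y ≼ x -> x = y.
Proof. by move=> /le_eq [//|h h']; have := lt_irr (lt_le_trans h h'). Qed.

Lemma N_sind (A : N -> Prop) : D1 A ->
  (forall x, (forall y, y ≺ x -> A y) -> A x) -> forall x, A x.
Proof.
move=> hA H x; apply: (N_ind (A := fun x => forall y, y ≺ x -> A y)) (ltS x) => //.
- by ddt.
- by move=> y /lt0.
- move=> z IH y /leS/le_eq [->|]; [exact: H|exact: IH].
Qed.

Lemma N_least (A : N -> Prop) x : D1 A -> A x ->
  exists y, [/\ A y, y ≼ x & forall z, z ≺ y -> ~ A z].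
Proof.
move=> hA Ax.
have [y [Ay hy]] : exists y, A y /\ forall z, z ≺ y -> ~ A z.
  apply: contrapT => H; suff : ~ A x by [].
  move: x {Ax}; apply: N_sind => [|x IH Ax]; first by ddt.
  by apply: H; exists x.
by exists y; split=> //; have [/hy|] := lt_total x y.
Qed.

Lemma le_addr x y : x ≼ x ⊕ y. Proof. by exists y. Qed.
Lemma le_addl x y : x ≼ y ⊕ x. Proof. by rewrite N_addC; exists y. Qed.

Lemma le_add x y x' y' : x ≼ x' -> y ≼ y' -> x ⊕ y ≼ x' ⊕ y'.
Proof. by case=> u <- [v <-]; exists (u ⊕ v); ring. Qed.

Lemma le_mul x y x' y' : x ≼ x' -> y ≼ y' -> x ⊗ y ≼ x' ⊗ y'.
Proof. by case=> u <- [v <-]; exists (x ⊗ v ⊕ u ⊗ y ⊕ u ⊗ v); ring. Qed.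

Lemma le_sqr x : x ≼ x ⊗ x.
Proof.
have [->|[y ->]] := zero_or_succ x; first exact: le0.
by exists (S y ⊗ y); nring.
Qed.

Lemma num_lt n x : x ≺ num N n <-> exists2 k, k < n & x = num N k.
Proof.
elim: n x => [|n IH] x; first by split=> [/lt0|[]].
split=> [/leS/le_eq [->|/IH [k hk ->]]|[k]]; first by exists n.
  by exists k => //; apply: ltnW.
rewrite ltnS leq_eqVlt => /orP [/eqP -> ->|hk hx]; first exact: ltS.
by apply: lt_trans (ltS _); apply/IH; exists k.
Qed.

Lemma num_inj : injective (num N).
Proof.
move=> m n; have [h|h|//] := ltngtP m n => E.
  have /lt_irr : num N m ≺ num N m by rewrite {2}E; apply/num_lt; exists m.
  by [].
have /lt_irr : num N n ≺ num N n by rewrite -{2}E; apply/num_lt; exists n.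
by [].
Qed.

(** * Pairs and coded sets *)

Lemma le_pr x y : x ⊕ y ≼ pr x y.
Proof. by apply: le_trans (le_sqr _) (le_addr _ _). Qed.

Lemma le_pr1 x y : x ≼ pr x y.
Proof. exact: le_trans (le_addr x y) (le_pr x y). Qed.

Lemma le_pr2 x y : y ≼ pr x y.
Proof. exact: le_trans (le_addl y x) (le_pr x y). Qed.

Lemma lt_pr2 x y : 0 ≺ x -> y ≺ pr x y.
Proof.
case=> z; rewrite add0n => <-; apply: (lt_le_trans (y := S z ⊕ y)).
  by rewrite addSn; apply/leS/le_addl.
exact: le_pr.
Qed.

Lemma pr_mono x y x' y' : x ≼ x' -> y ≼ y' -> pr x y ≼ pr x' y'.
Proof. by move=> h1 h2; do !apply: le_add => //; apply: le_mul; apply: le_add. Qed.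

(** The sum is recovered first: successive squares lie further apart than the summand [x], which is
    at most the sum. *)
Lemma pr_inj x y x' y' : pr x y = pr x' y' -> x = x' /\ y = y'.
Proof.
have aux u v u' v' : u ⊕ v ≺ u' ⊕ v' -> pr u v <> pr u' v'.
  move=> /ltSle h E; apply: (@lt_irr (pr u v)).
  apply: (@lt_le_trans (S (u ⊕ v) ⊗ S (u ⊕ v))).
    by exists (u ⊕ v ⊕ v); rewrite /pr; nring.
  by rewrite E; apply: le_trans (le_addr _ _); apply: le_mul.
move=> E; have [/aux|h1] := lt_total (x ⊕ y) (x' ⊕ y'); first by move/(_ E).
have [/aux|h2] := lt_total (x' ⊕ y') (x ⊕ y); first by rewrite E; move/(_ erefl).
have hs := le_anti h1 h2; move: E; rewrite /pr hs => /add_cancel ?; subst x'.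
by move: hs => /add_cancel.
Qed.

Definition dvd m x := exists q, x = q ⊗ m.
(** Coprimality in the form of cancellation, which avoids greatest common divisors. *)
Definition cop m x := forall z, dvd m (z ⊗ x) -> dvd m z.

Lemma dvd_mull m x y : dvd m x -> dvd m (y ⊗ x).
Proof. by case=> q ->; exists (y ⊗ q); ring. Qed.

Lemma dvd_cancel m x y : dvd m (x ⊕ y) -> dvd m x -> dvd m y.
Proof.
case=> q hq [r hr]; move: hq; rewrite hr; have [[u <-]|[u <-]] := le_total r q.
  by rewrite N_mulDl => /add_cancel ->; exists u.
rewrite N_mulDl -N_addA -{2}(addn0 (q ⊗ m)) => /add_cancel.
by rewrite N_addC => /add_eq0 ->; exists 0; rewrite mul0n.
Qed.

Lemma cop_mul m x y : cop m x -> cop m y -> cop m (x ⊗ y).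
Proof. by move=> hx hy z; rewrite N_mulA => /hy/hx. Qed.

Definition bmod d x := S (S x ⊗ d).

Lemma cop_bmod d x : cop (bmod d x) d.
Proof.
move=> z /(@dvd_mull _ _ (S x)) h; apply: (@dvd_cancel _ (S x ⊗ (z ⊗ d))) => //.
by exists z; rewrite /bmod; nring.
Qed.

(** Eliminating between the two moduli leaves [z] times the difference of the indices. That
    difference divides [d], to which every modulus is coprime. *)
Lemma cop_bmods d x y b : (forall i, i ≼ b -> i <> 0 -> dvd i d) ->
  x ≺ b -> y ≺ b -> x <> y -> cop (bmod d x) (bmod d y).
Proof.
move=> hd hx hy xy z hz.
suff [w hw [r hr]] : exists2 w, w ≼ b & exists r, w = S r /\ dvd (bmod d x) (z ⊗ w).
  move: hr => [wr hr]; have [|q hq] := hd _ hw; first by rewrite wr => /(ax_S0 HN).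
  apply: (@cop_bmod d).
  have -> : z ⊗ d = q ⊗ (z ⊗ w) by rewrite hq; ring.
  exact: dvd_mull.
have bound u v r : u ⊕ S r = v -> v ≺ b -> S r ≼ b.
  by move=> <- /ltW; apply: le_trans; apply: le_addl.
have [[r hr]|/le_eq [/esym //|[r hr]]] := lt_total x y.
  exists (S r); first exact: bound hr hy.
  exists r; split=> //; apply: (@dvd_cancel _ (z ⊗ S x ⊗ bmod d y)).
    by exists (z ⊗ S y); rewrite -hr /bmod; nring.
  have -> : z ⊗ S x ⊗ bmod d y = S x ⊗ (z ⊗ bmod d y) by ring.
  exact: dvd_mull.
exists (S r); first exact: bound hr hx.
exists r; split=> //; apply: (@dvd_cancel _ (z ⊗ S y ⊗ bmod d x)); last by exists (z ⊗ S y).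
have -> : z ⊗ S y ⊗ bmod d x ⊕ z ⊗ S r = S x ⊗ (z ⊗ bmod d y).
  by rewrite -hr /bmod; nring.
exact: dvd_mull.
Qed.

(** Plays the part of a factorial, obtained by induction on its divisibility property alone. *)
Lemma common_multiple b : exists2 d, d <> 0 & forall i, i ≼ b -> i <> 0 -> dvd i d.
Proof.
move: b; apply: N_ind => [||b [d d0 hd]]; first by rewrite /dvd; ddt.
  exists 1; first exact: (ax_S0 HN).
  by move=> i hi []; apply: le_anti hi (le0 _).
exists (d ⊗ S b).
  by rewrite mulnS; case: (zero_or_succ d) d0 => [->//|[e -> _]]; rewrite addnS => /(ax_S0 HN).
move=> i /le_eq [-> _|/leS hi i0]; first by exists d.
by rewrite N_mulC; apply: dvd_mull; apply: hd.
Qed.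

(** The code is the product of the moduli at the members, built by induction while the moduli at
    non-members stay coprime to it. *)
Lemma comprehension (X : N -> Prop) b : D1 X -> exists s, forall x, elem x s <-> x ≺ b /\ X x.
Proof.
move=> hX; have [d d0 hd] := common_multiple b.
have key k : k ≼ b -> exists c, forall x, x ≺ b ->
    (x ≺ k /\ X x -> dvd (bmod d x) c) /\ (~ (x ≺ k /\ X x) -> cop (bmod d x) c).
  move: k; apply: N_ind => [||k IH].
  - by rewrite /bmod /cop /dvd; ddt.
  - move=> _; exists 1 => x _; split; first by case=> /lt0.
    move=> _ z; have -> : z ⊗ 1 = z by ring.
    by [].
  - move=> /ltSle hk; have [c hc] := IH (ltW hk).
    have [Xk|Xk] := EM (X k); last first.
      exists c => x hx; have [h1 h2] := hc x hx; split; first case.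
        by move=> /leS/le_eq [-> //|? ?]; apply: h1.
      by move=> h; apply: h2 => -[h3 h4]; apply: h; split=> //; apply: lt_trans h3 (ltS _).
    exists (c ⊗ bmod d k) => x hx; have [h1 h2] := hc x hx.
    have [->|xk] := EM (x = k).
      by split; [move=> _; exists c|move=> []; split=> //; apply: ltS].
    split; first case.
      by move=> /leS/le_eq [//|? ?]; rewrite N_mulC; apply: dvd_mull; apply: h1.
    move=> h; apply: cop_mul; last exact: cop_bmods hd _ _ _.
    by apply: h2 => -[h3 h4]; apply: h; split=> //; apply: lt_trans h3 (ltS _).
have [c hc] := key b (le_refl b).
exists (pr b (pr c d)) => x; split=> [[b' [c' [d' [q [/pr_inj [<- /pr_inj [<- <-]] hx hq]]]]]|[hx Xx]].
  split=> //; apply: contrapT => Xx; have [_ h2] := hc x hx.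
  (* A modulus coprime to [c] that divides [c] would divide 1, which is excluded because [d] is not
     zero. *)
  have : dvd (bmod d x) 1.
    by apply: h2; [case|exists q; rewrite hq /bmod; nring].
  case: (zero_or_succ d) d0 => [->//|[e ->] _ [r]]; rewrite /bmod.
  have [->|[r' ->]] := zero_or_succ r; first by rewrite mul0n => /(ax_S0 HN).
  rewrite mulnS addnS => /(ax_Sinj HN)/esym/add_eq0.
  by rewrite mulnS addnS mulnS addnS => /(ax_S0 HN).
have [h1 _] := hc x hx; have [//|q hq] := h1.
by exists b, c, d, q.
Qed.
End Arith.

Section Codes.
Variable N : pre.
Hypothesis HN : ipre N.
Implicit Types x y z a b c d m s t u v F G : N.
Local Notation "0" := (@zero (car N)) : arith_scope.
Local Notation S := succ.

Lemma elem_lt x s : elem x s -> x ≺ s.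
Proof. by case=> b [c [d [q [-> h _]]]]; apply: (lt_le_trans HN h); apply: le_pr1. Qed.

Lemma elem2_lt x y s : elem2 x y s -> x ≺ s /\ y ≺ s.
Proof.
by move/elem_lt => h; split; apply: (le_lt_trans HN _ h); [apply: le_pr1|apply: le_pr2].
Qed.

Lemma elem_zero x : ~ elem x (0 : N).
Proof. by move/elem_lt/(lt0 HN). Qed.

Lemma elem_code (X : N -> Prop) b : D1 X -> (forall x, X x -> x ≺ b) ->
  exists s, least_code s /\ forall x, elem x s <-> X x.
Proof.
move=> hX hb; have [s hs] := comprehension HN b hX.
have [||t [ht _ hmin]] := @N_least _ HN (fun t => forall x, elem x t <-> X x) s.
- by ddt.
- by move=> x; rewrite hs; split=> [[]//|h]; split=> //; apply: hb.
exists t; split=> // u hu h; apply: (hmin u hu) => x.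
by rewrite h ht.
Qed.

Lemma least_code_inj s t : least_code s -> least_code t ->
  (forall x, elem x s <-> elem x t) -> s = t.
Proof.
move=> hs ht h; have [hst|/(le_eq HN) [//|hts]] := lt_total HN s t.
  by case: (ht s hst).
by case: (hs t hts) => x; rewrite h.
Qed.

Lemma least_code_zero : least_code (0 : N).
Proof. by move=> u /(lt0 HN). Qed.

Lemma elem_setU F G : exists s, forall x, elem x s <-> elem x F \/ elem x G.
Proof.
have [||s [_ hs]] := @elem_code (fun x => elem x F \/ elem x G) (F ⊕ G); [by ddt| |by exists s].
move=> x [] /elem_lt h; apply: (lt_le_trans HN h); first exact: le_addr.
exact: (le_addl HN).
Qed.

Lemma elem_setU1 F a : exists s, forall x, elem x s <-> x = a \/ elem x F.
Proof.
have [||s [_ hs]] := @elem_code (fun x => x = a \/ elem x F) (F ⊕ S a); [by ddt| |by exists s].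
move=> x [->|/elem_lt h]; first exact: (lt_le_trans HN (ltS HN a) (le_addl HN _ _)).
by apply: (lt_le_trans HN h); apply: le_addr.
Qed.

Lemma extend_ex al v a : is_fun al -> exists be, is_fun be /\ extend al v a be.
Proof.
move=> [_ hp hf].
pose X x := exists j m, x = pr j m /\ ((j = v /\ m = a) \/ (j <> v /\ elem2 j m al)).
have [||be [lb hb]] := @elem_code X (al ⊕ S (pr v a)).
- by rewrite /X; ddt.
- move=> x [j [m [-> [[-> ->]|[_ /elem_lt h]]]]].
    exact: (lt_le_trans HN (ltS HN _) (le_addl HN _ _)).
  by apply: (lt_le_trans HN h); apply: le_addr.
have E j m : elem2 j m be <-> (j = v /\ m = a) \/ (j <> v /\ elem2 j m al).
  rewrite /elem2 hb; split=> [[j' [m' [/(pr_inj HN) [-> ->]]]] //|h].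
  by exists j, m.
exists be; split=> //; split=> //.
- by move=> u /hb [j [m [-> _]]]; exists j, m.
- move=> x y z /E h1 /E h2.
  case: h1 h2 => -[hx hy] [] [hx' hz]; rewrite ?hy ?hz //.
  exact: (hf x).
Qed.

Definition mono1 (Phi : (N -> Prop) -> N -> Prop) :=
  forall (X Y : N -> Prop) x, (forall u, X u -> Y u) -> Phi X x -> Phi Y x.
Definition mono2 (Phi : (N -> N -> Prop) -> N -> N -> Prop) :=
  forall (X Y : N -> N -> Prop) x y, (forall u v, X u v -> Y u v) -> Phi X x y -> Phi Y x y.
Definition mono3 (Phi : (N -> N -> N -> Prop) -> N -> N -> N -> Prop) :=
  forall (X Y : N -> N -> N -> Prop) x y z,
  (forall u v w, X u v w -> Y u v w) -> Phi X x y z -> Phi Y x y z.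

Lemma rec1_inv Phi x : mono1 Phi -> rec1 Phi x -> Phi (rec1 Phi) x.
Proof.
move=> hm [F [hx hF]]; apply: hm (hF x hx) => u hu.
by exists F.
Qed.

(** The coded derivations of the finitely many premises are united and [x] is added; monotonicity
    keeps the old elements justified in the larger set. *)
Lemma rec1_intro Phi x (l : seq N) : mono1 Phi -> (forall u, List.In u l -> rec1 Phi u) ->
  Phi (fun u => List.In u l) x -> rec1 Phi x.
Proof.
move=> hm hl hx.
have [F [hF1 hF2]] : exists F, (forall u, List.In u l -> elem u F) /\ forall u, elem u F -> Phi (fun v => elem v F) u.
  elim: l hl {hx} => [|a l IH] hl; first by exists 0; split=> // u /elem_zero.
  have [|F [h1 h2]] := IH; first by move=> u hu; apply: hl; right.
  have [|G [h3 h4]] := hl a; first by left.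
  have [s hs] := elem_setU F G; exists s; split.
    by move=> u /= [<-|/h1 h]; apply/hs; [right|left].
  by move=> u /hs [/h2|/h4]; apply: hm => v hv; apply/hs; [left|right].
have [s hs] := elem_setU1 F x; exists s; split; first by apply/hs; left.
move=> u /hs [->|/hF2]; last by apply: hm => v hv; apply/hs; right.
by apply: hm hx => v /hF1 hv; apply/hs; right.
Qed.

Lemma rec2E Phi x y :
  rec2 Phi x y <->
  rec1 (fun X w => forall u v, w = pr u v -> Phi (fun u' v' => X (pr u' v')) u v) (pr x y).
Proof.
split=> -[F [h1 h2]]; exists F; split=> //; first by move=> w hw u v E; apply: h2; rewrite /elem2 -E.
by move=> u v h; apply: h2 h _ _ erefl.
Qed.

Lemma rec2_inv Phi x y : mono2 Phi -> rec2 Phi x y -> Phi (rec2 Phi) x y.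
Proof.
move=> hm [F [hx hF]]; apply: hm (hF _ _ hx) => u v hu.
by exists F.
Qed.

Lemma rec3_inv Phi x y z : mono3 Phi -> rec3 Phi x y z -> Phi (rec3 Phi) x y z.
Proof.
move=> hm [F [hx hF]]; apply: hm (hF _ _ _ hx) => u v w hu.
by exists F.
Qed.

Lemma rec2_intro Phi x y (l : seq (N * N)) : mono2 Phi ->
  (forall u v, List.In (u, v) l -> rec2 Phi u v) ->
  Phi (fun u v => List.In (u, v) l) x y -> rec2 Phi x y.
Proof.
move=> hm hl hx; apply/rec2E; apply: (@rec1_intro _ _ [seq pr p.1 p.2 | p <- l]).
- by move=> X Y w h hX u v E; apply: hm (hX u v E) => u' v'; apply: h.
- by move=> w /List.in_map_iff [[u v] [<- h]]; apply/rec2E; apply: hl.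
- move=> u v /(pr_inj HN) [<- <-]; apply: hm hx => u' v' h.
  by apply/List.in_map_iff; exists (u', v').
Qed.

(** A least failure up to [c] cannot be standard, nor zero; its predecessor is the required [d]. *)
Lemma overspill (A : N -> Prop) c : D1 A -> (forall n, A (num N n)) ->
  (forall n, num N n ≺ c) ->
  exists d, [/\ forall n, num N n ≺ d, d ≼ c & forall i, i ≼ d -> A i].
Proof.
move=> hA h hc.
have [H|H] := EM (forall i, i ≼ c -> A i); first by exists c; split=> //; apply: le_refl.
have {H} [x hx] : exists x, x ≼ c /\ ~ A x.
  by apply: contrapT => H'; apply: H => i hi; apply: contrapT => hA'; apply: H'; exists i.
have [||y [[yc Ay] _ hy]] := @N_least _ HN (fun x => x ≼ c /\ ~ A x) x; [by ddt|exact: hx|].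
have hlt i : i ≺ y -> A i.
  move=> hi; apply: contrapT => hi'; apply: (hy i hi); split=> //.
  exact: (le_trans HN (ltW hi) yc).
have yn n : num N n ≺ y.
  have [//|/(le_eq HN) [E|]] := lt_total HN (num N n) y; first by case: Ay; rewrite E; apply: h.
  by move=> /(num_lt HN) [k _ E]; case: Ay; rewrite E; apply: h.
have [E|[d E]] := zero_or_succ HN y; first by have := yn 0%N; rewrite E => /(lt0 HN).
exists d; split.
- move=> n; have := yn n.+1; rewrite E /= => /(leS HN)/(ltSle HN); exact.
- by apply: (le_trans HN (ltW (ltS HN d))); rewrite -E.
- by move=> i hi; apply: hlt; rewrite E; apply/(leS HN).
Qed.

(** Stated for coded relations so that the induction hypothesis may quantify over all of them. *)
Lemma pigeonhole_code m r :
  (forall u, u ≼ m -> exists2 k, k ≺ m & elem2 u k r) ->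
  exists u u' k, [/\ u <> u', elem2 u k r & elem2 u' k r].
Proof.
move: m r; apply: (N_ind HN) => [||m IH r hr]; first by ddt.
  by move=> r /(_ _ (le_refl HN _)) [k /(lt0 HN)].
apply: contrapT => H.
have inj u u' k : elem2 u k r -> elem2 u' k r -> u = u'.
  by move=> h1 h2; apply: contrapT => h3; apply: H; exists u, u', k.
have [k0 /(leS HN) hk0 h0] := hr _ (le_refl HN (S m)).
(* The argument [S m] is dropped and its value [k0] is handed to whichever argument had the value
   [m], so that the value [m] disappears as well. *)
pose X x := exists u k, [/\ x = pr u k, u ≼ m, k ≺ m & elem2 u k r \/ elem2 u m r /\ k = k0].
have [||s [_ hs]] := @elem_code X (S (pr m m)).
- by rewrite /X; ddt.
- by move=> x [u [k [-> hu hk _]]]; apply/(leS HN)/(pr_mono HN) => //; apply: ltW.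
have E u k : elem2 u k s <-> [/\ u ≼ m, k ≺ m & elem2 u k r \/ elem2 u m r /\ k = k0].
  rewrite /elem2 hs; split=> [[u' [k' [/(pr_inj HN) [-> ->] h1 h2 h3]]]|[h1 h2 h3]] //.
  by exists u, k.
have ne u : u ≼ m -> u <> S m.
  by move=> hu E'; apply: (lt_irr HN (x := S m)); rewrite -{1}E'; apply/(leS HN).
have [u hu|u [u' [k [uu /E [hu hk h1] /E [hu' _ h2]]]]] := IH s.
  have [|k /(leS HN)/(le_eq HN) [E'|hk] h1] := hr u; first by apply: (le_trans HN hu); apply/ltW/ltS.
    have k0m : k0 ≺ m.
      have [E2|//] := le_eq HN hk0.
      by case: (ne u hu); apply: (inj _ _ k0) => //; rewrite E2 -E'.
    by exists k0 => //; apply/E; split=> //; right; split=> //; rewrite -E'.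
  by exists k => //; apply/E; split=> //; left.
apply: uu; case: h1 h2 => [h1|[h1 E1]] [h2|[h2 E2]]; first exact: (inj _ _ k).
- by case: (ne u hu); apply: (inj _ _ k0) => //; rewrite -E2.
- by case: (ne u' hu'); apply: (inj _ _ k0) => //; rewrite -E1.
- exact: (inj _ _ m).
Qed.

Lemma pigeonhole (R : N -> N -> Prop) m : D2 R ->
  (forall u, u ≼ m -> exists2 k, k ≺ m & R u k) ->
  exists u u' k, [/\ u <> u', R u k & R u' k].
Proof.
move=> hR h.
pose X x := exists u k, [/\ x = pr u k, u ≼ m, k ≺ m & R u k].
have [||s [_ hs]] := @elem_code X (S (pr m m)).
- by rewrite /X; ddt.
- by move=> x [u [k [-> hu hk _]]]; apply/(leS HN)/(pr_mono HN) => //; apply: ltW.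
have E u k : elem2 u k s <-> [/\ u ≼ m, k ≺ m & R u k].
  rewrite /elem2 hs; split=> [[u' [k' [/(pr_inj HN) [-> ->] h1 h2 h3]]]|[h1 h2 h3]] //.
  by exists u, k.
have [u hu|u [u' [k [uu /E [_ _ h1] /E [_ _ h2]]]]] := @pigeonhole_code m s.
  by have [k hk hu'] := h u hu; exists k => //; apply/E.
by exists u, u', k.
Qed.
End Codes.

(** * Codes of expressions *)

Lemma tag_inj (N : pre) (HN : ipre N) (k k' : nat) (a a' : N) :
  pr (num N k) a = pr (num N k') a' -> k = k' /\ a = a'.
Proof. by move=> /(pr_inj HN) [/(num_inj HN)]. Qed.

(* Closes a goal when two expressions with distinct constructors are equated. *)
Ltac sdisc := exfalso; match goal with
  | HN : ipre _, H : _ = _ |- False =>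
    move: H; rewrite /var /zer /un /bin /qu;
    repeat match goal with |- context [match ?o with _ => _ end] => is_var o; destruct o end;
    by move=> /(tag_inj HN) []
  end.

Section Syntax.
Variable N : pre.
Hypothesis HN : ipre N.
Implicit Types x y z a b c d i j k m s t u v w e f : N.
Implicit Types rho sigma : N -> N -> Prop.
Local Notation "0" := (@zero (car N)) : arith_scope.
Local Notation S := succ.

Lemma un_inj o o' a a' : un o a = un o' a' -> o = o' /\ a = a'.
Proof. by case: o; case: o' => /(tag_inj HN) []. Qed.

Lemma bin_inj o o' a a' b b' : bin o a b = bin o' a' b' -> [/\ o = o', a = a' & b = b'].
Proof. by case: o; case: o' => /(tag_inj HN) [? /(pr_inj HN) []]. Qed.

Lemma qu_inj o o' a a' b b' : qu o a b = qu o' a' b' -> [/\ o = o', a = a' & b = b'].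
Proof. by case: o; case: o' => /(tag_inj HN) [? /(pr_inj HN) []]. Qed.

Lemma var_inj i j : var i = var j -> i = j.
Proof. by move=> /(tag_inj HN) []. Qed.

Lemma lt_tag n a : a ≺ pr (num N n.+1) a.
Proof. by apply: (lt_pr2 HN); apply: (lt0S HN). Qed.

Lemma lt_un o a : a ≺ un o a.
Proof. by case: o; apply: lt_tag. Qed.

Lemma lt_bin1 o a b : a ≺ bin o a b.
Proof. by apply: (le_lt_trans HN (le_pr1 HN a b)); case: o; apply: lt_tag. Qed.

Lemma lt_bin2 o a b : b ≺ bin o a b.
Proof. by apply: (le_lt_trans HN (le_pr2 HN a b)); case: o; apply: lt_tag. Qed.

Lemma lt_qu o a b : b ≺ qu o a b.
Proof. by apply: (le_lt_trans HN (le_pr2 HN a b)); case: o; apply: lt_tag. Qed.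

Lemma valueE rho t a : value rho t a <->
  [\/ exists2 i, t = var i & rho i a,
      t = zer N /\ a = 0,
      exists t' a', [/\ t = un USucc t', value rho t' a' & a = S a'] |
      exists t1 t2 a1 a2, [/\ value rho t1 a1, value rho t2 a2 &
        (t = bin BAdd t1 t2 /\ a = add a1 a2) \/ (t = bin BMul t1 t2 /\ a = mul a1 a2)]].
Proof.
set Phi := fun (X : N -> N -> Prop) t a => [\/ exists2 i, t = var i & rho i a,
      t = zer N /\ a = 0,
      exists t' a', [/\ t = un USucc t', X t' a' & a = S a'] |
      exists t1 t2 a1 a2, [/\ X t1 a1, X t2 a2 &
        (t = bin BAdd t1 t2 /\ a = add a1 a2) \/ (t = bin BMul t1 t2 /\ a = mul a1 a2)]].
have hm : mono2 Phi.
  move=> X Y u v h [?|?|[t' [a' [? ? ?]]]|[t1 [t2 [a1 [a2 [? ? ?]]]]]].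
  - exact: Or41. - exact: Or42.
  - by apply: Or43; exists t', a'; split=> //; apply: h.
  - by apply: Or44; exists t1, t2, a1, a2; split=> //; apply: h.
split; first exact: rec2_inv.
case=> [H|H|[t' [a' [? ? ?]]]|[t1 [t2 [a1 [a2 [? ? H]]]]]].
- by apply: (@rec2_intro _ HN _ _ _ [::]) => //; apply: Or41.
- by apply: (@rec2_intro _ HN _ _ _ [::]) => //; apply: Or42.
- apply: (@rec2_intro _ HN _ _ _ [:: (t', a')]) => //; first by move=> u v [[<- <-]|[]].
  by apply: Or43; exists t', a'; split=> //; left.
- apply: (@rec2_intro _ HN _ _ _ [:: (t1, a1); (t2, a2)]) => //.
    by move=> u v [[<- <-]|[[<- <-]|[]]].
  by apply: Or44; exists t1, t2, a1, a2; split=> //; [left|right; left].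
Qed.

Lemma freeE i x : free i x <->
  [\/ x = var i,
      exists o a, x = un o a /\ free i a,
      exists o a b, x = bin o a b /\ (free i a \/ free i b) |
      exists q j a, [/\ x = qu q j a, j <> i & free i a]].
Proof.
set Phi := fun (X : N -> Prop) x => [\/ x = var i,
      exists o a, x = un o a /\ X a,
      exists o a b, x = bin o a b /\ (X a \/ X b) |
      exists q j a, [/\ x = qu q j a, j <> i & X a]].
have hm : mono1 Phi.
  move=> X Y u h [?|[o [a [? ?]]]|[o [a [b [? H]]]]|[q [j [a [? ? ?]]]]].
  - exact: Or41.
  - by apply: Or42; exists o, a; split=> //; apply: h.
  - by apply: Or43; exists o, a, b; split=> //; case: H => ?; [left|right]; apply: h.
  - by apply: Or44; exists q, j, a; split=> //; apply: h.
split; first exact: rec1_inv.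
case=> [H|[o [a [? ?]]]|[o [a [b [? H]]]]|[q [j [a [? ? ?]]]]].
- by apply: (@rec1_intro _ HN _ _ [::]) => //; apply: Or41.
- apply: (@rec1_intro _ HN _ _ [:: a]) => //; first by move=> u [<-|[]].
  by apply: Or42; exists o, a; split=> //; left.
- case: H => H.
    apply: (@rec1_intro _ HN _ _ [:: a]) => //; first by move=> u [<-|[]].
    by apply: Or43; exists o, a, b; split=> //; left; left.
  apply: (@rec1_intro _ HN _ _ [:: b]) => //; first by move=> u [<-|[]].
  by apply: Or43; exists o, a, b; split=> //; right; left.
- apply: (@rec1_intro _ HN _ _ [:: a]) => //; first by move=> u [<-|[]].
  by apply: Or44; exists q, j, a; split=> //; left.
Qed.

Lemma free_un i o a : free i (un o a) <-> free i a.
Proof.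
rewrite freeE; split; last by move=> h; apply: Or42; exists o, a.
by case=> [?|[o' [a' [/un_inj [_ ->]]]]|[? [? [? [? _]]]]|[? [? [? [? _]]]]] //; sdisc.
Qed.

Lemma free_bin i o a b : free i (bin o a b) <-> free i a \/ free i b.
Proof.
rewrite freeE; split; last by move=> h; apply: Or43; exists o, a, b.
by case=> [?|[? [? [? _]]]|[? [? [? [/bin_inj [_ -> ->]]]]]|[? [? [? [? _]]]]] //; sdisc.
Qed.

Lemma free_qu i q j a : free i a -> j <> i -> free i (qu q j a).
Proof. by move=> h hj; apply/freeE; apply: Or44; exists q, j, a. Qed.

Lemma free_var i : free i (var i).
Proof. by apply/freeE; apply: Or41. Qed.

Definition Form_rule (X : N -> Prop) x :=
  [\/ exists a b, [/\ x = bin BEq a b, Term a & Term b],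
      exists2 a, x = un UNeg a & X a,
      exists a b, (x = bin BAnd a b \/ x = bin BOr a b) /\ X a /\ X b |
      exists q i a, x = qu q i a /\ X a].

Lemma Form_mono : mono1 Form_rule.
Proof.
move=> X Y u h [?|[a ? ?]|[a [b [? [? ?]]]]|[q [i [a [? ?]]]]].
- exact: Or41.
- by apply: Or42; exists a => //; apply: h.
- by apply: Or43; exists a, b; do !split=> //; apply: h.
- by apply: Or44; exists q, i, a; split=> //; apply: h.
Qed.

Lemma Form_inv x : Form x -> Form_rule (@Form N) x.
Proof. exact: (rec1_inv Form_mono). Qed.

Lemma Form_neg x : Form (un UNeg x) <-> Form x.
Proof.
split.
  by move=> /Form_inv [[? [? [? _ _]]]|[a /un_inj [_ ->]]|[? [? [[?|?] _]]]|[? [? [? [? _]]]]] //; sdisc.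
move=> h; apply: (@rec1_intro _ HN _ _ [:: x] Form_mono) => //; first by move=> u [<-|[]].
by apply: Or42; exists x => //; left.
Qed.

Lemma Form_eq s t : Form (bin BEq s t) -> Term s /\ Term t.
Proof.
move=> /Form_inv [[? [? [/bin_inj [_ -> ->]]]]|[a ?]|[? [? [[/bin_inj []|/bin_inj []] //]]]|[? [? [? [? _]]]]] //; sdisc.
Qed.

Lemma Form_sub x y : Form x -> direct_subformula y x -> Form y.
Proof.
move=> /Form_inv [[? [? [-> _ _]]]|[a -> ha]|[a [b [H [ha hb]]]]|[q [i [a [-> ha]]]]].
- by case=> [?|[? [/bin_inj []|/bin_inj []]]|[? [/bin_inj []|/bin_inj []]]|[? [? ?]]] //; sdisc.
- by case=> [/un_inj [_ <-]|[? [?|?]]|[? [?|?]]|[? [? ?]]] //; sdisc.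
- by case: H => ->; case=> [?|[? [/bin_inj [_ e1 e2]|/bin_inj [_ e1 e2]]]|[? [/bin_inj [_ e1 e2]|/bin_inj [_ e1 e2]]]|[? [? ?]]];
    rewrite -?e1 -?e2 //; sdisc.
- by case=> [?|[? [?|?]]|[? [?|?]]|[? [? /qu_inj [_ _ <-]]]] //; sdisc.
Qed.

Lemma value_free rho rho' t a : D2 rho -> D2 rho' ->
  (forall i b, free i t -> rho i b -> rho' i b) -> value rho t a -> value rho' t a.
Proof.
move=> h1 h2; move: t a; apply: (N_sind HN) => [|t IH a hf].
  by rewrite /value /free; ddt.
case/valueE => [[i e1 ?]|?|[t' [a' [e1 ? ?]]]|[t1 [t2 [a1 [a2 [? ? H]]]]]]; apply/valueE.
- by apply: Or41; exists i => //; apply: hf => //; rewrite e1; apply: free_var.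
- exact: Or42.
- apply: Or43; exists t', a'; split=> //; apply: IH => //; first by rewrite e1; apply: lt_un.
  by move=> i b hi; apply: hf; rewrite e1 free_un.
- have E : exists o, t = bin o t1 t2 by case: H => -[-> _]; [exists BAdd|exists BMul].
  case: E => o E; apply: Or44; exists t1, t2, a1, a2; split=> //; apply: IH => //.
  + by rewrite E; apply: lt_bin1.
  + by move=> i b hi; apply: hf; rewrite E free_bin; left.
  + by rewrite E; apply: lt_bin2.
  + by move=> i b hi; apply: hf; rewrite E free_bin; right.
Qed.

Lemma value_fun rho t a a' : D2 rho -> (forall i b b', rho i b -> rho i b' -> b = b') ->
  value rho t a -> value rho t a' -> a = a'.
Proof.
move=> h1 h2; move: t a a'; apply: (N_sind HN) => [|t IH a a'].
  by rewrite /value; ddt.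
case/valueE => [[i ? ha]|[? ?]|[t' [b [? ha ?]]]|[t1 [t2 [a1 [a2 [ha hb [[? ?]|[? ?]]]]]]]];
case/valueE => [[i' E ha']|[E ?]|[t'' [b' [E ha' ?]]]|[t1' [t2' [a1' [a2' [ha' hb' [[E ?]|[E ?]]]]]]]];
  subst; try sdisc.
- by move/var_inj: E ha' => <-; apply: h2.
- by [].
- by move/un_inj: E => [_ E]; subst; rewrite (IH _ (lt_un _ _) _ _ ha ha').
- by move/bin_inj: E => [_ E1 E2]; subst; rewrite (IH _ (lt_bin1 _ _ _) _ _ ha ha') (IH _ (lt_bin2 _ _ _) _ _ hb hb').
- by move/bin_inj: E => [_ E1 E2]; subst; rewrite (IH _ (lt_bin1 _ _ _) _ _ ha ha') (IH _ (lt_bin2 _ _ _) _ _ hb hb').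
Qed.

Lemma numeral_value a t : numeral a t -> cl_value t a.
Proof.
set Phi := fun (X : N -> N -> Prop) a t => (a = 0 /\ t = zer N) \/
  (exists a' t', [/\ a = S a', t = un USucc t' & X a' t']).
have hm : mono2 Phi.
  move=> X Y u v h [?|[a' [t' [? ? ?]]]]; [by left|right].
  by exists a', t'; split=> //; apply: h.
move: a t; apply: (N_sind HN) => [|a IH t].
  by rewrite /cl_value /numeral /value; ddt.
move=> /(rec2_inv hm) [[-> ->]|[a' [t' [E -> h]]]]; apply/valueE; first exact: Or42.
by apply: Or43; exists t', a'; split=> //; apply: IH => //; rewrite E; apply: (ltS HN).
Qed.
End Syntax.


(** * Truth clauses and their invariance *)

Definition upds (N : arith) (al v a be : N) : Prop := is_fun be /\ extend al v a be.

(** Applies to arbitrary codes; [Form] and [Asn] are imposed when the class is read off. Quantifiers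
    range over updates defined at [v]; assignments left undefined there are recovered by
    invariance. *)
Definition Comp (N : arith) (X : N -> N -> Prop) (x al : N) : Prop :=
  (exists s t, x = bin BEq s t /\ exists2 a, asn_value al s a & asn_value al t a) \/
  (exists y, x = un UNeg y /\ ~ X y al) \/
  (exists y z, x = bin BOr y z /\ (X y al \/ X z al)) \/
  (exists y z, x = bin BAnd y z /\ (X y al /\ X z al)) \/
  (exists v y, x = qu QEx v y /\ exists a be, upds al v a be /\ X y be) \/
  (exists v y, x = qu QAll v y /\ forall a be, upds al v a be -> X y be).

(* The logical skeleton of a formula: atomic formulas become 0 = 0 and all
   bound variables become variable 0.  Similar pairs have equal shapes, and a
   shape has at most two direct subformulas. *)
Definition shape (N : arith) : N -> N -> Prop := rec2 (fun X x z =>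
  [\/ exists a b, x = bin BEq a b /\ z = bin BEq zero zero,
      exists a z', [/\ x = un UNeg a, z = un UNeg z' & X a z'],
      exists o a b z1 z2, ((o = BAnd \/ o = BOr) /\ (x = bin o a b /\ z = bin o z1 z2)) /\
        (X a z1 /\ X b z2) |
      exists q i a z', [/\ x = qu q i a, z = qu q zero z' & X a z']]).

(** Variables in [b] are bound further out and have equal values on both sides. Elsewhere the value
    under [al] has moved into the substituted closed term, whatever [be] says. *)
Definition sub_asn (N : arith) (sigma : N -> N -> Prop) (x al y be : N) : Prop :=
  (is_fun al /\ is_fun be) /\ exists b, subst_under sigma b x y /\
  ((forall i, elem i b -> forall a, elem2 i a al <-> elem2 i a be) /\
   forall i t, ~ elem i b -> sigma i t ->
     exists a, (forall a', elem2 i a' al <-> a' = a) /\ cl_value t a).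

(** Variables bound at the same depth share their values although their names may differ. Keeping
    all depths below [k] makes the depth of the next quantifier fresh. *)
Definition alpha_asn (N : arith) (x al y be : N) : Prop :=
  (is_fun al /\ is_fun be) /\ exists k e f,
  inst_under (fun i y => y = var i) (pr k (pr e f)) x y /\
  ((forall i m, elem2 i m e -> lt_of m k) /\ (forall i m, elem2 i m f -> lt_of m k)) /\
  ((forall i j m a, elem2 i m e -> elem2 j m f -> (elem2 i a al <-> elem2 j a be)) /\
   forall i a, (forall m, ~ elem2 i m e) -> (forall m, ~ elem2 i m f) ->
     (elem2 i a al <-> elem2 i a be)).

Definition free_asn (N : arith) (x al y be : N) : Prop :=
  (is_fun al /\ is_fun be) /\ y = x /\ forall i, free i x -> forall a, elem2 i a al <-> elem2 i a be.

Definition asn_term (N : arith) (al i t : N) : Prop := exists2 a, elem2 i a al & numeral a t.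
Definition seq_term (N : arith) (e s i t : N) : Prop := exists2 k, elem2 k i e & elem2 k t s.

Definition invariant_under (N : arith) (Q : N -> N -> N -> N -> Prop) (X : N -> N -> Prop) :=
  forall x al y be, Q x al y be -> (X x al <-> X y be).

(** Similarity is composed of such moves, and each of them passes through a quantifier. The
    substitutions are those given by elements, which makes the condition first-order in [X] and
    hence definable. *)
Definition Inv (N : arith) (X : N -> N -> Prop) : Prop :=
  [/\ invariant_under (@free_asn N) X,
      forall al, invariant_under (sub_asn (asn_term al)) X,
      forall e s, invariant_under (sub_asn (seq_term e s)) X &
      invariant_under (@alpha_asn N) X].

Ltac dhook ::= first
  [ match goal with
    | H : D1 _ |- _ => apply (D1_app H); dterm
    | H : D2 _ |- _ => apply (D2_app H); dterm
    | H : D3 _ |- _ => apply (D3_app H); dterm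
    end
  | simple eapply UD_P1; [dsh|dterm..] | simple eapply UD_P2; [dsh|dterm..]
  | simple eapply UD_P3; [dsh|dterm..]
  | match goal with
    | H : forall t1 t2 t3 t4, cT _ _ -> _ |- _ => apply H; dterm
    end
  | progress (unfold upds, Comp, shape, sub_asn, alpha_asn, free_asn, asn_term, seq_term,
      invariant_under, Inv, value, asn_value, cl_value, numeral, free, subst_under, inst_under,
      Form, Term); dt ].

(** * Definability of the truth clauses and of invariance *)

Section Definability.
Variables (J : Type) (N : J -> arith) (K : cls N).
Implicit Types s t u v w : forall j, (nat -> N j) -> N j.

Lemma cD_free s t : cT K s -> cT K t -> cD K (fun j e => free (s j e) (t j e)).
Proof. by move=> hs ht; dt. Qed.

Lemma cD_shape s t : cT K s -> cT K t -> cD K (fun j e => shape (s j e) (t j e)).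
Proof. by move=> hs ht; dt. Qed.

Lemma cD_asn_value s t u : cT K s -> cT K t -> cT K u ->
  cD K (fun j e => asn_value (s j e) (t j e) (u j e)).
Proof. by move=> hs ht hu; dt. Qed.

Lemma cD_upds s t u v : cT K s -> cT K t -> cT K u -> cT K v ->
  cD K (fun j e => upds (s j e) (t j e) (u j e) (v j e)).
Proof. by move=> hs ht hu hv; dt. Qed.

Lemma cD_Inv X r : cP2 K X -> shf r -> cD K (fun j e => Inv (X j (r j e))).
Proof. by move=> hX hr; dt. Qed.
End Definability.

Ltac dmore := fail.
Ltac dhook ::= first
  [ match goal with
    | H : D1 _ |- _ => apply (D1_app H); dterm
    | H : D2 _ |- _ => apply (D2_app H); dterm
    | H : D3 _ |- _ => apply (D3_app H); dterm
    end
  | lazymatch goal with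
    | |- cD _ (fun j e => shape _ _) => apply cD_shape; dterm
    | |- cD _ (fun j e => free _ _) => apply cD_free; dterm
    | |- cD _ (fun j e => asn_value _ _ _) => apply cD_asn_value; dterm
    | |- cD _ (fun j e => upds _ _ _ _) => apply cD_upds; dterm
    | |- cD _ (fun j e => Sat _ (sc _ (sc _ (sc _ _)))) => simple eapply UD_P3; [dsh|dterm..]
    | |- cD _ (fun j e => Sat _ (sc _ (sc _ _))) => simple eapply UD_P2; [dsh|dterm..]
    | |- cD _ (fun j e => Sat _ (sc _ _)) => simple eapply UD_P1; [dsh|dterm..]
    end
  | match goal with
    | H : forall t1 t2 t3 t4, cT _ _ -> _ |- _ => apply H; dterm
    end
  | progress (unfold Comp, sub_asn, alpha_asn, free_asn, asn_term, seq_term,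
      invariant_under, Inv, value, asn_value, cl_value, numeral, subst_under, inst_under,
      Form, Term); dt
  | dmore ].

(** * Bisimulations and the truth clauses *)

Section Bisimulation.
Variable N : pre.
Hypothesis HN : ipre N.
Implicit Types x y z a b c d i j k m s t u v w e f al be : N.
Implicit Types X rho sigma : N -> N -> Prop.
Implicit Types Q : N -> N -> N -> N -> Prop.
Local Notation "0" := (@zero (car N)) : arith_scope.
Local Notation S := succ.

(** The relations also hold between terms; on these codes both [Comp] and [shape] are empty. *)
Definition nonform x := [/\ forall a b, x <> bin BEq a b, forall a, x <> un UNeg a,
  forall o a b, o = BAnd \/ o = BOr -> x <> bin o a b & forall q i a, x <> qu q i a].

Lemma nonform_var i : nonform (var i).
Proof. by split; intros; move=> ?; sdisc. Qed.
Lemma nonform_zer : nonform (zer N).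
Proof. by split; intros; move=> ?; sdisc. Qed.
Lemma nonform_succ a : nonform (un USucc a).
Proof. by split; intros; move=> ?; sdisc. Qed.
Lemma nonform_term o a b : o = BAdd \/ o = BMul -> nonform (bin o a b).
Proof.
move=> ho; split; intros; move=> E; try sdisc; move: E => /(bin_inj HN) [E _ _].
  by case: ho E => ->.
by case: ho E H => -> <- [].
Qed.

Lemma nonform_value rho t a : value rho t a -> nonform t.
Proof.
case/(valueE HN) => [[i -> _]|[-> _]|[t' [a' [-> _ _]]]|[t1 [t2 [a1 [a2 [_ _ [[-> _]|[-> _]]]]]]]].
- exact: nonform_var.
- exact: nonform_zer.
- exact: nonform_succ.
- by apply: nonform_term; left.
- by apply: nonform_term; right.
Qed.

Lemma Comp_non X x al : nonform x -> ~ Comp X x al.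
Proof.
case=> h1 h2 h3 h4; case=> [[s [t [/h1 []]]]|[[y [/h2 []]]|[[y [z [E _]]]|[[y [z [E _]]]|[[v [y [/h4 []]]]|[v [y [/h4 []]]]]]]]].
- by apply: (h3 BOr) E; right.
- by apply: (h3 BAnd) E; left.
Qed.

Lemma Comp_eq X s t al : Comp X (bin BEq s t) al <-> exists2 a, asn_value al s a & asn_value al t a.
Proof.
split; last by move=> h; left; exists s, t.
case=> [[? [? [/(bin_inj HN) [_ -> ->]]]]|[[y [? _]]|[[y [z [? _]]]|[[y [z [? _]]]|[[v [y [? _]]]|[v [y [? _]]]]]]]] //; sdisc.
Qed.

Lemma Comp_neg X y al : Comp X (un UNeg y) al <-> ~ X y al.
Proof.
split; last by move=> h; right; left; exists y.
case=> [[? [? [? _]]]|[[? [/(un_inj HN) [_ ->]]]|[[? [? [? _]]]|[[? [? [? _]]]|[[v [? [? _]]]|[v [? [? _]]]]]]]] //; sdisc.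
Qed.

Lemma Comp_or X y z al : Comp X (bin BOr y z) al <-> X y al \/ X z al.
Proof.
split; last by move=> h; do 2!right; left; exists y, z.
case=> [[? [? [? _]]]|[[? [? _]]|[[? [? [/(bin_inj HN) [_ -> ->]]]]|[[? [? [? _]]]|[[v [? [? _]]]|[v [? [? _]]]]]]]] //; sdisc.
Qed.

Lemma Comp_and X y z al : Comp X (bin BAnd y z) al <-> X y al /\ X z al.
Proof.
split; last by move=> h; do 3!right; left; exists y, z.
case=> [[? [? [? _]]]|[[? [? _]]|[[? [? [? _]]]|[[? [? [/(bin_inj HN) [_ -> ->]]]]|[[v [? [? _]]]|[v [? [? _]]]]]]]] //; sdisc.
Qed.

Lemma Comp_ex X v y al : Comp X (qu QEx v y) al <-> exists a be, upds al v a be /\ X y be.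
Proof.
split; last by move=> h; do 4!right; left; exists v, y.
case=> [[? [? [? _]]]|[[? [? _]]|[[? [? [? _]]]|[[? [? [? _]]]|[[? [? [/(qu_inj HN) [_ -> ->]]]]|[? [? [? _]]]]]]]] //; sdisc.
Qed.

Lemma Comp_all X v y al : Comp X (qu QAll v y) al <-> forall a be, upds al v a be -> X y be.
Proof.
split; last by move=> h; do 5!right; exists v, y.
case=> [[? [? [? _]]]|[[? [? _]]|[[? [? [? _]]]|[[? [? [? _]]]|[[? [? [? _]]]|[? [? [/(qu_inj HN) [_ -> ->]]]]]]]]] //; sdisc.
Qed.

Lemma shapeE x z : shape x z <->
  [\/ exists a b, x = bin BEq a b /\ z = bin BEq 0 0,
      exists a z', [/\ x = un UNeg a, z = un UNeg z' & shape a z'],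
      exists o a b z1 z2, ((o = BAnd \/ o = BOr) /\ (x = bin o a b /\ z = bin o z1 z2)) /\
        (shape a z1 /\ shape b z2) |
      exists q i a z', [/\ x = qu q i a, z = qu q 0 z' & shape a z']].
Proof.
set Phi := fun (X : N -> N -> Prop) x z => [\/ exists a b, x = bin BEq a b /\ z = bin BEq 0 0,
      exists a z', [/\ x = un UNeg a, z = un UNeg z' & X a z'],
      exists o a b z1 z2, ((o = BAnd \/ o = BOr) /\ (x = bin o a b /\ z = bin o z1 z2)) /\
        (X a z1 /\ X b z2) |
      exists q i a z', [/\ x = qu q i a, z = qu q 0 z' & X a z']].
have hm : mono2 Phi.
  move=> X Y u v h [?|[a [z' [? ? ?]]]|[o [a [b [z1 [z2 [? [? ?]]]]]]]|[q [i [a [z' [? ? ?]]]]]].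
  - exact: Or41.
  - by apply: Or42; exists a, z'; split=> //; apply: h.
  - by apply: Or43; exists o, a, b, z1, z2; split=> //; split; apply: h.
  - by apply: Or44; exists q, i, a, z'; split=> //; apply: h.
split; first exact: rec2_inv.
case=> [?|[a [z' [? ? ?]]]|[o [a [b [z1 [z2 [? [? ?]]]]]]]|[q [i [a [z' [? ? ?]]]]]].
- by apply: (@rec2_intro _ HN _ _ _ [::]) => //; apply: Or41.
- apply: (@rec2_intro _ HN _ _ _ [:: (a, z')]) => //; first by move=> u v [[<- <-]|[]].
  by apply: Or42; exists a, z'; split=> //; left.
- apply: (@rec2_intro _ HN _ _ _ [:: (a, z1); (b, z2)]) => //.
    by move=> u v [[<- <-]|[[<- <-]|[]]].
  by apply: Or43; exists o, a, b, z1, z2; split=> //; split; [left|right; left].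
- apply: (@rec2_intro _ HN _ _ _ [:: (a, z')]) => //; first by move=> u v [[<- <-]|[]].
  by apply: Or44; exists q, i, a, z'; split=> //; left.
Qed.

Lemma shape_non x z : nonform x -> ~ shape x z.
Proof.
case=> h1 h2 h3 h4 /shapeE [[? [? [/h1 []]]]|[? [? [/h2 []]]]|[o [? [? [? [? [[ho [E _]] _]]]]]]|[? [? [? [? [/h4 []]]]]]] //.
exact: h3 ho E.
Qed.

Lemma shape_eq s t z : shape (bin BEq s t) z <-> z = bin BEq 0 0.
Proof.
split; last by move=> ->; apply/shapeE; apply: Or41; exists s, t.
case/shapeE => [[? [? [_ ->]]]|[? [? [? _]]]|[o [? [? [? [? [[ho [/(bin_inj HN) [E _ _] _]] _]]]]]]|[? [? [? [? [? _]]]]]] //; try sdisc.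
by case: ho E => ->.
Qed.

Lemma shape_neg x z : shape (un UNeg x) z <-> exists2 z', z = un UNeg z' & shape x z'.
Proof.
split; last by case=> z' -> h; apply/shapeE; apply: Or42; exists x, z'.
case/shapeE => [[? [? [? _]]]|[? [z' [/(un_inj HN) [_ ->] -> h]]]|[o [? [? [? [? [[ho [? _]] _]]]]]]|[? [? [? [? [? _]]]]]] //; try sdisc.
by exists z'.
Qed.

Lemma shape_bin o x y z : o = BAnd \/ o = BOr ->
  (shape (bin o x y) z <-> exists z1 z2, z = bin o z1 z2 /\ (shape x z1 /\ shape y z2)).
Proof.
move=> ho; split; last first.
  by case=> z1 [z2 [-> [h1 h2]]]; apply/shapeE; apply: Or43; exists o, x, y, z1, z2.
case/shapeE => [[? [? [/(bin_inj HN) [E _ _] _]]]|[? [? [? _]]]|[o' [? [? [z1 [z2 [[ho' [/(bin_inj HN) [-> -> ->] ->]] ?]]]]]]|[? [? [? [? [? _]]]]]] //; try sdisc.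
  by case: ho E => ->.
by exists z1, z2.
Qed.

Lemma shape_qu q i x z : shape (qu q i x) z <-> exists2 z', z = qu q 0 z' & shape x z'.
Proof.
split; last by case=> z' -> h; apply/shapeE; apply: Or44; exists q, i, x, z'.
case/shapeE => [[? [? [? _]]]|[? [z' [? _ _]]]|[o [? [? [? [? [[ho [? _]] _]]]]]]|[? [? [? [z' [/(qu_inj HN) [-> _ ->] -> h]]]]]] //; try sdisc.
by exists z'.
Qed.

Lemma shape_Form x : Form x -> exists z, shape x z.
Proof.
move: x; apply: (N_sind HN) => [|x IH]; first by ddt.
move=> /Form_inv [[s [t [-> _ _]]]|[a E ha]|[a [b [E [ha hb]]]]|[q [i [a [E ha]]]]].
- by exists (bin BEq 0 0); apply/shape_eq.
- have [|z hz] := IH a _ ha; first by rewrite E; apply: lt_un.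
  by exists (un UNeg z); rewrite E; apply/shape_neg; exists z.
- have [o ho Eo] : exists2 o, o = BAnd \/ o = BOr & x = bin o a b.
    by case: E => ->; [exists BAnd => //; left|exists BOr => //; right].
  have [|z1 h1] := IH a _ ha; first by rewrite Eo; apply: lt_bin1.
  have [|z2 h2] := IH b _ hb; first by rewrite Eo; apply: lt_bin2.
  by exists (bin o z1 z2); rewrite Eo; apply/(shape_bin _ _ _ ho); exists z1, z2.
- have [|z hz] := IH a _ ha; first by rewrite E; apply: lt_qu.
  by exists (qu q 0 z); rewrite E; apply/shape_qu; exists z.
Qed.

Lemma shape_fun x z z' : shape x z -> shape x z' -> z = z'.
Proof.
move: x z z'; apply: (N_sind HN) => [|x IH z z' h]; first by ddt.
case/shapeE: h IH => [[s [t [-> ->]]]|[a [z1 [-> -> ha]]]|[o [a [b [z1 [z2 [[ho [-> ->]] [ha hb]]]]]]]|[q [i [a [z1 [-> -> ha]]]]]] IH.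
- by move=> /shape_eq.
- by move=> /shape_neg [z2 -> hb]; rewrite (IH a _ _ _ ha hb) //; apply: lt_un.
- move=> /(shape_bin _ _ _ ho) [z3 [z4 [-> [hc hd]]]].
  by rewrite (IH a _ _ _ ha hc) ?(IH b _ _ _ hb hd) //; [apply: lt_bin2|apply: lt_bin1].
- by move=> /shape_qu [z2 -> hb]; rewrite (IH a _ _ _ ha hb) //; apply: lt_qu.
Qed.

(** At a quantifier the same value is given to both bound variables; this suffices in both
    directions because every assignment has an update with a given value. *)
Inductive bstep Q al be : N -> N -> Prop :=
| Bnon x y of nonform x & nonform y : bstep Q al be x y
| Beq s t s' t' of (forall a, asn_value al s a <-> asn_value be s' a) &
    (forall a, asn_value al t a <-> asn_value be t' a) :
    bstep Q al be (bin BEq s t) (bin BEq s' t')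
| Bneg x y of Q x al y be : bstep Q al be (un UNeg x) (un UNeg y)
| Bbin o x1 x2 y1 y2 of o = BAnd \/ o = BOr & Q x1 al y1 be & Q x2 al y2 be :
    bstep Q al be (bin o x1 x2) (bin o y1 y2)
| Bqu q v w x y of (forall a al' be', upds al v a al' -> upds be w a be' -> Q x al' y be') :
    bstep Q al be (qu q v x) (qu q w y).

Definition bisimulation Q := forall x al y be, Q x al y be ->
  [/\ is_fun al, is_fun be & bstep Q al be x y].

Lemma Comp_invariant Q X : bisimulation Q -> invariant_under Q X -> invariant_under Q (Comp X).
Proof.
move=> hQ hX x al y be /hQ [fal fbe []].
- by move=> {}x {}y hx hy; split=> /Comp_non; case.
- by move=> s t s' t' hs ht; rewrite !Comp_eq; split=> -[a ? ?]; exists a; first [exact/hs|exact/ht].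
- by move=> {}x {}y h; rewrite !Comp_neg (hX _ _ _ _ h).
- move=> o x1 x2 y1 y2 [] -> h1 h2.
    by rewrite !Comp_and (hX _ _ _ _ h1) (hX _ _ _ _ h2).
  by rewrite !Comp_or (hX _ _ _ _ h1) (hX _ _ _ _ h2).
- move=> q v w {}x {}y h.
  have H1 a al' : upds al v a al' -> exists2 be', upds be w a be' & (X x al' <-> X y be').
    move=> ha; have [be' hb] := extend_ex HN w a fbe.
    by exists be' => //; apply: hX; apply: h ha hb.
  have H2 a be' : upds be w a be' -> exists2 al', upds al v a al' & (X x al' <-> X y be').
    move=> hb; have [al' ha] := extend_ex HN v a fal.
    by exists al' => //; apply: hX; apply: h ha hb.
  case: q {h}; rewrite ?Comp_ex ?Comp_all.
    split=> -[a [b [hb hX']]].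
      by have [b' ? E] := H1 _ _ hb; exists a, b'; split=> //; apply/E.
    by have [b' ? E] := H2 _ _ hb; exists a, b'; split=> //; apply/E.
  split=> H a b hb.
    by have [b' hb' E] := H2 _ _ hb; apply/E; apply: H hb'.
  by have [b' hb' E] := H1 _ _ hb; apply/E; apply: H hb'.
Qed.

(** Induction on the skeleton. To enter a quantifier, both assignments are updated with an arbitrary
    common value, here zero, since the skeleton does not depend on it. *)
Lemma shape_invariant Q z : bisimulation Q ->
  (forall t1 t2 t3 t4 : unit -> (nat -> N) -> N, cT (Dn N) t1 -> cT (Dn N) t2 ->
    cT (Dn N) t3 -> cT (Dn N) t4 ->
    cD (Dn N) (fun (o : unit) (E : nat -> N) => Q (t1 o E) (t2 o E) (t3 o E) (t4 o E))) ->
  invariant_under Q (fun x _ => shape x z).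
Proof.
move=> hQ dQ x al y be; move: z x al y be; apply: (N_sind HN) => [|z IH x al y be].
  by ddt.
move=> /hQ [fal fbe []].
- by move=> {}x {}y hx hy; split=> /shape_non; case.
- by move=> s t s' t' _ _; rewrite !shape_eq.
- move=> {}x {}y h; rewrite !shape_neg.
  by split=> -[z' E h']; exists z' => //; move: h'; rewrite (IH z' _ _ _ _ _ h) // E; apply: lt_un.
- move=> o x1 x2 y1 y2 ho h1 h2; rewrite !shape_bin //.
  split=> -[z1 [z2 [E [h1' h2']]]]; exists z1, z2; (split; [by []|split]).
  + by move: h1'; rewrite (IH z1 _ _ _ _ _ h1) // E; apply: lt_bin1.
  + by move: h2'; rewrite (IH z2 _ _ _ _ _ h2) // E; apply: lt_bin2.
  + by move: h1'; rewrite (IH z1 _ _ _ _ _ h1) // E; apply: lt_bin1.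
  + by move: h2'; rewrite (IH z2 _ _ _ _ _ h2) // E; apply: lt_bin2.
- move=> q v w {}x {}y h; rewrite !shape_qu.
  have [al' ha] := extend_ex HN v 0 fal; have [be' hb] := extend_ex HN w 0 fbe.
  by split=> -[z' E h']; exists z' => //; move: h'; rewrite (IH z' _ _ _ _ _ (h _ _ _ ha hb)) // E; apply: lt_qu.
Qed.
End Bisimulation.

(** * Similarity decomposed into bisimulations *)

Section Similar.
Variable N : pre.
Hypothesis HN : ipre N.
Implicit Types x y z a b c d i j k m s t u v w e f al be : N.
Implicit Types X rho sigma R : N -> N -> Prop.
Implicit Types Q : N -> N -> N -> N -> Prop.
Local Notation "0" := (@zero (car N)) : arith_scope.
Local Notation S := succ.

Lemma value_var rho i a : value rho (var i) a <-> rho i a.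
Proof.
rewrite (valueE HN); split; last by move=> h; apply: Or41; exists i.
case=> [[? /(var_inj HN) ->]|[? _]|[? [? [? _ _]]]|[? [? [? [? [_ _ [[? _]|[? _]]]]]]]] //; sdisc.
Qed.

Lemma value_un rho o t a :
  value rho (un o t) a <-> o = USucc /\ exists2 a', value rho t a' & a = S a'.
Proof.
rewrite (valueE HN); split.
  case=> [[? ? _]|[? _]|[? [a' [/(un_inj HN) [-> ->] h e]]]|[? [? [? [? [_ _ [[? _]|[? _]]]]]]]]; try sdisc.
  by split=> //; exists a'.
by case=> -> [a' h e]; apply: Or43; exists t, a'.
Qed.

Lemma value_bin rho o t1 t2 a : value rho (bin o t1 t2) a <->
  exists a1 a2, [/\ value rho t1 a1, value rho t2 a2 &
    o = BAdd /\ a = add a1 a2 \/ o = BMul /\ a = mul a1 a2].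
Proof.
rewrite (valueE HN); split.
  case=> [[? ? _]|[? _]|[? [? [? _ _]]]|[? [? [a1 [a2 [h1 h2 [[/(bin_inj HN) [E E1 E2] e]|[/(bin_inj HN) [E E1 E2] e]]]]]]]]; try sdisc; subst.
    by exists a1, a2; split=> //; left.
  by exists a1, a2; split=> //; right.
case=> a1 [a2 [h1 h2 h]]; apply: Or44; exists t1, t2, a1, a2; split=> //.
by case: h => -[-> ->]; [left|right].
Qed.

Lemma value_qu rho q i t a : ~ value rho (qu q i t) a.
Proof.
move=> /(valueE HN) [[? ? _]|[? _]|[? [? [? _ _]]]|[? [? [a1 [a2 [_ _ [[? _]|[? _]]]]]]]]; sdisc.
Qed.

(** A quantified code has no value, so any two of them match vacuously. *)
Inductive tstep R rho rho' : N -> N -> Prop :=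
| Tleaf t t' of (forall a, value rho t a <-> value rho' t' a) : tstep R rho rho' t t'
| Tun o t t' of R t t' : tstep R rho rho' (un o t) (un o t')
| Tbin o s t s' t' of R s s' & R t t' : tstep R rho rho' (bin o s t) (bin o s' t')
| Tqu q i j t t' : tstep R rho rho' (qu q i t) (qu q j t').

Lemma value_rel R rho rho' t t' a : D2 R -> D2 rho -> D2 rho' ->
  (forall t t', R t t' -> tstep R rho rho' t t') ->
  R t t' -> (value rho t a <-> value rho' t' a).
Proof.
move=> hR h1 h2 H; move: t t' a; apply: (N_sind HN) => [|t IH t' a /H h]; first by ddt.
case: h IH => [{}t {}t' -> //|o {}t {}t' h IH|o s {}t s' {}t' hs ht IH|q i j {}t {}t' _].
- rewrite !value_un; split=> -[e [a' ha e']]; split=> //; exists a' => //; move: ha;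
  by rewrite (IH t _ t') //; apply: (lt_un HN).
- have Es c := IH s (lt_bin1 HN _ _ _) s' c hs; have Et c := IH t (lt_bin2 HN _ _ _) t' c ht.
  rewrite !value_bin; split=> -[a1 [a2 [/Es ha /Et hb e]]]; exists a1, a2; split=> //.
- by split=> /value_qu.
Qed.

Lemma free_bisimulation : bisimulation (@free_asn N).
Proof.
move=> x al y be [[fal fbe] [-> hf]]; split=> //.
have [v|v] := EM (nonform x); first exact: Bnon.
have hval s : (forall i, free i s -> free i x) -> forall a, asn_value al s a <-> asn_value be s a.
  move=> hs a; split; apply: (value_free HN); try by ddt.
    by move=> i c /hs/hf ->.
  by move=> i c /hs/hf ->.
have {v} : (exists s t, x = bin BEq s t) \/ (exists y, x = un UNeg y) \/
    (exists o y z, (o = BAnd \/ o = BOr) /\ x = bin o y z) \/ (exists q i y, x = qu q i y).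
  apply: contrapT => h; apply: v; split.
  - by move=> s t E; apply: h; left; exists s, t.
  - by move=> s E; apply: h; right; left; exists s.
  - by move=> o s t ho E; apply: h; do 2 right; left; exists o, s, t.
  - by move=> q i s E; apply: h; do 3 right; exists q, i, s.
case=> [[s [t E]]|[[z E]|[[o [z [z' [ho E]]]]|[q [i [z E]]]]]]; rewrite E in hf hval *.
- apply: Beq; apply: hval => i hi; apply/(free_bin HN); [by left|by right].
- apply: Bneg; split=> //; split=> // i hi; apply: hf; exact/(free_un HN).
- by apply: Bbin => //; split=> //; split=> // i hi; apply: hf; apply/(free_bin HN); [left|right].
- apply: Bqu => a al' be' [h1 h2] [h3 h4]; split=> //; split=> // j hj c.
  rewrite h2 h4; have [->|ji] := EM (j = i); first tauto.
  by rewrite hf //; apply: (free_qu HN) => // /esym.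
Qed.

Definition subst_rule sigma (X : N -> N -> N -> Prop) b x y :=
  [\/ exists2 i, x = var i & (elem i b /\ y = var i) \/ (~ elem i b /\ sigma i y),
      x = zer N /\ y = zer N,
      exists o a a', [/\ x = un o a, y = un o a' & X b a a'] |
      (exists o a1 a2 a1' a2', [/\ x = bin o a1 a2, y = bin o a1' a2', X b a1 a1' & X b a2 a2']) \/
      (exists q i a a' b', [/\ x = qu q i a, y = qu q i a',
         forall j, elem j b' <-> j = i \/ elem j b & X b' a a'])].

Lemma subst_inv sigma b x y :
  subst_under sigma b x y -> subst_rule sigma (subst_under sigma) b x y.
Proof.
apply: rec3_inv => X Y u v w h [?|?|[o [a [a' [? ? ?]]]]|[[o [a1 [a2 [a1' [a2' [? ? ? ?]]]]]]|[q [i [a [a' [b' [? ? ? ?]]]]]]]].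
- exact: Or41. - exact: Or42.
- by apply: Or43; exists o, a, a'; split=> //; apply: h.
- by apply: Or44; left; exists o, a1, a2, a1', a2'; split=> //; apply: h.
- by apply: Or44; right; exists q, i, a, a', b'; split=> //; apply: h.
Qed.

Lemma asn_D2 al : D2 (fun i a => elem2 i a al).
Proof. by ddt. Qed.

Lemma empty_D2 : D2 (fun _ _ : N => False).
Proof. by ddt. Qed.

Lemma cl_value_asn al t a a' : is_fun al -> cl_value t a -> (asn_value al t a' <-> a' = a).
Proof.
move=> [_ _ hf] h; have h1 : asn_value al t a.
  by apply: (value_free HN) h => //; [apply: empty_D2|apply: asn_D2].
split=> [h2|-> //]; apply: (value_fun HN (asn_D2 al) _ h2 h1) => i c c'; exact: hf.
Qed.

Lemma sub_tstep sigma b al be : D2 sigma -> is_fun al -> is_fun be ->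
  (forall i, elem i b -> forall a, elem2 i a al <-> elem2 i a be) ->
  (forall i t, ~ elem i b -> sigma i t ->
     exists a, (forall a', elem2 i a' al <-> a' = a) /\ cl_value t a) ->
  forall t t', subst_under sigma b t t' ->
  tstep (subst_under sigma b) (fun i a => elem2 i a al) (fun i a => elem2 i a be) t t'.
Proof.
move=> hs fal fbe hb hsig t t'.
move=> /subst_inv [[i -> h]|[-> ->]|[o [a [a' [-> -> ?]]]]|[[o [a1 [a2 [a1' [a2' [-> -> ? ?]]]]]]|[q [i [a [a' [b' [-> -> ? ?]]]]]]]].
- apply: Tleaf => c; rewrite value_var.
  case: h => [[h ->]|[h h']]; first by rewrite value_var; apply: hb.
  have [a [-> ha]] := hsig _ _ h h'.
  by apply: iff_sym; apply: (cl_value_asn _ fbe ha).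
- by apply: Tleaf => c; rewrite !(valueE HN); split=> -[[i E]|[_ h]|[? [? [? _ _]]]|[? [? [a1 [a2 [_ _ [[? _]|[? _]]]]]]]];
    try sdisc; apply: Or42.
- exact: Tun.
- exact: Tbin.
- exact: Tqu.
Qed.

(** Below a quantifier the bound variable joins the set [b], and the common update makes the two
    assignments agree there. *)
Lemma sub_bisimulation sigma : D2 sigma -> bisimulation (sub_asn sigma).
Proof.
move=> hs x al y be [[fal fbe] [b [hsub [hb hsig]]]]; split=> //.
have hT := sub_tstep hs fal fbe hb hsig.
have hval s s' a : subst_under sigma b s s' -> (asn_value al s a <-> asn_value be s' a).
  by apply: (value_rel _ _ _ _ hT); [ddt|exact: asn_D2..].
have hQ s s' : subst_under sigma b s s' -> sub_asn sigma s al s' be by split=> //; exists b.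
case: (subst_inv hsub) => [[i -> h]|[-> ->]|[o [a [a' [-> -> ?]]]]|[[o [a1 [a2 [a1' [a2' [-> -> ? ?]]]]]]|[q [i [a [a' [b' [-> -> hb' ?]]]]]]]].
- apply: Bnon; first exact: (nonform_var HN).
  case: h => [[_ ->]|[h h']]; first exact: (nonform_var HN).
  have [c [_ hc]] := hsig _ _ h h'; exact: (nonform_value HN hc).
- by apply: Bnon; apply: (nonform_zer HN).
- by case: o; [apply: Bnon; apply: (nonform_succ HN)|apply: Bneg; apply: hQ].
- case: o; first [by apply: Bnon; apply: (nonform_term HN); tauto | by apply: Bbin; [tauto|apply: hQ..] |
    by apply: Beq => c; apply: hval].
- apply: Bqu => c al' be' [f1 h1] [f2 h2]; split=> //; exists b'; split=> //; split.
    move=> j /hb' hj d; rewrite h1 h2; have [->|ji] := EM (j = i); first tauto.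
    by case: hj => // /hb h; rewrite h; tauto.
  move=> j t; rewrite hb' => hj hjt.
  have [d [h3 h4]] : exists d, (forall a', elem2 j a' al <-> a' = d) /\ cl_value t d.
    by apply: hsig => // ?; apply: hj; right.
  exists d; split=> // a2; rewrite h1 h3; split=> [[[? _]|[]//]|?]; first by case: hj; left.
  by right; split=> // ?; apply: hj; left.
Qed.

Definition inst_rule sigma (X : N -> N -> N -> Prop) k e f x y :=
  [\/ exists2 i, x = var i & (exists m j, [/\ elem2 i m e, y = var j & elem2 j m f]) \/
          [/\ forall m, ~ elem2 i m e, sigma i y & forall j m, free j y -> ~ elem2 j m f],
      x = zer N /\ y = zer N,
      exists o a a', [/\ x = un o a, y = un o a' & X (pr k (pr e f)) a a'] |
      (exists o a1 a2 a1' a2', [/\ x = bin o a1 a2, y = bin o a1' a2',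
         X (pr k (pr e f)) a1 a1' & X (pr k (pr e f)) a2 a2']) \/
      (exists q i j a a' e' f', x = qu q i a /\ y = qu q j a' /\ extend e i k e' /\
         extend f j k f' /\ X (pr (succ k) (pr e' f')) a a')].

Lemma inst_inv sigma k e f x y : inst_under sigma (pr k (pr e f)) x y ->
  inst_rule sigma (inst_under sigma) k e f x y.
Proof.
move=> /rec3_inv [|k' [e' [f' [/(pr_inj HN) [<- /(pr_inj HN) [<- <-]] h]]]]; last exact: h.
move=> X Y u v w h [k' [e' [f' [E H]]]]; exists k', e', f'; split=> //.
case: H => [?|?|[o [a [a' [? ? ?]]]]|[[o [a1 [a2 [a1' [a2' [? ? ? ?]]]]]]|[q [i [j [a [a' [e2 [f2 [? [? [? [? ?]]]]]]]]]]]]].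
- exact: Or41. - exact: Or42.
- by apply: Or43; exists o, a, a'; split=> //; apply: h.
- by apply: Or44; left; exists o, a1, a2, a1', a2'; split=> //; apply: h.
- by apply: Or44; right; exists q, i, j, a, a', e2, f2; do !split=> //; apply: h.
Qed.

Lemma alpha_bisimulation : bisimulation (@alpha_asn N).
Proof.
move=> x al y be [[fal fbe] [k [e [f [hin [[hke hkf] [hb hfr]]]]]]]; split=> //.
set c := pr k (pr e f) in hin *; set sg := fun i y => y = var i in hin *.
have hT t t' : inst_under sg c t t' ->
    tstep (inst_under sg c) (fun i a => elem2 i a al) (fun i a => elem2 i a be) t t'.
  case/inst_inv => [[i -> h]|[-> ->]|[o [a [a' [-> -> ?]]]]|[[o [a1 [a2 [a1' [a2' [-> -> ? ?]]]]]]|[q [i [j [a [a' [e2 [f2 [-> [-> _]]]]]]]]]]].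
  - apply: Tleaf => d; rewrite value_var.
    case: h => [[m [j [h1 -> h2]]]|[h1 -> h2]]; rewrite value_var; first exact: hb h1 h2.
    by apply: hfr => // m; apply: h2; apply: (free_var HN).
  - by apply: Tleaf => d; rewrite !(valueE HN); split=> -[[i E]|[_ h]|[? [? [? _ _]]]|[? [? [a1 [a2 [_ _ [[? _]|[? _]]]]]]]];
      try sdisc; apply: Or42.
  - exact: Tun.
  - exact: Tbin.
  - exact: Tqu.
have hval s s' a : inst_under sg c s s' -> (asn_value al s a <-> asn_value be s' a).
  by apply: (value_rel _ _ _ _ hT); [rewrite /sg; ddt|exact: asn_D2..].
have hQ s s' : inst_under sg c s s' -> alpha_asn s al s' be by split=> //; exists k, e, f.
case: (inst_inv hin) => [[i -> h]|[-> ->]|[o [a [a' [-> -> ?]]]]|[[o [a1 [a2 [a1' [a2' [-> -> ? ?]]]]]]|[q [i [j [a [a' [e2 [f2 [-> [-> [he [hf ?]]]]]]]]]]]]].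
- apply: Bnon; first exact: (nonform_var HN).
  by case: h => [[m [j [_ -> _]]]|[_ -> _]]; apply: (nonform_var HN).
- by apply: Bnon; apply: (nonform_zer HN).
- by case: o; [apply: Bnon; apply: (nonform_succ HN)|apply: Bneg; apply: hQ].
- case: o; first [by apply: Bnon; apply: (nonform_term HN); tauto | by apply: Bbin; [tauto|apply: hQ..] |
    by apply: Beq => d; apply: hval].
(* All recorded depths lie below [k], so depth [k] pairs the two newly bound variables with each
   other and never with an older one. *)
- have kk m : m ≺ k -> m <> k by move=> + E; rewrite E => /(lt_irr HN).
  have kS m : m ≺ k -> m ≺ S k by move=> h; apply: (lt_trans HN h (ltS HN k)).
  apply: Bqu => d al' be' [f1 h1] [f2' h2]; split=> //; exists (S k), e2, f2; split=> //; split; first split.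
  + by move=> i1 m /he [[_ ->]|[_ /hke/kS]] //; apply: (ltS HN).
  + by move=> i1 m /hf [[_ ->]|[_ /hkf/kS]] //; apply: (ltS HN).
  split.
    move=> i1 j1 m c0 /he [[-> Em]|[n1 g1]] /hf [[-> Em']|[n2 g2]]; rewrite h1 h2.
    * tauto.
    * by case: (kk _ (hkf _ _ g2)).
    * by case: (kk _ (hke _ _ g1)).
    * by have := hb _ _ _ c0 g1 g2; tauto.
  move=> i1 c0 g1 g2.
  have ne : i1 <> i by move=> E; apply: (g1 k); apply/he; left.
  have ne' : i1 <> j by move=> E; apply: (g2 k); apply/hf; left.
  rewrite h1 h2; have -> : elem2 i1 c0 al <-> elem2 i1 c0 be.
    apply: hfr => m hm; first by apply: (g1 m); apply/he; right.
    by apply: (g2 m); apply/hf; right.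
  tauto.
Qed.

Lemma asn_term_D2 al : D2 (asn_term al).
Proof. by ddt. Qed.

Lemma seq_term_D2 e s : D2 (seq_term e s).
Proof. by ddt. Qed.

Lemma Comp_Inv X : Inv X -> Inv (Comp X).
Proof.
case=> h1 h2 h3 h4; split=> [|al|e s|].
- exact: (Comp_invariant HN free_bisimulation).
- exact: (Comp_invariant HN (sub_bisimulation (asn_term_D2 al))).
- exact: (Comp_invariant HN (sub_bisimulation (seq_term_D2 e s))).
- exact: (Comp_invariant HN alpha_bisimulation).
Qed.

Lemma shape_Inv z : Inv (fun x _ => shape x z).
Proof.
split=> [|al|e s|].
- by apply: (shape_invariant HN _ free_bisimulation) => *; dt.
- by apply: (shape_invariant HN _ (sub_bisimulation (asn_term_D2 al))) => *; dt.
- by apply: (shape_invariant HN _ (sub_bisimulation (seq_term_D2 e s))) => *; dt.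
- by apply: (shape_invariant HN _ alpha_bisimulation) => *; dt.
Qed.

Lemma is_fun_zero : is_fun (0 : N).
Proof.
split; first exact: (least_code_zero HN).
  by move=> u /(elem_zero HN).
by move=> x y z /(elem_zero HN).
Qed.

(** Enumerations that agree below [k] agree at [k], since a variable skipped there could not appear
    later. The length may be nonstandard, hence induction inside [N]. *)
Lemma free_vars_unique tau l e l' e' k i :
  free_vars tau l e -> free_vars tau l' e' -> (elem2 k i e <-> elem2 k i e').
Proof.
move=> [[[_ _ fe] le] he me] [[[_ _ fe'] le'] he' me']; move: k i; apply: (N_sind HN); first by ddt.
move=> k IH i.
have aux e1 e2 l2 : (forall k y z, elem2 k y e1 -> elem2 k z e1 -> y = z) ->
    (forall i, (exists y, elem2 i y e2) <-> i ≺ l2) ->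
    (forall i, free i tau <-> exists k, elem2 k i e1) ->
    (forall i, free i tau <-> exists k, elem2 k i e2) ->
    (forall k k' i i', elem2 k i e1 -> elem2 k' i' e1 -> k ≺ k' -> i ≺ i') ->
    (forall k k' i i', elem2 k i e2 -> elem2 k' i' e2 -> k ≺ k' -> i ≺ i') ->
    (forall y, y ≺ k -> forall i, elem2 y i e1 <-> elem2 y i e2) ->
    elem2 k i e1 -> elem2 k i e2.
  move=> f1 g2 h1 h2 m1 m2 ih hk.
  have [k' hk'] : exists k', elem2 k' i e2 by apply/h2/h1; exists k.
  have [hlt|/(le_eq HN) [E|hlt]] := lt_total HN k' k; last 2 first.
  - by rewrite E.
  - have [i' hi'] : exists i', elem2 k i' e2.
      by apply/g2; apply: (lt_trans HN hlt); apply/g2; exists i.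
    have ii := m2 _ _ _ _ hi' hk' hlt.
    have [k2 hk2] : exists k2, elem2 k2 i' e1 by apply/h1/h2; exists k.
    have [hlt2|/(le_eq HN) [E|hlt2]] := lt_total HN k2 k.
    + by have := m2 _ _ _ _ ((ih _ hlt2 _).1 hk2) hi' hlt2 => /(lt_irr HN).
    + by move: ii; rewrite -E in hk2; rewrite (f1 _ _ _ hk hk2) => /(lt_irr HN).
    + by have := lt_trans HN ii (m1 _ _ _ _ hk hk2 hlt2) => /(lt_irr HN).
  - by have := m1 _ _ _ _ ((ih _ hlt i).2 hk') hk hlt => /(lt_irr HN).
split; first exact: (aux e e' l' fe le' he he' me me' IH).
apply: (aux e' e l fe' le he' he me' me) => y hy j.
by rewrite IH.
Qed.

(** The [k]-th free variable of the template receives the [k]-th value, so the assignment depends on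
    [r] and not on the terms in [s] that produced it. *)
Lemma seq_assignment tau l e s r : free_vars tau l e -> is_seq l s -> seq_value s r ->
  exists2 ga, is_fun ga &
    (forall i a, elem2 i a ga <-> exists k, elem2 k i e /\ elem2 k a r) /\
    forall i t, seq_term e s i t -> exists a, (forall a', elem2 i a' ga <-> a' = a) /\ cl_value t a.
Proof.
move=> [[[_ _ fe] le] he me] [_ ls] [l' [[_ ls'] [[_ _ fr] lr] hv]].
have einj k k' i : elem2 k i e -> elem2 k' i e -> k = k'.
  move=> h h'; have [hlt|/(le_eq HN) [//|hlt]] := lt_total HN k k'.
    by case: (lt_irr HN (me _ _ _ _ h h' hlt)).
  by case: (lt_irr HN (me _ _ _ _ h' h hlt)).
pose P x := exists i a, x = pr i a /\ exists k, elem2 k i e /\ elem2 k a r.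
have [||ga [lga hga]] := @elem_code _ HN P (S (pr e r)).
- by rewrite /P; ddt.
- move=> x [i [a [-> [k [/(elem2_lt HN) [_ /ltW h1] /(elem2_lt HN) [_ /ltW h2]]]]]].
  by apply/(leS HN)/(pr_mono HN).
have E i a : elem2 i a ga <-> exists k, elem2 k i e /\ elem2 k a r.
  rewrite /elem2 hga; split=> [[i' [a' [/(pr_inj HN) [-> ->]]]]|h] //.
  by exists i, a.
exists ga; first split=> //.
- by move=> u /hga [i [a [-> _]]]; exists i, a.
- move=> i a a' /E [k [h1 h2]] /E [k' [h1' h2']].
  by rewrite -(einj _ _ _ h1 h1') in h2'; apply: fr h2 h2'.
split=> // i t [k h1 h2].
have [a ha] : exists a, elem2 k a r by apply/lr/ls'; exists t.
exists a; split; last exact: hv h2 ha.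
move=> a'; rewrite E; split=> [[k' [g1 g2]]|->]; last by exists k.
by rewrite (einj _ _ _ g1 h1) in g2; apply: fr g2 ha.
Qed.

(** Each pair is moved to the template: to the closed sentence under the empty assignment, then to
    its renaming obtained from the template, then to the template itself. The assignments reached
    coincide because they are determined by the common values [r]. *)
Lemma similar_invariant X phi al psi be : Inv X -> is_fun al -> is_fun be ->
  similar phi al psi be -> (X phi al <-> X psi be).
Proof.
move=> [_ hasn hseq halpha] fal fbe [tau [_ _ [s [t [_ _ [r hsr htr] ps pt]]]]].
have half s0 ph a0 : is_fun a0 -> seq_value s0 r -> presents tau s0 ph a0 ->
    exists l e, free_vars tau l e /\ exists2 ga,
      is_fun ga & (forall i a, elem2 i a ga <-> exists k, elem2 k i e /\ elem2 k a r) /\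
      (X ph a0 <-> X tau ga).
  move=> fa0 hv [th [th' [[l [e [hl ls hth]]] hth' hal]]].
  have [ga fga [E hga]] := seq_assignment hl ls hv.
  exists l, e; split=> //; exists ga => //; split=> //.
  have -> : X ph a0 <-> X th' 0.
    apply: (hasn a0); split; first by split=> //; exact: is_fun_zero.
    exists 0; split=> //; split; first by move=> i /(elem_zero HN).
    move=> i t0 _ [a h1 h2]; exists a; split; last exact: (numeral_value HN h2).
    by move=> a'; split=> [h|-> //]; case: fa0 => _ _ f0; apply: f0 h h1.
  have -> : X th' 0 <-> X th 0.
    apply: iff_sym; apply: halpha; split; first by split; exact: is_fun_zero.
    exists 0, 0, 0; split=> //.
    by do ![split]; move=> *; exfalso; apply: (elem_zero HN); eassumption.
  apply: iff_sym; apply: (hseq e s0); split; first by split=> //; exact: is_fun_zero.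
  exists 0; split=> //; split; first by move=> i /(elem_zero HN).
  by move=> i t0 _; apply: hga.
have [l [e [hl [ga fga [E ->]]]]] := half _ _ _ fal hsr ps.
have [l' [e' [hl' [ga' fga' [E' ->]]]]] := half _ _ _ fbe htr pt.
suff -> : ga = ga' by [].
case: fga fga' => lg pg _ [lg' pg' _]; apply: (least_code_inj HN lg lg') => u.
have EE i a : elem2 i a ga <-> elem2 i a ga'.
  by rewrite E E'; split=> -[k [h1 h2]]; exists k; split=> //; apply/(free_vars_unique k i hl hl').
by split=> h; [have [i [a Eu]] := pg _ h|have [i [a Eu]] := pg' _ h]; rewrite Eu in h *; apply/EE.
Qed.
End Similar.

(** * The finite stages over a given model *)

Fixpoint tmax (t : tm) : nat :=
  match t with
  | TVar i => i.+1
  | TZero => 0%N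
  | TSucc t => tmax t
  | TAdd s t | TMul s t => maxn (tmax s) (tmax t)
  end.

Fixpoint fmax (p : fm) : nat :=
  match p with
  | FEq s t => maxn (tmax s) (tmax t)
  | FNeg p => fmax p
  | FAnd p q | FOr p q => maxn (fmax p) (fmax q)
  | FEx v p | FAll v p => maxn v.+1 (fmax p)
  end.

Lemma tm_val_dep (M : arith) (e e' : nat -> M) t :
  (forall i, i < tmax t -> e i = e' i) -> tm_val e t = tm_val e' t.
Proof.
elim: t => //= [i|t IH|s IHs t IHt|s IHs t IHt] H; first exact: H; rewrite ?IH // ?IHs ?IHt // => i Hi;
  by apply: H; rewrite leq_max Hi ?orbT.
Qed.

Lemma upd_dep (M : Type) (e e' : nat -> M) v a n :
  (forall i, i < n -> e i = e' i) -> forall i, i < n -> upd e v a i = upd e' v a i.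
Proof. by move=> H i hi; rewrite /upd; case: ifP => // _; apply: H. Qed.

Lemma sat_dep (M : arith) p (e e' : nat -> M) :
  (forall i, i < fmax p -> e i = e' i) -> (sat e p <-> sat e' p).
Proof.
elim: p e e' => //= [s t|p IH|p IHp q IHq|p IHp q IHq|v p IH|v p IH] e e' H.
- by rewrite (tm_val_dep (e' := e')) ?(tm_val_dep (e' := e') (t := t)) // => i hi; apply: H; rewrite leq_max hi ?orbT.
- by rewrite (IH e e').
- by rewrite (IHp e e') ?(IHq e e') // => i hi; apply: H; rewrite leq_max hi ?orbT.
- by rewrite (IHp e e') ?(IHq e e') // => i hi; apply: H; rewrite leq_max hi ?orbT.
- have E a : sat (upd e v a) p <-> sat (upd e' v a) p.
    by apply/IH/upd_dep => i hi; apply: H; rewrite leq_max hi orbT.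
  by split=> -[a ha]; exists a; apply/E.
- have E a : sat (upd e v a) p <-> sat (upd e' v a) p.
    by apply/IH/upd_dep => i hi; apply: H; rewrite leq_max hi orbT.
  by split=> ha a; apply/E.
Qed.

Lemma tm_val_subst (M : arith) (e : nat -> M) v s t :
  tm_val e (tm_subst v s t) = tm_val (upd e v (tm_val e s)) t.
Proof.
by elim: t => //= [i|t ->|t1 -> t2 ->|t1 -> t2 ->] //; rewrite /upd; case: ifP.
Qed.

Lemma upd_upd (M : Type) (e : nat -> M) v a b : upd (upd e v a) v b = upd e v b.
Proof. by apply/funext => i; rewrite /upd; case: (i == v). Qed.

Lemma upd_comm (M : Type) (e : nat -> M) v w a b : (v == w) = false ->
  upd (upd e v a) w b = upd (upd e w b) v a.
Proof.
move=> vw; apply/funext => i; rewrite /upd.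
by case: (eqVneq i w) => [->|_] //; rewrite eq_sym vw.
Qed.

Lemma sat_subst (M : arith) v s p (e : nat -> M) :
  (forall i (e : nat -> M) a, (i == v) = false -> tm_val (upd e i a) s = tm_val e s) ->
  sat e (fm_subst v s p) <-> sat (upd e v (tm_val e s)) p.
Proof.
move=> hs; elim: p e => //= [t1 t2|p IH|p IHp q IHq|p IHp q IHq|i p IH|i p IH] e.
- by rewrite !tm_val_subst.
- by rewrite IH.
- by rewrite IHp IHq.
- by rewrite IHp IHq.
- have E a : sat (upd e i a) (if i == v then p else fm_subst v s p) <-> sat (upd (upd e v (tm_val e s)) i a) p.
    by case: ifP => h; [rewrite (eqP h) upd_upd|rewrite IH hs // upd_comm].
  by split=> -[a ha]; exists a; apply/E.
- have E a : sat (upd e i a) (if i == v then p else fm_subst v s p) <-> sat (upd (upd e v (tm_val e s)) i a) p.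
    by case: ifP => h; [rewrite (eqP h) upd_upd|rewrite IH hs // upd_comm].
  by split=> ha a; apply/E.
Qed.

Fixpoint tm_sub (f : nat -> tm) (t : tm) : tm :=
  match t with
  | TVar i => f i | TZero => TZero | TSucc t => TSucc (tm_sub f t)
  | TAdd s t => TAdd (tm_sub f s) (tm_sub f t) | TMul s t => TMul (tm_sub f s) (tm_sub f t)
  end.

Lemma tm_val_sub (M : arith) (e : nat -> M) f t :
  tm_val e (tm_sub f t) = tm_val (fun i => tm_val e (f i)) t.
Proof. by elim: t => //= [t ->|s -> t ->|s -> t ->]. Qed.

(* Simultaneous substitution, up to equivalence: bound variables are renamed. *)
Lemma sat_sub (M : arith) p (f : nat -> tm) :
  exists q, forall e : nat -> M, sat e q <-> sat (fun i => tm_val e (f i)) p.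
Proof.
have bound (g : nat -> tm) n : exists w, forall i, i < n -> tmax (g i) <= w.
  elim: n => [|n [w hw]]; first by exists 0%N.
  exists (maxn w (tmax (g n))) => i; rewrite ltnS leq_eqVlt => /orP [/eqP ->|/hw h].
    exact: leq_maxr.
  by apply: leq_trans h (leq_maxl _ _).
have quant v p' : (forall f, exists q, forall e : nat -> M, sat e q <-> sat (fun i => tm_val e (f i)) p') ->
    forall f, exists w q, forall (e : nat -> M) a, sat (upd e w a) q <-> sat (upd (fun i => tm_val e (f i)) v a) p'.
  move=> IH {}f; have [w hw] := bound f (fmax p').
  have [q hq] := IH (fun i => if i == v then TVar w else if i < fmax p' then f i else TZero).
  exists w, q => e a; rewrite hq; apply: sat_dep => i hi; rewrite /upd hi; case: ifP => /= _.
    by rewrite eqxx.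
  by apply: tm_val_dep => j hj; case: eqP => // E; move: (leq_trans hj (hw i hi)); rewrite E ltnn.
elim: p f => [s t|p IH|p IHp q IHq|p IHp q IHq|v p IH|v p IH] f.
- by exists (FEq (tm_sub f s) (tm_sub f t)) => e /=; rewrite !tm_val_sub.
- by have [q hq] := IH f; exists (FNeg q) => e /=; rewrite hq.
- by have [p' hp] := IHp f; have [q' hq] := IHq f; exists (FAnd p' q') => e /=; rewrite hp hq.
- by have [p' hp] := IHp f; have [q' hq] := IHq f; exists (FOr p' q') => e /=; rewrite hp hq.
- have [w [q hq]] := quant v p IH f; exists (FEx w q) => e /=.
  by split=> -[a ha]; exists a; apply/hq.
- have [w [q hq]] := quant v p IH f; exists (FAll w q) => e /=.
  by split=> ha a; apply/hq.
Qed.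

Fixpoint iterC (N : arith) (B0 B1 : N -> N -> Prop) (k : nat) : N -> N -> Prop :=
  match k with
  | 0 => fun _ _ => False
  | k.+1 => fun x al => B0 x al \/ (B1 x al /\ Comp (iterC B0 B1 k) x al)
  end.

(** Stages are restricted to numerals up to [n], so an iteration unfolds into a finite disjunction
    over [M], while the same formula [LIt p q] serves all [n]. *)
Fixpoint satn (M : arith) (n : nat) (p : lf) (e : nat -> M) : Prop :=
  match p with
  | LEq s t => lval (num M n) e s = lval (num M n) e t
  | LNeg p => ~ satn n p e
  | LAnd p q => satn n p e /\ satn n q e
  | LEx p => exists a, satn n p (sc a e)
  | LSub ts k p => satn n p (senv (num M n) ts k e)
  | LIt p q => exists k : nat, k <= n /\ e 0%N = num M k /\
      iterC (fun x al => satn n p (sc x (sc al (sh 3 e)))) (fun x al => satn n q (sc x (sc al (sh 3 e))))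
        k (e 1%N) (e 2%N)
  end.

Lemma sc_dep (T : Type) (e e' : nat -> T) n a : (forall i, i < n.-1 -> e i = e' i) ->
  forall i, i < n -> sc a e i = sc a e' i.
Proof. by move=> H [|i] //= hi; apply: H; case: n hi. Qed.

Lemma satn_dep (M : arith) n p (e e' : nat -> M) :
  (forall i, i < bnd p -> e i = e' i) -> satn n p e -> satn n p e'.
Proof.
elim: p e e' => [s t|p IH|p IHp q IHq|p IH|ts k p IH|p IHp q IHq] e e' H.
- by rewrite /= (@lval_dep _ _ s e e') ?(@lval_dep _ _ t e e') // => i hi; apply: H;
    rewrite /= leq_max hi ?orbT.
- by move=> /= h h'; apply: h; apply: IH h' => i hi; rewrite H.
- move=> /= [h1 h2]; split; [apply: IHp h1|apply: IHq h2] => i hi; apply: H; rewrite /= leq_max hi ?orbT //.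
- by move=> /= [a ha]; exists a; apply: IH ha; apply: sc_dep.
- by move=> /=; apply: IH; apply: senv_dep.
- move=> /= [k [hk [h0 h]]]; exists k; split=> //.
  have E i : i < 3 -> e i = e' i.
    by move=> hi; apply: H; apply: (leq_trans hi); rewrite /= ltnS leq_max.
  rewrite -!E //; split=> //.
  have D r : bnd r <= maxn (bnd p) (bnd q) -> (forall e e' : nat -> M, (forall i, i < bnd r -> e i = e' i) -> satn n r e -> satn n r e') ->
      forall x al, satn n r (sc x (sc al (sh 3 e))) = satn n r (sc x (sc al (sh 3 e'))).
    move=> hr IH x al.
    have hi i : i < (bnd r).-2 -> sh 3 e i = sh 3 e' i.
      move=> hi; apply: H; rewrite /= addn3 ltnS; apply: leq_trans (leq_maxr _ _); apply: leq_trans hr.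
      by move: hi; case: (bnd r) => [|[|b]].
    by apply/propext; split; apply: IH; apply: sc_dep; apply: sc_dep => i /hi.
  rewrite (_ : (fun x al => satn n p (sc x (sc al (sh 3 e')))) = (fun x al => satn n p (sc x (sc al (sh 3 e))))).
    rewrite (_ : (fun x al => satn n q (sc x (sc al (sh 3 e')))) = (fun x al => satn n q (sc x (sc al (sh 3 e))))) //.
    by apply/funext => x; apply/funext => al; rewrite D // leq_maxr.
  by apply/funext => x; apply/funext => al; rewrite D // leq_maxl.
Qed.

Definition factor (M : arith) (n : nat) : pre.
Proof.
by exists M (num M n) (@satn M n) => // p e e'; apply: satn_dep.
Defined.

Lemma cD_Comp (J : Type) (N : J -> arith) (K : cls N) X : cP2 K X ->
  cD K (fun j e => Comp (X j (sh 2 e)) (e 0%N) (e 1%N)).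
Proof. by move=> hX; unfold Comp; dt. Qed.

Section FactorClass.
Variable M : arith.

(** Definability in the original language, for which the induction axioms of PA are given. *)
Definition DF : cls (fun _ : unit => M).
Proof.
exists (fun P => exists q, forall e, P tt e <-> sat e q) (fun t => exists u, forall e, t tt e = tm_val e u).
- by move=> s t [u hu] [v hv]; exists (FEq u v) => e /=; rewrite hu hv.
- by move=> P [q hq]; exists (FNeg q) => e /=; rewrite hq.
- by move=> P Q [q hq] [r hr]; exists (FAnd q r) => e /=; rewrite hq hr.
- move=> P [q hq]; set K := fmax q.
  have [q' hq'] := sat_sub M q (fun i => if i is j.+1 then (if j < K then TVar j else TZero) else TVar K).
  have E e a : sat (upd e K a) q' <-> P tt e a.
    rewrite hq' -{2}(sh1_sc a e) -[a in P _ _ a]/(sc a e 0%N) hq; apply: sat_dep => -[|i] hi /=.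
      by rewrite /upd eqxx.
    by rewrite ltnW //= /upd ltn_eqF // ltnW.
  by exists (FEx K q') => e /=; split=> -[a ha]; exists a; apply/E.
- by move=> k; exists (TVar k).
- move=> k t [u hu]; exists (tm_sub (fun i => TVar (i + k)) u) => e.
  by rewrite hu tm_val_sub.
- by exists TZero.
- by move=> s [u hu]; exists (TSucc u) => e; rewrite hu.
- by move=> s t [u hu] [v hv]; exists (TAdd u v) => e; rewrite hu hv.
- by move=> s t [u hu] [v hv]; exists (TMul u v) => e; rewrite hu hv.
Defined.

Lemma DF_spec P : cD DF P <-> exists q, forall e, P tt e <-> sat e q.
Proof. by []. Qed.

Lemma DF_sub P (s : nat -> unit -> (nat -> M) -> M) :
  cD DF P -> (forall i, cT DF (s i)) -> cD DF (fun j e => P j (fun i => s i j e)).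
Proof.
move=> [q hq] hs; have /choice [f hf] : forall i, exists u, forall e, s i tt e = tm_val e u.
  exact: hs.
have [q' hq'] := sat_sub M q f; exists q' => e; rewrite hq' hq.
by rewrite (_ : (fun i => s i tt e) = (fun i => tm_val e (f i))) //; apply/funext.
Qed.

Lemma DF_sub2 P : cD DF P -> cP2 DF (fun j e x y => P j (sc x (sc y e))).
Proof.
move=> hP w t1 t2 [k ->] h1 h2.
pose s i j e := match i with 0 => t1 j e | 1 => t2 j e | i.+2 => e (i + k) end : M.
by apply: cD_ext (DF_sub (s := s) hP _) => [//|[|[|i]]] //; apply: cT_var.
Qed.

Global Opaque DF.

(** This reduces induction for the extended language in a finite stage to the axioms of PA, which
    speak only of formulas in [fm]. *)
Lemma satn_DF n p : cD DF (fun _ e => satn n p e).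
Proof.
have hT t : cT DF (fun _ e => lval (num M n) e t).
  elim: t => /= [i||| t IH|s IHs t IHt|s IHs t IHt].
  - exact: cT_var. - exact: cT_zero. - exact: cT_num.
  - exact: cT_succ. - exact: cT_add. - exact: cT_mul.
elim: p => /= [s t|p IH|p IHp q IHq|p IH|ts k p IH|p IHp q IHq].
- exact: cD_eq.
- exact: cD_not.
- exact: cD_and.
- apply: cD_ex; apply: cD_ext IH => j e; by rewrite sc_sh1.
- apply: (DF_sub (s := fun i j e => senv (num M n) ts k e i) IH) => i.
  by rewrite /senv; case: (i < size ts); [apply: hT|apply: cT_var].
- pose I k (e : nat -> M) x al := iterC (fun x al => satn n p (sc x (sc al e)))
    (fun x al => satn n q (sc x (sc al e))) k x al.
  have sh2 (e : nat -> M) : sc (e 0%N) (sc (e 1%N) (sh 2 e)) = e.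
    by apply/funext => -[|[|i]] //=; rewrite /sh addn2.
  have hI k : cP2 DF (fun _ e x al => I k e x al).
    suff h : cD DF (fun _ e => I k (sh 2 e) (e 0%N) (e 1%N)).
      move=> w t1 t2 hw h1 h2; apply: cD_ext (DF_sub2 h hw h1 h2) => j e.
      by rewrite (_ : sh 2 _ = w j e) //; apply/funext => i; rewrite /sh addn2.
    elim: k => [|k IH]; first exact: cD_false.
    apply: cD_or; first by apply: cD_ext IHp => j e; rewrite sh2.
    apply: cD_and; first by apply: cD_ext IHq => j e; rewrite sh2.
    have {}IH : cP2 DF (fun _ e x al => I k e x al).
      move=> w t1 t2 hw h1 h2; apply: cD_ext (DF_sub2 IH hw h1 h2) => j e.
      by rewrite (_ : sh 2 _ = w j e) //; apply/funext => i; rewrite /sh addn2.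
    exact: (cD_Comp (X := fun _ => I k)).
  have hex m : cD DF (fun _ e => exists k, k < m /\ e 0%N = num M k /\ I k (sh 3 e) (e 1%N) (e 2%N)).
    elim: m => [|m IH]; first by apply: cD_ext (cD_false DF) => j e; split=> // -[k []].
    have hm : cD DF (fun _ e => e 0%N = num M m /\ I m (sh 3 e) (e 1%N) (e 2%N)).
      apply: cD_and; first by dt.
      by apply: (hI m (fun _ e => sh 3 e)); [exists 3|exact: cT_var..].
    apply: cD_ext (cD_or IH hm) => j e; split.
      by case=> [[k [hk h]]|h]; [exists k; split=> //; apply: ltnW|exists m].
    by case=> k []; rewrite ltnS leq_eqVlt => /orP [/eqP ->|hk] h; [right|left; exists k].
  exact: hex n.+1.
Qed.
End FactorClass.

(** * Structures resembling the finite stages *)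

Lemma UD_upd q v w t : shf w -> cT UD t -> cD UD (fun N e => Sat q (upd (w N e) v (t N e))).
Proof.
move=> hw ht.
pose ts := rcons (mkseq (fun i (N : pre) (e : nat -> N) => w N e i) v) t.
have hsw : shf (fun N e => sh v.+1 (w N e)) by apply: shf_sh.
apply: cD_ext (UD_sub (ts := ts) q hsw _).
  move=> N e; rewrite (_ : pcat _ _ = upd (w N e) v (t N e)) //; apply/funext => i.
  rewrite /pcat size_map size_rcons size_mkseq map_rcons nth_rcons size_map size_mkseq /upd ltnS.
  case: ltngtP => hi; last by [].
    by rewrite (nth_map t) ?size_mkseq // nth_mkseq.
  by rewrite /sh subnK.
move=> u; rewrite /ts -cats1 => /List.in_app_iff [|[<-|[]]] //.
case: hw => k ->; rewrite /mkseq => /List.in_map_iff [i [<- _]]; exact: cT_var.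
Qed.

Lemma UD_sat p : cD UD (fun N e => sat e p).
Proof.
have hT t : cT UD (fun N e => tm_val e t).
  elim: t => /= [i||t IH|s IHs t IHt|s IHs t IHt].
  - exact: cT_var. - exact: cT_zero. - exact: cT_succ. - exact: cT_add. - exact: cT_mul.
have hq v p' : cD UD (fun N e => sat e p') -> cD UD (fun N e => sat (upd (sh 1 e) v (e 0%N)) p').
  move=> /UD_spec [q h]; apply: cD_ext (@UD_upd q v (fun N e => sh 1 e) (fun N e => e 0%N) _ _).
  - by move=> N e; rewrite h.
  - by dsh.
  - exact: cT_var.
elim: p => /= [s t|p IH|p IHp q IHq|p IHp q IHq|v p IH|v p IH].
- exact: cD_eq. - exact: cD_not. - exact: cD_and. - exact: cD_or.
- by apply: cD_ex; apply: hq.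
- by apply: cD_all; apply: hq.
Qed.

(** Only [bnd q] variables matter, so a block of that many quantifiers closes the formula. *)
Lemma UD_closure R : cD UD R -> cD UD (fun N _ => forall e, R N e).
Proof.
move=> /UD_spec [q hq].
have hk k : cD UD (fun N e => forall l : seq N, size l = k -> Sat q (pcat l e)).
  elim: k => [|k IH].
    apply: (@cD_ext _ _ _ (fun N e => Sat q e)); last by apply/UD_spec; exists q.
    move=> N e; split=> [h l /size0nil ->|/(_ [::])]; first by rewrite pcat_nil.
    by rewrite pcat_nil; apply.
  apply: (@cD_ext _ _ _ (fun (N : pre) (e : nat -> N) => forall (a : N) (l : seq N), size l = k -> Sat q (pcat l (sc a e)))).
    move=> N e; split=> [h l|h a l hl]; last by rewrite -pcat_rcons; apply: h; rewrite size_rcons hl.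
    by case: (lastP l) => // {}l a; rewrite size_rcons => -[hl]; rewrite pcat_rcons; apply: h.
  by apply: cD_all; apply: cD_ext IH => N e; rewrite sc_sh1.
apply: cD_ext (hk (bnd q)) => N e; split=> [h e'|h l _]; last by apply/hq; apply: h.
apply/hq; apply: Sat_dep (h (mkseq e' (bnd q)) _); last by rewrite size_mkseq.
by move=> i hi; rewrite /pcat size_mkseq hi nth_mkseq.
Qed.

Definition itT (N : pre) (p q : lf) (e : nat -> N) (i x al : N) : Prop :=
  Sat (LIt p q) (sc i (sc x (sc al e))).

Definition it_ax (p q : lf) (N : pre) (e : nat -> N) : Prop :=
  (forall x al, ~ itT p q e zero x al) /\
  forall i, lt_of i cc -> forall x al, itT p q e (succ i) x al <->
    Sat p (sc x (sc al e)) \/ (Sat q (sc x (sc al e)) /\ Comp (itT p q e i) x al).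

Section Good.
Variable M : arith.
Hypothesis hPA : models_PA M.

(** [N] satisfies the common theory of all finite stages; PA, induction and the iteration clauses
    are all obtained from it. *)
Definition good0 (N : pre) : Prop :=
  forall R, cD UD R -> (forall n e, R (factor M n) e) -> forall e : nat -> N, R N e.

Definition good (N : pre) : Prop := good0 N /\ forall n, num N n ≺ cc.

Lemma factor_good0 n : good0 (factor M n).
Proof. by move=> R _; apply. Qed.

Lemma factor_ind n q (e : nat -> factor M n) v :
  Sat q (upd e v zero) -> (forall x, Sat q (upd e v x) -> Sat q (upd e v (succ x))) ->
  forall x, Sat q (upd e v x).
Proof.
have [r hr] := (DF_spec _).1 (@satn_DF M n q).
have hv t : (t = TZero) \/ (t = TSucc (TVar v)) -> sat e (fm_subst v t r) <-> satn n q (upd e v (tm_val e t)).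
  move=> ht; rewrite hr; apply: sat_subst => i e' a iv; case: ht => -> //=.
  by rewrite /upd eq_sym iv.
move=> h0 hS x; have := hPA (PA_induction r v) e; rewrite /= => -[H|H]; last by apply/hr.
exfalso; apply: H; split; first by apply/hv; [left|].
move=> a; have [h|h] := EM (sat (upd e v a) r); last by left.
right.
have -> : sat (upd e v a) (fm_subst v (TSucc (TVar v)) r) <-> sat (upd (upd e v a) v (succ a)) r.
  rewrite sat_subst /=; first by rewrite (_ : upd e v a v = a) // /upd eqxx.
  by move=> i e' b iv; rewrite /= /upd eq_sym iv.
by rewrite upd_upd; apply/hr; apply: hS; apply/hr.
Qed.

Lemma good0_PA N : good0 N -> models_PA N.
Proof.
move=> H p hp; apply: (H (fun N e => sat e p)); first exact: UD_sat.
by move=> n; apply: hPA.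
Qed.

Lemma good0_ipre N : good0 N -> ipre N.
Proof.
move=> H; have hp := good0_PA H.
split.
- by move=> x; have := hp _ PA_S0 (fun _ => x).
- move=> x y h; have [/= []//|//] := hp _ PA_Sinj (sc x (sc y (fun _ => zero))).
- by move=> x; have := hp _ PA_add0 (fun _ => x).
- by move=> x y; have := hp _ PA_addS (sc x (sc y (fun _ => zero))).
- by move=> x; have := hp _ PA_mul0 (fun _ => x).
- by move=> x y; have := hp _ PA_mulS (sc x (sc y (fun _ => zero))).
- move=> A /Dn_spec [l [q hq]] h0 hS.
  pose v := size l; pose e := pcat l (fun _ : nat => zero : N).
  have E x : A x <-> Sat q (upd e v x).
    rewrite (hq (sc x (fun _ => zero))) (_ : pcat _ _ = upd e v x) //; apply/funext => i.
    rewrite /upd /e /pcat; case: eqP => [->|ne]; first by rewrite ltnn subnn.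
    case: ifP => // hi; case k : (i - size l) => [|m] //=.
    by case: ne; apply/eqP; rewrite eqn_leq -subn_eq0 k eqxx leqNgt hi.
  have := H (fun N e => Sat q (upd e v zero) -> (forall x, Sat q (upd e v x) -> Sat q (upd e v (succ x))) ->
    forall x, Sat q (upd e v x)) _ _ e.
  move=> h x; apply/E; apply: h.
  + apply: cD_imp; first by apply: (@UD_upd q v (fun N e => e)); [dsh|dt].
    apply: cD_imp; last by apply: cD_all; apply: (@UD_upd q v (fun N e => sh 1 e)); [dsh|dt].
    by apply: cD_all; apply: cD_imp; apply: (@UD_upd q v (fun N e => sh 1 e)); [dsh|dt|dsh|dt].
  + by move=> n e'; apply: factor_ind.
  + exact/E.
  + by move=> y /E /hS /E.
Qed.

(** In a finite stage every index below [c] is a numeral, so the recursion is that of [iterC]; as a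
    uniformly definable statement it passes to [N]. *)
Lemma good0_it N p q e : good0 N -> @it_ax p q N e.
Proof.
move=> H; apply: H.
  by unfold it_ax, itT; dt.
move=> n {}e; have hF := good0_ipre (@factor_good0 n).
have E i x al k : i = num M k -> k <= n -> @itT (factor M n) p q e i x al <->
    iterC (fun x al => satn n p (sc x (sc al e))) (fun x al => satn n q (sc x (sc al e))) k x al.
  move=> -> hk; rewrite /itT /=.
  have -> : sh 3 (sc (num M k) (sc x (sc al e))) = e.
    by apply/funext => j; rewrite /sh addn3.
  split; last by move=> h; exists k.
  by case=> k' [_ [/(num_inj hF) <-]].
split; first by move=> x al; rewrite (E _ _ _ 0%N).
move=> i /(num_lt hF) [k hk ->] x al; rewrite (E _ _ _ k.+1) //.
rewrite (_ : itT p q e (num (factor M n) k) =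
  iterC (fun x al => satn n p (sc x (sc al e))) (fun x al => satn n q (sc x (sc al e))) k) //.
by apply/funext => y; apply/funext => be; apply/propext; apply: E => //; apply: ltnW.
Qed.

Definition elem_map (N N' : pre) (j : N -> N') := forall p e, Sat p e <-> Sat p (j \o e).

Section ElemMap.
Variables (N N' : pre) (j : N -> N').
Hypothesis hj : elem_map j.

Lemma emap_UD R e : cD UD R -> (R N e <-> R N' (j \o e)).
Proof. by move=> /UD_spec [q hq]; rewrite !hq. Qed.

(** An environment of [N'] may leave the range of [j]; passing to the universal closure before
    transferring removes this difficulty. *)
Lemma emap_good0 : good0 N -> good0 N'.
Proof.
move=> H R hR hv.
have h : forall e, R N e by apply: (H (fun N _ => forall e, R N e)) (fun _ => zero) => //; apply: UD_closure.
exact: (emap_UD (fun _ => zero) (UD_closure hR)).1 h.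
Qed.

Lemma emap_inj : injective j.
Proof.
move=> x y E; have := hj (LEq (LV 0) (LV 1)) (sc x (fun _ => y)).
by rewrite !Sat_eq /= => h; apply/h.
Qed.

Lemma emap_zero : j zero = zero.
Proof.
have := hj (LEq (LV 0) LZ) (fun _ => zero).
by rewrite !Sat_eq /= => h; apply/h.
Qed.

Lemma emap_cc : j cc = cc.
Proof.
have := hj (LEq (LV 0) LC) (fun _ => cc).
by rewrite !Sat_eq /= => h; apply/h.
Qed.

Lemma emap_succ x : j (succ x) = succ (j x).
Proof.
have := hj (LEq (LV 0) (LS (LV 1))) (sc (succ x) (fun _ => x)).
by rewrite !Sat_eq /= => h; apply/h.
Qed.

Lemma emap_add x y : j (add x y) = add (j x) (j y).
Proof.
have := hj (LEq (LV 0) (LA (LV 1) (LV 2))) (sc (add x y) (sc x (fun _ => y))).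
by rewrite !Sat_eq /= => h; apply/h.
Qed.

Lemma emap_mul x y : j (mul x y) = mul (j x) (j y).
Proof.
have := hj (LEq (LV 0) (LM (LV 1) (LV 2))) (sc (mul x y) (sc x (fun _ => y))).
by rewrite !Sat_eq /= => h; apply/h.
Qed.

Lemma emap_num n : j (num N n) = num N' n.
Proof. by elim: n => [|n IH] /=; [apply: emap_zero|rewrite emap_succ IH]. Qed.

Lemma emap_good : good N -> good N'.
Proof.
move=> [h1 h2]; split=> [|n]; first exact: emap_good0.
case: (h2 n) => z hz; exists (j z).
by rewrite -emap_cc -hz emap_add emap_succ emap_num.
Qed.

Lemma emap_sat p e : sat e p <-> sat (j \o e) p.
Proof. exact: (emap_UD e (UD_sat p)). Qed.
End ElemMap.
End Good.

(** * Restricted ultraproducts *)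

Definition enumerable (T : Type) : Prop := exists g : nat -> T, forall x, exists n, g n = x.

Lemma countable_enumerable (T : Type) (x0 : T) : countable [set: T] <-> enumerable T.
Proof.
split=> [/countable_injP [f hf]|[g hg]].
  have [g hg] : {g : nat -> T | forall n x, f x = n -> g n = x}.
    apply: constructive_indefinite_description.
    have /choice [g hg] : forall n, exists y, forall x, f x = n -> y = x.
      move=> n; have [[x hx]|h] := EM (exists x, f x = n).
        by exists x => y hy; apply: hf; rewrite ?inE // hx.
      by exists x0 => x hx; case: h; exists x.
    by exists g.
  by exists g => x; exists (f x); apply: hg.
have /choice [f hf] := hg.
by apply/countable_injP; exists f => x y _ _ E; rewrite -(hf x) -(hf y) E.
Qed.

Lemma enumerable_image (T T' : Type) (f : T -> T') :
  (forall y, exists x, f x = y) -> enumerable T -> enumerable T'.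
Proof.
move=> hf [g hg]; exists (f \o g) => y.
by have [x <-] := hf y; have [n <-] := hg x; exists n.
Qed.

Lemma countType_enumerable (T : countType) (x0 : T) : enumerable T.
Proof.
exists (fun n => odflt x0 (unpickle n)) => x.
by exists (pickle x); rewrite pickleK.
Qed.

Section Ultraproduct.
Variables (I : Type) (Ns : I -> pre) (F : (forall i, Ns i) -> Prop) (U : set (set I)).
Hypothesis FU : UltraFilter U.
Hypothesis skolem : forall p (f : nat -> forall i, Ns i), (forall k, F (f k)) ->
  exists2 g, F g & forall i a, Sat p (sc a (fun k => f k i)) -> Sat p (sc (g i) (fun k => f k i)).
Variable f0 : forall i, Ns i.
Hypothesis F0 : F f0.
Implicit Types f g : forall i, Ns i.

Lemma ultra_mono (A B : set I) : (forall i, A i -> B i) -> U A -> U B.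
Proof. exact: filterS. Qed.

Lemma ultra_and (A B : set I) : U A -> U B -> U (fun i => A i /\ B i).
Proof. exact: filterI. Qed.

Lemma ultra_true (A : set I) : (forall i, A i) -> U A.
Proof. by move=> h; apply: (ultra_mono (A := setT)) filterT => i _. Qed.

Lemma ultra_not (A : set I) : U (fun i => ~ A i) <-> ~ U A.
Proof.
split=> [h1 h2|h].
  apply: (filter_not_empty U); apply: (ultra_mono _ (ultra_and h1 h2)) => i [].
  by [].
by have [] := in_ultra_setVsetC A FU.
Qed.

Lemma ultra_all (A : nat -> set I) n : (forall k, k < n -> U (A k)) -> U (fun i => forall k, k < n -> A k i).
Proof.
elim: n => [|n IH] h; first by apply: ultra_true.
have h1 : U (fun i => forall k, k < n -> A k i) by apply: IH => k hk; apply: h; apply: ltnW.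
apply: ultra_mono (ultra_and h1 (h n (ltnSn n))) => i [h2 h3] k.
by rewrite ltnS leq_eqVlt => /orP [/eqP ->|/h2].
Qed.

Definition uclass f : (forall i, Ns i) -> Prop := fun g => F g /\ U (fun i => f i = g i).
Definition ucar := {A : (forall i, Ns i) -> Prop | exists2 f, F f & A = uclass f}.

Definition ucls f (hf : F f) : ucar := exist _ (uclass f) (ex_intro2 _ _ f hf erefl).

Definition urep (a : ucar) : forall i, Ns i := projT1 (cid2 (proj2_sig a)).

Lemma urepF a : F (urep a).
Proof. by rewrite /urep; case: cid2. Qed.

Lemma ucls_rep a : ucls (urepF a) = a.
Proof.
case: a (urepF a) => A hA; rewrite /urep /=; case: cid2 => f hf E /= hf'.
by subst A; apply: eq_exist.
Qed.

Lemma ucls_eq f g (hf : F f) (hg : F g) : ucls hf = ucls hg <-> U (fun i => f i = g i).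
Proof.
split=> [[E]|E].
  have : uclass f g by rewrite E; split=> //; apply: ultra_true.
  by case.
apply: eq_exist; apply/funext => h; apply/propext; split=> -[h1 h2]; split=> //.
  by apply: ultra_mono (ultra_and E h2) => i [-> ->].
by apply: ultra_mono (ultra_and E h2) => i [-> ->].
Qed.

Lemma urep_cls f (hf : F f) : U (fun i => urep (ucls hf) i = f i).
Proof. by apply/(ucls_eq (urepF _) hf); rewrite ucls_rep. Qed.

(** A Skolem function for the equation of variable 0 with a term is the value of that term, so [F]
    is closed under the operations. *)
Lemma F_op (op : forall i, (nat -> Ns i) -> Ns i) t :
  (forall i e, op i e = lval cc e t) ->
  forall f : nat -> forall i, Ns i, (forall k, F (f k)) -> F (fun i => op i (fun k => f k i)).
Proof.
move=> hop f hf; have [g hg h] := skolem (LEq (LV 0) (lren S t)) hf.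
rewrite (_ : (fun i => _) = g) //; apply: functional_extensionality_dep => i.
have := h i (op i (fun k => f k i)); rewrite !Sat_eq !lval_ren /= => ->.
  by rewrite hop; congr (lval _ _ t); apply/funext.
by rewrite hop; congr (lval _ _ t); apply/funext.
Qed.

Definition uzero := ucls (F_op (op := fun _ _ => zero) (t := LZ) (fun _ _ => erefl) (fun _ => F0)).
Definition ucc := ucls (F_op (op := fun _ _ => cc) (t := LC) (fun _ _ => erefl) (fun _ => F0)).
Definition usucc a := ucls (F_op (op := fun _ e => succ (e 0%N)) (t := LS (LV 0)) (fun _ _ => erefl) (fun _ => urepF a)).
Definition uadd a b := ucls (F_op (op := fun _ e => add (e 0%N) (e 1%N)) (t := LA (LV 0) (LV 1)) (fun _ _ => erefl)
  (f := fun k => if k is 0 then urep a else urep b) (fun k => if k is 0 then urepF a else urepF b)).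
Definition umul a b := ucls (F_op (op := fun _ e => mul (e 0%N) (e 1%N)) (t := LM (LV 0) (LV 1)) (fun _ _ => erefl)
  (f := fun k => if k is 0 then urep a else urep b) (fun k => if k is 0 then urepF a else urepF b)).

Definition uarith := @Arith ucar uzero usucc uadd umul.

Definition usat (p : lf) (e : nat -> uarith) : Prop := U (fun i => Sat p (fun k => urep (e k) i)).

Lemma usuccE a : U (fun i => urep (usucc a) i = succ (urep a i)).
Proof. exact: urep_cls. Qed.

Lemma uaddE a b : U (fun i => urep (uadd a b) i = add (urep a i) (urep b i)).
Proof. exact: urep_cls. Qed.

Lemma umulE a b : U (fun i => urep (umul a b) i = mul (urep a i) (urep b i)).
Proof. exact: urep_cls. Qed.

Lemma urep_val (e : nat -> uarith) t :
  U (fun i => urep (lval (ucc : uarith) e t) i = lval cc (fun k => urep (e k) i) t).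
Proof.
elim: t => /= [k||| t IH|s IHs t IHt|s IHs t IHt].
- exact: ultra_true.
- exact: urep_cls.
- exact: urep_cls.
- by apply: ultra_mono (ultra_and IH (usuccE (lval (ucc : uarith) e t))) => i [E ->] /=; rewrite E.
- by apply: ultra_mono (ultra_and (ultra_and IHs IHt) (uaddE (lval (ucc : uarith) e s) (lval (ucc : uarith) e t))) => i [[E E'] ->] /=; rewrite E E'.
- by apply: ultra_mono (ultra_and (ultra_and IHs IHt) (umulE (lval (ucc : uarith) e s) (lval (ucc : uarith) e t))) => i [[E E'] ->] /=; rewrite E E'.
Qed.

Lemma urep_inj a b : U (fun i => urep a i = urep b i) <-> a = b.
Proof.
rewrite -{2}(ucls_rep a) -{2}(ucls_rep b); exact: iff_sym (ucls_eq _ _).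
Qed.

(** An ultrafilter meets finitely many conditions at a time, and [bnd p] limits the environment to
    finitely many places. *)
Lemma usat_cls p (f : nat -> forall i, Ns i) (e : nat -> uarith) :
  (forall k, k < bnd p -> U (fun i => urep (e k) i = f k i)) ->
  usat p e <-> U (fun i => Sat p (fun k => f k i)).
Proof.
move=> h; have hU := ultra_all h.
split=> H; apply: ultra_mono (ultra_and hU H) => i [h1]; apply: Sat_dep => k hk.
  exact: h1.
by rewrite h1.
Qed.

Definition upre : pre.
Proof.
exists uarith ucc usat.
- move=> s t e; rewrite -urep_inj.
  have H := ultra_and (urep_val e s) (urep_val e t).
  split=> h; apply: ultra_mono (ultra_and H h) => i [[h1 h2]]; first by rewrite Sat_eq h1 h2.
  by rewrite Sat_eq -h1 -h2.
- move=> p e; rewrite -ultra_not.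
  by split; apply: ultra_mono => i; rewrite Sat_neg.
- move=> p q e; split=> [h|[h1 h2]].
    by split; apply: ultra_mono h => i; rewrite Sat_and => -[].
  by apply: ultra_mono (ultra_and h1 h2) => i; rewrite Sat_and.
- have E a (e : nat -> uarith) i : (fun k => urep (sc a e k) i) = sc (urep a i) (fun k => urep (e k) i).
    by apply/funext => -[|k].
  move=> p e; split=> [h|[a h]]; last first.
    by apply: ultra_mono h => i; rewrite Sat_ex E => ?; exists (urep a i).
  have [g hg hs] := skolem p (f := fun k => urep (e k)) (fun k => urepF (e k)).
  exists (ucls hg); apply: (ultra_mono _ (ultra_and (urep_cls hg) h)) => i [h1].
  by rewrite Sat_ex E h1 => -[b /hs].
- move=> ts k p e.
  have E : U (fun i => forall n, n < bnd p ->
      urep (senv (ucc : uarith) ts k e n) i = senv cc ts k (fun k => urep (e k) i) n).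
    apply: ultra_all => n _; rewrite /senv; case: (n < size ts); first exact: urep_val.
    exact: ultra_true.
  split=> h; apply: ultra_mono (ultra_and E h) => i [h1]; rewrite Sat_sub; apply: Sat_dep => n hn.
    by rewrite h1.
  by rewrite h1.
- move=> p e e' h; apply: ultra_mono => i; apply: Sat_dep => k hk.
  by rewrite h.
Defined.

Lemma upre_UD R (f : nat -> forall i, Ns i) (e : nat -> upre) : cD UD R ->
  (forall k, U (fun i => urep (e k) i = f k i)) ->
  R upre e <-> U (fun i => R (Ns i) (fun k => f k i)).
Proof.
move=> /UD_spec [q hq] h; rewrite hq.
have -> : @Sat upre q e <-> U (fun i => Sat q (fun k => f k i)) by apply: usat_cls.
by split; apply: ultra_mono => i; rewrite hq.
Qed.

Lemma upre_good0 M : (forall i, good0 M (Ns i)) -> good0 M upre.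
Proof.
move=> H R hR hv e; apply/(upre_UD (f := fun k => urep (e k)) hR) => [k|]; first exact: ultra_true.
by apply: ultra_true => i; apply: H.
Qed.
End Ultraproduct.

(** * Countability of the language and the first structure *)

Fixpoint ltm_enc (t : ltm) : GenTree.tree nat :=
  match t with
  | LV i => GenTree.Leaf i
  | LZ => GenTree.Node 1 [::]
  | LC => GenTree.Node 2 [::]
  | LS t => GenTree.Node 3 [:: ltm_enc t]
  | LA s t => GenTree.Node 4 [:: ltm_enc s; ltm_enc t]
  | LM s t => GenTree.Node 5 [:: ltm_enc s; ltm_enc t]
  end.

Fixpoint ltm_dec (t : GenTree.tree nat) : ltm :=
  match t with
  | GenTree.Leaf i => LV i
  | GenTree.Node 2 _ => LC
  | GenTree.Node 3 [:: t] => LS (ltm_dec t)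
  | GenTree.Node 4 [:: s; t] => LA (ltm_dec s) (ltm_dec t)
  | GenTree.Node 5 [:: s; t] => LM (ltm_dec s) (ltm_dec t)
  | _ => LZ
  end.

Lemma ltm_encK : cancel ltm_enc ltm_dec.
Proof. by elim=> //= [t ->|s -> t ->|s -> t ->]. Qed.

Fixpoint lf_enc (p : lf) : GenTree.tree nat :=
  match p with
  | LEq s t => GenTree.Node 1 [:: ltm_enc s; ltm_enc t]
  | LNeg p => GenTree.Node 2 [:: lf_enc p]
  | LAnd p q => GenTree.Node 3 [:: lf_enc p; lf_enc q]
  | LEx p => GenTree.Node 4 [:: lf_enc p]
  | LIt p q => GenTree.Node 5 [:: lf_enc p; lf_enc q]
  | LSub ts k p => GenTree.Node 6 [:: GenTree.Leaf k, lf_enc p & map ltm_enc ts]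
  end.

Fixpoint lf_dec (t : GenTree.tree nat) : lf :=
  match t with
  | GenTree.Node 1 [:: s; t] => LEq (ltm_dec s) (ltm_dec t)
  | GenTree.Node 2 [:: p] => LNeg (lf_dec p)
  | GenTree.Node 3 [:: p; q] => LAnd (lf_dec p) (lf_dec q)
  | GenTree.Node 4 [:: p] => LEx (lf_dec p)
  | GenTree.Node 5 [:: p; q] => LIt (lf_dec p) (lf_dec q)
  | GenTree.Node 6 (GenTree.Leaf k :: p :: ts) => LSub (map ltm_dec ts) k (lf_dec p)
  | _ => LEq LZ LZ
  end.

Lemma lf_encK : cancel lf_enc lf_dec.
Proof.
elim=> //= [s t|p ->|p -> q ->|p ->|ts k p ->|p -> q ->] //; first by rewrite !ltm_encK.
by rewrite mapK //; apply: ltm_encK.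
Qed.

Lemma lf_enumerable : enumerable lf.
Proof.
apply: (enumerable_image (f := lf_dec)); first by move=> p; exists (lf_enc p); apply: lf_encK.
exact: (countType_enumerable (GenTree.Leaf 0%N : GenTree.tree nat)).
Qed.

Definition senv_of (N : arith) (l : seq N) : nat -> N := fun i => nth zero l i.

(** A finite list of arguments in place of an environment lets the iterated Skolem functions be
    named by finite trees, hence countably many. *)
Definition witness (N : pre) (p : lf) (l : seq N) : N :=
  if pselect (exists a, Sat p (sc a (senv_of l))) is left h then projT1 (cid h) else zero.

Lemma witnessP (N : pre) p (e : nat -> N) a :
  Sat p (sc a e) -> Sat p (sc (witness p (mkseq e (bnd p))) e).
Proof.
set l := mkseq _ _; have E b : Sat p (sc b e) <-> Sat p (sc b (senv_of l)).
  have h i : i < bnd p -> sc b e i = sc b (senv_of l) i.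
    by case: i => //= i hi; rewrite /senv_of nth_mkseq // ltnW.
  by split; apply: Sat_dep => i /h.
rewrite !E /witness => h; case: pselect => [h'|[]]; first by case: cid.
by exists a.
Qed.

Section Stage0.
Variable M : arith.
Hypothesis hPA : models_PA M.
Hypothesis hM : enumerable M.

Lemma nonprincipal : exists U : set (set nat), UltraFilter U /\ forall n, U (fun k => n < k).
Proof.
pose F : set (set nat) := fun A => exists n, forall k, n < k -> A k.
have FF : ProperFilter F.
  split; first by case=> n /(_ n.+1 (ltnSn n)).
  split.
  - by exists 0%N.
  - move=> A B [n hA] [m hB]; exists (maxn n m) => k; rewrite gtn_max => /andP [h1 h2].
    by split; [apply: hA|apply: hB].
  - by move=> A B AB [n hA]; exists n => k /hA /AB.
have [U [UU hU]] := ultraFilterLemma FF.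
by exists U; split=> // n; apply: hU; exists n.
Qed.

Lemma stage0 : exists N : pre, [/\ good M N, enumerable N &
  exists j : M -> N, forall p e, sat e p <-> sat (j \o e) p].
Proof.
have [gM hgM] := hM; have [gf hgf] := lf_enumerable.
have [U [UU hU]] := nonprincipal.
pose Ns n := factor M n.
(* Leaf 0 stands for the constant [c], whose value in stage [n] is [num M n]; the other leaves are
   the elements of [M]. *)
pose base (k : nat) : forall n, Ns n := if k is k.+1 then fun _ => gM k else fun n => num M n.
pose ev := fix ev (t : GenTree.tree nat) : forall n, Ns n :=
  match t with
  | GenTree.Leaf k => base k
  | GenTree.Node k l => fun n => witness (gf k) [seq ev t n | t <- l]
  end.
pose F (f : forall n, Ns n) := exists t, f = ev t.
have hF p (f : nat -> forall i, Ns i) : (forall k, F (f k)) ->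
    exists2 g, F g & forall i a, Sat p (sc a (fun k => f k i)) -> Sat p (sc (g i) (fun k => f k i)).
  move=> /choice [t ht]; have [kp hkp] := hgf p.
  exists (ev (GenTree.Node kp (mkseq t (bnd p)))); first by eexists.
  move=> i a /witnessP; rewrite /= hkp -map_comp.
  by rewrite (_ : map _ _ = mkseq (fun k => f k i) (bnd p)) //; apply: eq_map => k /=; rewrite ht.
have FM (m : M) : F (fun n => m : Ns n).
  by have [k <-] := hgM m; exists (GenTree.Leaf k.+1).
pose N := upre UU hF (FM (@zero M)).
have Fnum : F (fun n => num M n) by exists (GenTree.Leaf 0%N).
exists N; split.
- split; first by apply: upre_good0 => n; apply: factor_good0.
  move=> k.
  have hk : cD UD (fun N e => num N k ≺ e 0%N) by dt.
  pose f (i : nat) : forall n, Ns n := if i is 0 then fun n => num M n else fun n => zero.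
  have h := upre_UD (f := f) (e := sc (cc : N) (fun _ => zero)) hk.
  apply/h; first by case=> [|i]; apply: urep_cls.
  apply: (ultra_mono UU) (hU k) => n hn.
  apply/(num_lt (good0_ipre hPA (@factor_good0 M n))).
  by exists k.
- apply: (enumerable_image (f := fun t => ucls U (ex_intro _ t erefl : F (ev t)))).
    move=> a; have := urepF a; case=> t E; exists t.
    rewrite -[RHS]ucls_rep; apply/(ucls_eq UU); rewrite E; exact: ultra_true.
  exact: (countType_enumerable (GenTree.Leaf 0%N : GenTree.tree nat)).
- pose j m : N := ucls U (FM m).
  exists j => p e.
  (* All stages have the carrier and operations of [M], so at constant functions an arithmetical
     formula has the same truth value in each of them. *)
  have h := upre_UD (f := fun k n => e k : Ns n) (e := j \o e) (UD_sat p).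
  rewrite h; last by move=> k; apply: urep_cls.
  split=> [h'|h']; first exact: ultra_true.
  have [n hn] := filter_ex h'; exact: hn.
Qed.
End Stage0.

(** * Amalgamation of local truth predicates *)

Section Env.
Variable N : pre.
Local Notation "0" := (@zero (car N)) : arith_scope.

Lemma D3_env (A : N -> N -> N -> Prop) : D3 A ->
  exists q e, forall x y z, A x y z <-> Sat q (sc x (sc y (sc z e))).
Proof.
move=> /Dn_spec [l [q hq]]; pose e0 : nat -> N := fun _ => 0.
pose ts := mkseq (fun i => LV i.+3) (size l) ++ [:: LV 0; LV 1; LV 2].
exists (LSub ts (size l + 3) q), (pcat l e0) => x y z.
rewrite Sat_sub (hq (sc x (sc y (sc z e0)))).
rewrite (_ : pcat l _ = senv cc ts (size l + 3) (sc x (sc y (sc z (pcat l e0))))) //.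
apply/funext => i; rewrite /senv /ts size_cat size_mkseq /=.
have [hi|hi] := ltnP i (size l).
  by rewrite (leq_trans hi) ?leq_addr // nth_cat size_mkseq hi nth_mkseq //= /pcat hi.
rewrite -(subnKC hi); move: (i - size l) => k; rewrite ltn_add2l nth_cat size_mkseq.
have -> : (size l + k < size l) = false by rewrite ltnNge leq_addr.
rewrite addKn {1}/pcat ltnNge leq_addr /= addKn.
case: k => [|[|[|k]]] //=; rewrite subnK ?leq_add2l // -addn3 addnA addn3 /= /pcat.
by rewrite ltnNge leq_addr.
Qed.

Lemma D3_Sat q (e : nat -> N) : D3 (fun x y z => Sat q (sc x (sc y (sc z e)))).
Proof.
apply/Dn_spec; set b := bnd q; exists (mkseq e b).
exists (LSub ([:: LV b; LV b.+1; LV b.+2] ++ mkseq LV b) 0 q) => E.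
rewrite Sat_sub; have H i : i < bnd q ->
  sc (E 0%N) (sc (E 1%N) (sc (E 2%N) e)) i =
  senv cc ([:: LV b; LV b.+1; LV b.+2] ++ mkseq LV b) 0 (pcat (mkseq e b) E) i.
  rewrite /senv size_cat size_mkseq /=.
  case: i => [|[|[|i]]] hi /=; rewrite ?add3n ?ltnS /pcat ?size_mkseq ?ltnn ?subnn //.
  - by rewrite ltnNge leqnSn /= subSnn.
  - have -> : b.+2 - b = 2 by rewrite -addn2 addKn.
    by rewrite ltnNge (leq_trans (leqnSn b)).
  - have hb : i < b by rewrite /b; do 3!apply: ltnW.
    by rewrite hb nth_mkseq //= hb nth_mkseq.
by split; apply: Sat_dep => i hi; rewrite H.
Qed.

Lemma D2_env (A : N -> N -> Prop) : D2 A ->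
  exists q e, forall x y, A x y <-> Sat q (sc x (sc y e)).
Proof.
move=> hA; have [|q [e h]] := @D3_env (fun x y z => A x y); first by ddt.
by exists q, (sc 0 e) => x y; apply: h.
Qed.

Lemma D2_Sat q (e : nat -> N) : D2 (fun x y => Sat q (sc x (sc y e))).
Proof. by have h := D3_Sat q (sh 1 e); rewrite -(sc_sh1 e); ddt. Qed.
End Env.

Definition Comp_at (N : arith) (A : N -> N -> Prop) z :=
  forall x al, shape x z -> (A x al <-> Comp A x al).
Definition eq_at (N : arith) (A B : N -> N -> Prop) z :=
  forall x al, shape x z -> (A x al <-> B x al).

(** Direct subformulas are only required one level higher. This leaves standard levels finite, and
    still their union is closed under direct subformulas. *)
Definition family (N : pre) (G : N -> N -> Prop) : Prop :=
  [/\ D2 G, forall i z, G i z -> G (succ i) z,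
      forall i z z', G i z -> direct_subformula z' z -> G (succ i) z' &
      forall n, exists l : seq N, forall z, G (num N n) z -> List.In z l].

(* The part of a family at standard levels; it is not definable. *)
Definition core (N : pre) (G : N -> N -> Prop) z := exists n, G (num N n) z.

Ltac dmore ::= progress (unfold Comp_at, eq_at); dt.

Section Glue.
Variable N : pre.
Hypothesis HN : ipre N.
Hypothesis HI : forall p q (e : nat -> N), it_ax p q e.
Hypothesis Hc : forall n, num N n ≺ cc.
Implicit Types x y z i k d m g u al be : N.
Implicit Types A B X : N -> N -> Prop.
Local Notation "0" := (@zero (car N)) : arith_scope.
Local Notation S := succ.

(** [itT] takes two formulas with one environment; the selector [k] merges [B0] and [B1], with their
    parameters, into a single formula [r]. *)
Lemma iteration B0 B1 : D2 B0 -> D2 B1 -> exists T, [/\ D3 T, forall x al, ~ T 0 x al &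
  forall i, i ≺ cc -> forall x al, T (S i) x al <-> B0 x al \/ (B1 x al /\ Comp (T i) x al)].
Proof.
move=> h0 h1.
have [|r [e hr]] := @D3_env N (fun k x al => k = 0 /\ B0 x al \/ k = S 0 /\ B1 x al); first by ddt.
have [p hp] : cD UD (fun N e => Sat r (sc zero (sc (e 0%N) (sc (e 1%N) (sh 2 e))))) by dt.
have [q hq] : cD UD (fun N e => Sat r (sc (succ zero) (sc (e 0%N) (sc (e 1%N) (sh 2 e))))) by dt.
have E x al (e' : nat -> N) : sh 2 (sc x (sc al e')) = e' by apply/funext => i; rewrite /sh addn2.
have ne := ax_S0 HN.
exists (itT p q e); have [hT0 hT] := HI p q e; split=> //; first exact: D3_Sat.
move=> i hi x al; rewrite hT // -hp -hq /= !E -!hr.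
by split=> [[[[_ ?]|[/esym/ne]]|[[[/ne]|[_ ?]] ?]]|[?|[? ?]]] //; [left|right|left; left|right; split=> //; right].
Qed.

Lemma Comp_local A B x al z : shape x z ->
  (forall z', direct_subformula z' z -> eq_at A B z') -> (Comp A x al <-> Comp B x al).
Proof.
case/(shapeE HN) => [[s [t [-> _]]]|[a [z' [-> -> ha]]]|[o [a [b [z1 [z2 [[ho [-> ->]] [ha hb]]]]]]]|[q [i [a [z' [-> -> ha]]]]]] H.
- by rewrite !(Comp_eq HN).
- by rewrite !(Comp_neg HN) (H z') //; apply: Or41.
- case: ho H => -> H.
    rewrite !(Comp_and HN) (H z1) // 1?(H z2) //; apply: Or42; [by exists z1; right|by exists z2; left].
  rewrite !(Comp_or HN) (H z1) // 1?(H z2) //; apply: Or43; [by exists z1; right|by exists z2; left].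
- have E be : A a be <-> B a be by apply: (H z') => //; apply: Or44; exists q, 0.
  case: q {H}; rewrite ?(Comp_ex HN) ?(Comp_all HN).
    by split=> -[c [be [? ?]]]; exists c, be; split=> //; apply/E.
  by split=> h c be /h /E.
Qed.

(** Covers at once all combinations of invariant predicates, such as a definition by cases on the
    skeleton. *)
Lemma Inv_comb X :
  (forall x al y be, (forall Y, Inv Y -> (Y x al <-> Y y be)) -> (X x al <-> X y be)) -> Inv X.
Proof.
move=> H; split.
- by move=> x al y be h; apply: H => Y [h1 _ _ _]; apply: h1.
- by move=> a x al y be h; apply: H => Y [_ h1 _ _]; apply: h1 h.
- by move=> e s x al y be h; apply: H => Y [_ _ h1 _]; apply: h1 h.
- by move=> x al y be h; apply: H => Y [_ _ _ h1]; apply: h1.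
Qed.

(** Turns standard finiteness into the existence of a coded enumeration, a statement inside [N] that
    can overspill. *)
Lemma list_code (l : seq N) : exists g, (forall k z, elem2 k z g -> k ≺ num N (size l)) /\
  ((forall k z z', elem2 k z g -> elem2 k z' g -> z = z') /\
   forall z, List.In z l -> exists2 k, k ≺ num N (size l) & elem2 k z g).
Proof.
elim: l => [|a l [g [h1 [h2 h3]]]].
  by exists 0; split; [|split] => [k z /(elem_zero HN)|k z z' /(elem_zero HN)|].
have [s hs] := elem_setU1 HN g (pr (num N (size l)) a).
have E k z : elem2 k z s <-> (k = num N (size l) /\ z = a) \/ elem2 k z g.
  by rewrite /elem2 hs; split=> [[/(pr_inj HN)|]|[[-> ->]|]]; tauto.
have ne k : k ≺ num N (size l) -> k <> num N (size l) by move=> + E'; rewrite E' => /(lt_irr HN).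
exists s; split=> [k z /E [[-> _]|/h1 h]|]; first exact: (ltS HN).
  exact: (lt_trans HN h (ltS HN _)).
split=> [k z z'|z /= [<-|/h3 [k hk hz]]].
- move=> /E [[h ->]|h] /E [[h' ->]|h'] //; last exact: h2 h h'.
    by case: (ne _ (h1 _ _ h')).
  by case: (ne _ (h1 _ _ h)).
- by exists (num N (size l)); [exact: (ltS HN)|apply/E; left].
- by exists k; [exact: (lt_trans HN hk (ltS HN _))|apply/E; right].
Qed.

Section Family.
Variable G : N -> N -> Prop.
Hypothesis hG : family G.

Lemma family_mono i k z : i ≼ k -> G i z -> G k z.
Proof.
case: hG => h1 h2 _ _ [d <-]; move: d; apply: (N_ind HN) => [||d IH]; first by ddt.
  by rewrite (ax_add0 HN).
by rewrite (ax_addS HN) => /IH; apply: h2.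
Qed.
End Family.

Lemma familyU G H : family G -> family H -> family (fun i z => G i z \/ H i z).
Proof.
case=> g1 g2 g3 g4 [h1 h2 h3 h4]; split; first by ddt.
- by move=> i z [/g2|/h2]; [left|right].
- by move=> i z z' [/g3|/h3] h /h; [left|right].
- move=> n; have [l hl] := g4 n; have [l' hl'] := h4 n; exists (l ++ l') => z.
  by move=> h; apply/List.in_app_iff; case: h => [/hl|/hl']; [left|right].
Qed.

(** By monotonicity a member of [E] enters [G] at one step at most. The indices of members lie below
    [m], so one of the [m + 1] steps starting at level [d] sees no member enter. *)
Lemma break G (E : N -> Prop) d m g : family G -> D1 E ->
  (forall k z z', elem2 k z g -> elem2 k z' g -> z = z') ->
  (forall z, E z -> exists2 k, k ≺ m & elem2 k z g) ->
  exists u, u ≼ m /\ forall z, E z -> G (S (add d u)) z -> G (add d u) z.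
Proof.
move=> hG hE hg hcov; apply: contrapT => H; have [hD _ _ _] := hG.
pose R u k := exists z, [/\ E z, elem2 k z g, G (S (add d u)) z & ~ G (add d u) z].
have [||u [u' [k [ne [z [_ hk h1 h2]] [z' [_ hk' h1' h2']]]]]] := @pigeonhole N HN R m.
- by rewrite /R; ddt.
- move=> u hu; have [[z [h1 [h2 h3]]]|h] := EM (exists z, E z /\ (G (S (add d u)) z /\ ~ G (add d u) z)).
    by have [k hk hz] := hcov z h1; exists k => //; exists z.
  case: H; exists u; split=> // z h1 h2; apply: contrapT => h3.
  by apply: h; exists z.
rewrite -(hg _ _ _ hk hk') in h1' h2'.
have aux v w : v ≺ w -> G (S (add d v)) z -> G (add d w) z.
  by move=> [c <-]; apply: (family_mono hG); apply/(ltSle HN); exists c; rewrite (N_addA HN).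
have [h|/(le_eq HN) [E'|h]] := lt_total HN u u'.
- by apply: h2'; apply: aux h h1.
- by apply: ne.
- by apply: h2; apply: aux h h1'.
Qed.
End Glue.

Section Amalgamation.
Variable N : pre.
Hypothesis HN : ipre N.
Hypothesis HI : forall p q (e : nat -> N), it_ax p q e.
Hypothesis Hc : forall n, num N n ≺ cc.
Implicit Types x y z i k d m g u v al be : N.
Implicit Types A B X : N -> N -> Prop.
Local Notation "0" := (@zero (car N)) : arith_scope.
Local Notation S := succ.

(* The truth clauses are iterated from the values A1 on W1 and A2 on W2.
   If stage i + 1 changes the value at a shape, then stage i does so at a smaller
   one; hence nothing changes after as many stages as W3 has elements. *)
Lemma assemble (W1 W2 W3 : N -> Prop) A1 A2 g m :
  D1 W1 -> D1 W2 -> D1 W3 -> D2 A1 -> D2 A2 -> Inv A1 -> Inv A2 ->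
  (forall k z z', elem2 k z g -> elem2 k z' g -> z = z') ->
  (forall z, W3 z -> exists2 k, k ≺ m & elem2 k z g) -> S (S m) ≼ cc ->
  exists A, [/\ D2 A, Inv A, forall z, W1 z -> eq_at A A1 z,
    forall z, ~ W1 z -> W2 z -> eq_at A A2 z &
    forall z, ~ W1 z -> ~ W2 z -> W3 z -> Comp_at A z].
Proof.
move=> dW1 dW2 dW3 dA1 dA2 iA1 iA2 gfun gcov hm.
(* [W1] has priority over [W2]; outside both, the clauses are applied on [W3] only, and all other
   values are false. *)
pose B0 x al := exists z, shape x z /\ ((W1 z /\ A1 x al) \/ (~ W1 z /\ W2 z /\ A2 x al)).
pose B1 x (al : N) := exists z, shape x z /\ (~ W1 z /\ ~ W2 z /\ W3 z).
have [||T [dT T0 TS]] := @iteration N HN HI B0 B1; first by rewrite /B0; ddt.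
  by rewrite /B1; ddt.
have hcc i : i ≼ S m -> i ≺ cc.
  by move=> h; apply/(ltSle HN); apply: (le_trans HN _ hm); apply/(ltSle HN)/(leS HN).
have E1 i z : i ≺ cc -> W1 z -> eq_at (T (S i)) A1 z.
  move=> hi h x al hx; rewrite TS //; split.
    by case=> [[z' [/(shape_fun HN hx) <- []]]|[[z' [/(shape_fun HN hx) <- []]]]] //; tauto.
  by move=> h'; left; exists z; split=> //; left.
have E2 i z : i ≺ cc -> ~ W1 z -> W2 z -> eq_at (T (S i)) A2 z.
  move=> hi h1 h x al hx; rewrite TS //; split.
    by case=> [[z' [/(shape_fun HN hx) <- []]]|[[z' [/(shape_fun HN hx) <- []]]]] //; tauto.
  by move=> h'; left; exists z; split=> //; right.
have E3 i z : i ≺ cc -> ~ W1 z -> ~ W2 z -> W3 z -> eq_at (T (S i)) (Comp (T i)) z.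
  move=> hi h1 h2 h x al hx; rewrite TS //; split.
    by case=> [[z' [/(shape_fun HN hx) <- []]]|[_ ?]] //; tauto.
  by move=> h'; right; split=> //; exists z.
have E4 i z : i ≺ cc -> ~ W1 z -> ~ W2 z -> ~ W3 z -> forall x al, shape x z -> ~ T (S i) x al.
  move=> hi h1 h2 h x al hx; rewrite TS //.
  by case=> [[z' [/(shape_fun HN hx) <- []]]|[[z' [/(shape_fun HN hx) <- []]]]] //; tauto.
have Tinv i : i ≼ cc -> Inv (T i).
  move: i; apply: (N_ind HN) => [||i IH hi].
  - apply: cD_imp; first by dt.
    by apply: (@cD_Inv _ _ _ (fun _ e => T (e 0%N)) (fun _ e => e)); [move=> w t1 t2 hw h1 h2; dt|dsh].
  - by move=> _; apply: Inv_comb => x al y be _; split=> /T0.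
  have {}hi : i ≺ cc by apply/(ltSle HN).
  have iC := Comp_Inv HN (IH (ltW hi)).
  apply: Inv_comb => x al y be h.
  have hs z : shape x z <-> shape y z by apply: (h (fun x _ => shape x z)); apply: (shape_Inv HN).
  have h1 := h _ iA1; have h2 := h _ iA2; have h3 := h _ iC.
  rewrite !TS // /B0 /B1 h3.
  by split=> -[[z [hz hz']]|[[z [hz hz']] hC]]; [left; exists z|right; split=> //; exists z|
    left; exists z|right; split=> //; exists z]; move: hz hz'; rewrite hs; tauto.
pose U i z := ~ eq_at (T i) (T (S i)) z.
have Udown i z : S i ≺ cc -> U (S i) z -> W3 z /\ exists2 z', z' ≺ z & U i z'.
  move=> hi hU; have hi' : i ≺ cc by apply: (lt_trans HN (ltS HN i) hi).
  have [h1|h1] := EM (W1 z).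
    by case: hU => x al hx; rewrite (E1 _ _ hi' h1) // (E1 _ _ hi h1).
  have [h2|h2] := EM (W2 z).
    by case: hU => x al hx; rewrite (E2 _ _ hi' h1 h2) // (E2 _ _ hi h1 h2).
  have [h3|h3] := EM (W3 z); last first.
    by case: hU => x al hx; split=> h; [case: (E4 _ _ hi' h1 h2 h3 x al hx h)|case: (E4 _ _ hi h1 h2 h3 x al hx h)].
  split=> //; apply: contrapT => H; case: hU => x al hx.
  rewrite (E3 _ _ hi' h1 h2 h3) // (E3 _ _ hi h1 h2 h3) //.
  apply: (@Comp_local N HN _ _ x al z hx) => z' hz'; apply: contrapT => hU'; apply: H; exists z' => //.
  case: hz' => [->|[? [->|->]]|[? [->|->]]|[? [? ->]]];
    by [apply: (lt_un HN)|apply: (lt_bin1 HN)|apply: (lt_bin2 HN)|apply: (lt_qu HN)].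
have dU : D2 U by rewrite /U; ddt.
have stable z : eq_at (T (S m)) (T (S (S m))) z.
  apply: contrapT => hz.
  have Uex i : i ≼ S m -> exists z, U i z.
    have aux j : forall i, i ⊕ j = S m -> exists z, U i z.
      move: j; apply: (N_ind HN) => [||j IH k].
      - by ddt.
      - by move=> k; rewrite (ax_add0 HN) => ->; exists z.
      - rewrite (ax_addS HN) (N_addC HN) -(ax_addS HN) (N_addC HN) => E.
        have [z' hz'] := IH _ E; have [|_ [z2 _ h2]] := Udown k z' _ hz'; last by exists z2.
        by apply: hcc; exists j.
    by case=> j; apply: aux.
  (* The least places of change increase strictly with the stage, so the stages from 1 to [S m]
     would have [m + 1] distinct places in [W3]. *)
  pose V i z := U i z /\ forall y, y ≺ z -> ~ U i y.
  have Vex i : i ≼ S m -> exists z, V i z.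
    move=> /Uex [z0 h0]; have [|z1 [h1 _ h2]] := @N_least N HN (U i) z0 _ h0; first by ddt.
    by exists z1.
  have Vlt i k y y' : i ⊕ S k ≼ S m -> V i y -> V (i ⊕ S k) y' -> y ≺ y'.
    move=> hk [hy hmin]; move: k hk y'; apply: (N_ind HN) => [||k IH hk y' [hy' _]].
    - by rewrite /V; ddt.
    - rewrite (ax_addS HN) (ax_add0 HN) => hk y' [hy' _].
      have [_ [y2 h2 h3]] := Udown _ _ (hcc _ hk) hy'.
      by apply: (le_lt_trans HN _ h2); have [/hmin|] := lt_total HN y2 y.
    - rewrite (ax_addS HN) in hk hy'.
      have hk' := le_trans HN (ltW (ltS HN (i ⊕ S k))) hk.
      have [_ [y2 h2 h3]] := Udown _ _ (hcc _ hk) hy'.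
      have [y3 hy3] := Vex _ hk'.
      apply: (lt_trans HN (IH hk' y3 hy3)); apply: (le_lt_trans HN _ h2).
      by have [/(hy3.2 _)|] := lt_total HN y2 y3.
  pose R u k := exists z, [/\ u ≼ m, V (S u) z & elem2 k z g].
  have [||u [u' [k [ne [z1 [um hV hk]] [z2 [um' hV' hk']]]]]] := @pigeonhole N HN R m.
  - by rewrite /R /V; ddt.
  - move=> u hu; have hu' : S u ≼ S m by apply/(ltSle HN)/(leS HN).
    have [z1 hz1] := Vex _ hu'.
    have [hW _] := Udown u z1 (hcc _ hu') hz1.1.
    by have [k hk hkz] := gcov _ hW; exists k => //; exists z1.
  rewrite -(gfun _ _ _ hk hk') in hV'.
  have aux v w : v ≺ w -> w ≼ m -> V (S v) z1 -> V (S w) z1 -> False.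
    case=> c <- hw; have E : S (v ⊕ S c) = S v ⊕ S c by rewrite !(ax_addS HN) (N_addC HN (S v)) (ax_addS HN) (N_addC HN c).
    rewrite E => h1 h2; apply: (lt_irr HN (x := z1)); apply: Vlt h1 h2.
    by rewrite -E; apply/(ltSle HN)/(leS HN).
  have [h|/(le_eq HN) [E'|h]] := lt_total HN u u'.
  - exact: aux h um' hV hV'.
  - exact: ne.
  - exact: aux h um hV' hV.
exists (T (S m)); split.
- by ddt.
- by apply: Tinv; apply: ltW; apply: hcc; apply: (le_refl HN).
- by move=> z; apply: E1; apply: hcc; apply/ltW/(ltS HN).
- by move=> z; apply: E2; apply: hcc; apply/ltW/(ltS HN).
- move=> z h1 h2 h3 x al hx; rewrite (stable z) //.
  by apply: (E3 _ z) => //; apply: hcc; apply: (le_refl HN).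
Qed.

(** The hypotheses survive up to a nonstandard level [d0]. Level [d] of [E] has fewer than [m]
    members, and at the levels [r] of [G] and [r'] of [H] none of them is about to enter. A member
    with its direct subformulas in [E d] therefore has them inside [G r] or [H r'] as soon as it
    lies there itself, and keeps the values of [A1] or [A2]; what is left is iterated. *)
Lemma glue G H Dl A1 A2 : family G -> family H -> family Dl ->
  D2 A1 -> D2 A2 -> Inv A1 -> Inv A2 ->
  (forall z, core G z -> Comp_at A1 z) -> (forall z, core H z -> Comp_at A2 z) ->
  (forall z, core G z -> core H z -> eq_at A1 A2 z) ->
  exists A, [/\ D2 A, Inv A, forall z, core G z -> eq_at A A1 z, forall z, core H z -> eq_at A A2 z &
    forall z, core G z \/ core H z \/ core Dl z -> Comp_at A z].
Proof.
move=> hG hH hDl dA1 dA2 iA1 iA2 c1 c2 c12.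
have [dG _ sG _] := hG; have [dH _ sH _] := hH; have [dD _ sD _] := hDl.
(* [H] is included because a member of its core may lie in [G r], where [A1] has priority; its
   direct subformulas must then lie in [G r] too. *)
pose E i z := Dl i z \/ H i z.
have hE : family E := familyU hDl hH; have [dE _ sE fE] := hE.
have [|||d0 [nd0 d0c hd0]] := @overspill N HN (fun i => forall z, (G i z -> Comp_at A1 z) /\
   ((H i z -> Comp_at A2 z) /\ (G i z -> H i z -> eq_at A1 A2 z))) cc.
- by ddt.
- move=> n z; split; first by move=> h; apply: c1; exists n.
  by split=> [h|h h']; [apply: c2; exists n|apply: c12; exists n].
- exact: Hc.
(* Both [d] and the offsets [u], [v] are at most [m], so [m + m] bounds the levels used; [m + 2]
   stages of iteration must be available up to [c]. *)
have [|||m [nm md0 /(_ _ (le_refl HN m)) [hm hmc]]] :=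
   @overspill N HN (fun i => i ⊕ i ≼ d0 /\ S (S i) ≼ cc) d0.
- by ddt.
- move=> n; split; last exact: (ltW (Hc n.+2)).
  have -> : num N n ⊕ num N n = num N (n + n).
    elim: {2 4}n => [|k IH]; first by rewrite addn0 (ax_add0 HN).
    by rewrite addnS /= (ax_addS HN) IH.
  exact: (ltW (nd0 _)).
- exact: nd0.
have [|||d [nd dm /(_ _ (le_refl HN d)) [g [gfun gcov]]]] := @overspill N HN (fun i => exists g,
   (forall k z z', elem2 k z g -> elem2 k z' g -> z = z') /\
   forall z, E i z -> exists2 k, k ≺ m & elem2 k z g) m.
- by ddt.
- move=> n; have [l hl] := fE n; have [g [_ [h2 h3]]] := list_code HN l.
  exists g; split=> // z /hl /h3 [k hk hz]; exists k => //.
  exact: (lt_trans HN hk (nm _)).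
- exact: nm.
have dE1 : D1 (E d) by ddt.
have [u [um bG]] := break HN d hG dE1 gfun gcov.
have [v [vm bH]] := break HN d hH dE1 gfun gcov.
set r := d ⊕ u in bG; set r' := d ⊕ v in bH.
have hr : r ≼ d0 by apply: (le_trans HN _ hm); apply: (le_add HN).
have hr' : r' ≼ d0 by apply: (le_trans HN _ hm); apply: (le_add HN).
have stdle n w : num N n ≼ d ⊕ w by apply: (le_trans HN (ltW (nd n))); apply: le_addr.
have [||||A [dA iA a1 a2 a3]] := @assemble (G r) (H r') (Dl d) A1 A2 g m _ _ _ dA1 dA2 iA1 iA2 gfun _ hmc.
- by ddt.
- by ddt.
- by ddt.
- by move=> z hz; apply: gcov; left.
have a12 z : G r z -> H r' z -> eq_at A1 A2 z.
  move=> h1 h2; have [h|h] := le_total HN r r'.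
    by have [_ [_]] := hd0 _ hr' z; apply=> //; apply: (family_mono HN hG h).
  by have [_ [_]] := hd0 _ hr z; apply=> //; apply: (family_mono HN hH h).
have a2' z : H r' z -> eq_at A A2 z.
  move=> h2; have [h1|h1] := EM (G r z); last exact: a2.
  by move=> x al hx; rewrite (a1 _ h1) // (a12 _ h1 h2).
have viaA1 z : G r z -> (forall z', direct_subformula z' z -> G r z') -> Comp_at A z.
  move=> h1 hs x al hx; have [cz _] := hd0 _ hr z.
  rewrite (a1 _ h1) // (cz h1) //; apply: iff_sym; apply: (@Comp_local N HN _ _ x al z hx) => z' /hs; exact: a1.
have viaA2 z : H r' z -> ~ G r z -> (forall z', direct_subformula z' z -> H r' z') -> Comp_at A z.
  move=> h1 h2 hs x al hx; have [_ [cz _]] := hd0 _ hr' z.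
  rewrite (a2 _ h2 h1) // (cz h1) //; apply: iff_sym; apply: (@Comp_local N HN _ _ x al z hx) => z' /hs; exact: a2'.
exists A; split=> //.
- by move=> z [n hn]; apply: a1; apply: (family_mono HN hG (stdle n u)).
- by move=> z [n hn]; apply: a2'; apply: (family_mono HN hH (stdle n v)).
have inE n z : E (num N n) z -> Comp_at A z \/ ~ G r z /\ ~ H r' z.
  move=> hz; have sub z' : direct_subformula z' z -> E d z'.
    move=> /(sE _ _ _ hz); apply: (family_mono HN hE); exact: (ltW (nd n.+1)).
  have [h1|h1] := EM (G r z).
    by left; apply: viaA1 => // z' hz'; apply: bG; [apply: sub|apply: sG hz'].
  have [h2|h2] := EM (H r' z); last by right.
  by left; apply: viaA2 => // z' hz'; apply: bH; [apply: sub|apply: sH hz'].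
move=> z [[n hz]|[[n hz]|[n hz]]].
- apply: viaA1; first exact: (family_mono HN hG (stdle n u)).
  by move=> z' /(sG _ _ _ hz); apply: (family_mono HN hG (stdle n.+1 u)).
- have [//|[_ []]] := inE n z (or_intror hz).
  exact: (family_mono HN hH (stdle n v)).
- have [//|[h1 h2]] := inE n z (or_introl hz).
  by apply: a3 => //; apply: (family_mono HN hDl (ltW (nd n))).
Qed.
End Amalgamation.

(** * Extending a class over a countable structure *)

Lemma prod_enumerable (T T' : Type) : enumerable T -> enumerable T' -> enumerable (T * T').
Proof.
move=> [f hf] [g hg]; apply: (enumerable_image (f := fun p : nat * nat => (f p.1, g p.2))).
  by move=> [x y]; have [m <-] := hf x; have [n <-] := hg y; exists (m, n).
exact: countType_enumerable (0%N, 0%N).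
Qed.

Lemma seq_enumerable (T : Type) : enumerable T -> enumerable (seq T).
Proof.
move=> [f hf]; apply: (enumerable_image (f := map f)); last exact: (countType_enumerable [::]).
elim=> [|x s [l <-]]; first by exists [::].
by have [n <-] := hf x; exists (n :: l).
Qed.

Lemma D2_enumeration (N : pre) : enumerable N ->
  exists g : nat -> N -> N -> Prop, forall A, D2 A -> exists n, g n = A.
Proof.
move=> hN; have [g hg] := prod_enumerable lf_enumerable (seq_enumerable hN).
exists (fun n x y => Sat (g n).1 (sc x (sc y (senv_of (g n).2)))) => A /D2_env [q [e h]].
have [n hn] := hg (q, mkseq e (bnd q)); exists n; rewrite hn /=.
apply/funext => x; apply/funext => y; apply/propext; rewrite h.
have E i : i < bnd q -> sc x (sc y e) i = sc x (sc y (senv_of (mkseq e (bnd q)))) i.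
  by case: i => [|[|i]] //= hi; rewrite /senv_of nth_mkseq //; do 2!apply: ltnW.
by split; apply: Sat_dep => i /E.
Qed.

(** Only the core is constrained, so the predicate may change from family to family and [S] itself
    may be undefinable. *)
Definition locally_definable (N : pre) (S : N -> N -> Prop) : Prop :=
  forall F, family F -> exists A, [/\ D2 A, Inv A,
    forall z, core F z -> Comp_at A z & forall z, core F z -> eq_at S A z].

(** A class prescribed on the skeletons in [Z]. The part of a core inside [Z] must again be the core
    of a family, since amalgamation works with families. *)
Definition local_base (N : pre) (Z : N -> Prop) (S : N -> N -> Prop) : Prop :=
  forall F, family F -> exists H A, [/\ family H, forall z, core H z <-> core F z /\ Z z,
    D2 A /\ Inv A, forall z, core H z -> Comp_at A z & forall z, core H z -> eq_at S A z].

Section Extension.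
Variable N : pre.
Hypothesis HN : ipre N.
Hypothesis HI : forall p q (e : nat -> N), it_ax p q e.
Hypothesis Hc : forall n, num N n ≺ cc.
Implicit Types x y z i k g al : N.
Implicit Types A : N -> N -> Prop.
Local Notation "0" := (@zero (car N)) : arith_scope.
Local Notation S := succ.

Lemma subformulas_finite z : exists l : seq N, forall z', direct_subformula z' z -> List.In z' l.
Proof.
have [[a E]|h1] := EM (exists a, z = un UNeg a).
  exists [:: a] => z'; rewrite E.
  by case=> [/(un_inj HN) [_ ->]|[? [?|?]]|[? [?|?]]|[? [? ?]]]; [left|sdisc..].
have [[o [a [b E]]]|h2] := EM (exists o a b, z = bin o a b).
  exists [:: a; b] => z'; rewrite E.
  by case=> [?|[? [/(bin_inj HN) [_ -> ->]|/(bin_inj HN) [_ -> ->]]]|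
    [? [/(bin_inj HN) [_ -> ->]|/(bin_inj HN) [_ -> ->]]]|[? [? ?]]]; try sdisc; simpl; tauto.
have [[q [i [a E]]]|h3] := EM (exists q i a, z = qu q i a).
  exists [:: a] => z'; rewrite E.
  by case=> [?|[? [?|?]]|[? [?|?]]|[? [? /(qu_inj HN) [_ _ ->]]]]; try sdisc; left.
exists [::] => z' [E|[a E]|[a E]|[q [i E]]].
- by apply: h1; exists z'.
- by apply: h2; case: E; [exists BAnd, z', a|exists BAnd, a, z'].
- by apply: h2; case: E; [exists BOr, z', a|exists BOr, a, z'].
- by apply: h3; exists q, i, z'.
Qed.

(** Level [i] consists of the ends of coded chains from [z0], each step staying or passing to a
    direct subformula. Coding makes the levels definable, and the finitely many choices per step
    make standard levels finite. *)
Lemma neighbourhood z0 : exists2 G, family G & core G z0.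
Proof.
pose st y' y := y' = y \/ direct_subformula y' y.
pose P g i := [/\ forall k y y', elem2 k y g -> elem2 k y' g -> y = y',
  forall k, k ≼ i -> exists y, elem2 k y g, elem2 0 z0 g &
  forall k y y', k ≺ i -> elem2 k y g -> elem2 (S k) y' g -> st y' y].
pose G i z := exists g, P g i /\ elem2 i z g.
have GS i z z' : G i z -> st z' z -> G (S i) z'.
  move=> [g [[gf gt g0 gs] hz]] hz'.
  pose X w := w = pr (S i) z' \/ exists k y, [/\ w = pr k y, k ≼ i & elem2 k y g].
  have [||s [_ hs]] := @elem_code N HN X (g ⊕ S (pr (S i) z')).
  - by rewrite /X; ddt.
  - move=> w [->|[k [y [-> _ /(elem_lt HN) h]]]].
      exact: (lt_le_trans HN (ltS HN _) (le_addl HN _ _)).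
    by apply: (lt_le_trans HN h); apply: le_addr.
  have E k y : elem2 k y s <-> (k = S i /\ y = z') \/ (k ≼ i /\ elem2 k y g).
    rewrite /elem2 hs; split=> [[/(pr_inj HN)|[k' [y' [/(pr_inj HN) [-> ->]]]]]|[[-> ->]|[h h']]].
    - by left. - by right. - by left.
    - by right; exists k, y.
  have ne k : k ≼ i -> k <> S i.
    by move=> h E'; apply: (lt_irr HN (x := S i)); rewrite -{1}E'; apply/(leS HN).
  exists s; split; last by apply/E; left.
  split.
  - move=> k y y' /E [[h ->]|[h hy]] /E [[h' ->]|[h' hy']] //; last exact: gf hy hy'.
      by case: (ne _ h').
    by case: (ne _ h).
  - move=> k /(le_eq HN) [->|/(leS HN) h]; first by exists z'; apply/E; left.
    by have [y hy] := gt k h; exists y; apply/E; right.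
  - by apply/E; right; split=> //; apply: le0.
  - move=> k y y' /(leS HN) hk /E [[h _]|[_ hy]]; first by case: (ne _ hk).
    move=> /E [[h ->]|[h hy']]; first by rewrite (ax_Sinj HN h) in hy *; rewrite (gf _ _ _ hy hz).
    by apply: (gs k) => //; apply/(ltSle HN).
exists G.
  split.
  - by rewrite /G /P /st; ddt.
  - by move=> i z h; apply: GS h _; left.
  - by move=> i z z' h h'; apply: GS h _; right.
  - elim=> [|n [l hl]].
      by exists [:: z0] => z [g [[gf _ g0 _] hz]]; left; apply: gf g0 hz.
    have [l' hl'] : exists l', forall y z, List.In y l -> direct_subformula z y -> List.In z l'.
      elim: l {hl} => [|a l [l' IH]]; first by exists [::].
      have [l2 h2] := subformulas_finite a; exists (l2 ++ l') => y z /= [<-|hy] hz;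
        apply/List.in_app_iff; [left; exact: h2|right; exact: IH hy hz].
    exists (l ++ l') => z [g [[gf gt g0 gs] hz]]; apply/List.in_app_iff.
    have nS : num N n ≼ S (num N n) := ltW (ltS HN _).
    have [y hy] := gt _ nS.
    have /hl hly : G (num N n) y.
      exists g; split=> //; split=> // [k hk|k y1 y2 hk]; first by apply: gt; apply: (le_trans HN hk).
      by apply: gs; apply: (lt_le_trans HN hk).
    by case: (gs _ _ _ (ltS HN _) hy hz) => [->|h]; [left|right; apply: hl' h].
exists 0%N; have [s hs] := elem_setU1 HN 0 (pr 0 z0).
have E k y : elem2 k y s <-> k = 0 /\ y = z0.
  rewrite /elem2 hs; split=> [[/(pr_inj HN)//|/(elem_zero HN)//]|[-> ->]]; by left.
exists s; split; last exact/E.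
split.
- by move=> k y y' /E [_ ->] /E [_ ->].
- move=> k hk; exists z0; apply/E; split=> //.
  by have [//|/(lt0 HN)] := le_eq HN hk.
- exact/E.
- by move=> k y y' /(lt0 HN).
Qed.

(** Families are definable from finitely many parameters, so they can be enumerated. Each is added
    by [glue], whose second predicate carries the prescribed values [Sg]. *)
Lemma local_extension Z Sg : enumerable N -> local_base Z Sg ->
  exists S, locally_definable S /\ forall z, Z z -> eq_at S Sg z.
Proof.
move=> hN hZ; have [gF hgF] := D2_enumeration hN.
pose good (s : (N -> N -> Prop) * (N -> N -> Prop)) := [/\ family s.1, D2 s.2, Inv s.2,
  forall z, core s.1 z -> Comp_at s.2 z & forall z, core s.1 z -> Z z -> eq_at Sg s.2 z].
have step : forall n (s : {s | good s}), exists s' : {s | good s},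
    (forall z, core (sval s).1 z -> core (sval s').1 z /\ eq_at (sval s').2 (sval s).2 z) /\
    (family (gF n) -> forall z, core (gF n) z -> core (sval s').1 z).
  move=> n [[G A] [/= fG dA iA cA zA]].
  have [fD|nF] := EM (family (gF n)); last first.
    by exists (exist _ (G, A) (And5 fG dA iA cA zA)).
  set D := gF n in fD *; pose G' i z := G i z \/ D i z.
  have fG' : family G' := familyU fG fD.
  (* The trace on [Z] is taken of the enlarged family, so that the new predicate agrees with [Sg] on
     the added members as well. *)
  have [H [B [fH cH [dB iB] cB eB]]] := hZ _ fG'.
  have [|A' [dA' iA' e1 e2 cA']] := @glue N HN HI Hc G H D A B fG fH fD dA dB iA iB cA cB.
    by move=> z hz hz' x al hx; rewrite -(zA z hz ((cH z).1 hz').2) // (eB z hz').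
  have coreG' z : core G' z <-> core G z \/ core D z.
    split=> [[m [?|?]]|[[m ?]|[m ?]]]; [left|right|..]; exists m => //; by [left|right].
  have gd : good (G', A').
    split=> //= z; first by move=> /coreG' h; apply: cA'; tauto.
    move=> h hz x al hx; have hH : core H z by apply/cH.
    by rewrite (eB z) // (e2 z).
  exists (exist _ _ gd); split=> /= [z hz|_ z hz]; last by apply/coreG'; right.
  by split; [apply/coreG'; left|apply: e1].
have /choice [f hf] : forall ns : nat * {s | good s}, exists s' : {s | good s},
    (forall z, core (sval ns.2).1 z -> core (sval s').1 z /\ eq_at (sval s').2 (sval ns.2).2 z) /\
    (family (gF ns.1) -> forall z, core (gF ns.1) z -> core (sval s').1 z).
  by move=> [n s]; apply: step.
have g0 : good (fun _ _ => False, fun _ _ => False).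
  split=> /=.
  - by split=> // [|n]; [ddt|exists [::]].
  - by ddt.
  - by apply: (Inv_comb (X := fun _ _ => False)) => x al y be _; split.
  - by move=> z [].
  - by move=> z [].
pose s := fix s n : {s | good s} := if n is n.+1 then f (n, s n) else exist _ _ g0.
pose G n := (sval (s n)).1; pose A n := (sval (s n)).2.
have hs n : (forall z, core (G n) z -> core (G n.+1) z /\ eq_at (A n.+1) (A n) z) /\
    (family (gF n) -> forall z, core (gF n) z -> core (G n.+1) z) by apply: (hf (n, s n)).
have gd n : good (G n, A n) by rewrite -surjective_pairing; exact: svalP (s n).
have mono m n z : m <= n -> core (G m) z -> core (G n) z /\ eq_at (A n) (A m) z.
  move=> /subnK <-; elim: (n - m) => [|k IH] h; first by split=> // x al.
  have [h1 h2] := IH h; have [h3 h4] := (hs (k + m)).1 _ h1.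
  by split=> // x al hx; rewrite addSn (h4 x al hx); apply: h2.
pose T x al := exists n z, [/\ shape x z, core (G n) z & A n x al].
have eqT n z : core (G n) z -> eq_at T (A n) z.
  move=> h x al hx; split=> [[m [z' [hx' h' hA]]]|hA]; last by exists n, z.
  rewrite -(shape_fun HN hx hx') in h'.
  have [h1|h1] := leqP m n.
    by apply/(mono m n z h1 h').2.
  by apply/(mono n m z (ltnW h1) h).2.
exists T; split.
- move=> F hF; have [n hn] : exists n, gF n = F by apply: hgF; case: hF.
  have hC z : core F z -> core (G n.+1) z by rewrite -hn; apply: (hs n).2; rewrite hn.
  have [_ h1 h2 h3 _] := gd n.+1.
  by exists (A n.+1); split=> // z /hC; [apply: h3|apply: eqT].
- move=> z hz; have [F hF Fz] := neighbourhood z.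
  have [n hn] : exists n, gF n = F by apply: hgF; case: hF.
  have hC : core (G n.+1) z by apply: (hs n).2; rewrite hn.
  have [_ _ _ _ h3] := gd n.+1.
  by move=> x al hx; rewrite (eqT _ _ hC) // (h3 z hC hz).
Qed.
End Extension.

(** * Conservative end extensions *)

Section Cohesive.
Variable N : pre.
Hypothesis HN : ipre N.
Implicit Types x y z b t : N.
Local Notation "0" := (@zero (car N)) : arith_scope.
Local Notation S := succ.

Definition unbounded (X : N -> Prop) := forall b, exists2 t, b ≼ t & X t.

(* The sets A y are decided one after the other, so that an unbounded part of X
   has the prescribed trace on every initial segment of indices. *)
Lemma trace (X : N -> Prop) (A : N -> N -> Prop) : D1 X -> D2 A -> unbounded X ->
  exists s, D1 s /\ forall y, unbounded (fun t => X t /\ forall z, z ≺ y -> (A z t <-> s z)).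
Proof.
move=> dX dA uX.
pose good sg y := unbounded (fun t => X t /\ forall z, z ≺ y -> (A z t <-> elem z sg)).
(* Bit [z] is set whenever an unbounded set survives. This greedy rule determines the branch
   uniquely, which makes it definable. *)
pose one sg z := exists sg', [/\ forall u, u ≺ z -> (elem u sg' <-> elem u sg), elem z sg' & good sg' (S z)].
pose cand sg y := (forall z, z ≺ y -> (elem z sg <-> one sg z)) /\ good sg y.
have good_ext sg sg' y : (forall u, u ≺ y -> (elem u sg' <-> elem u sg)) -> good sg y -> good sg' y.
  move=> h hg b; have [t bt [Xt ht]] := hg b; exists t => //; split=> // z hz.
  by rewrite h // ht.
have one_ext sg sg' z : (forall u, u ≺ z -> (elem u sg' <-> elem u sg)) -> one sg z -> one sg' z.
  by move=> h [ta [h1 h2 h3]]; exists ta; split=> // u hu; rewrite h1 // h.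
have dgood : D2 good by rewrite /good /unbounded; ddt.
have done_ : D2 one by rewrite /one; ddt.
have dcand : D2 cand by rewrite /cand; ddt.
have cand_ex y : exists sg, cand sg y.
  move: y; apply: (N_ind HN) => [||y [sg [h1 h2]]]; first by ddt.
    exists 0; split=> [z /(lt0 HN)//|b].
    by have [t bt Xt] := uX b; exists t => //; split=> // z /(lt0 HN).
  have [||s0 [_ hs0]] := @elem_code N HN (fun u => u ≺ y /\ elem u sg) y; [by ddt|by move=> u []|].
  have [s1 hs1] := elem_setU1 HN s0 y.
  have e0 u : u ≺ y -> (elem u s0 <-> elem u sg) by move=> hu; rewrite hs0; tauto.
  have e1 u : u ≺ y -> (elem u s1 <-> elem u sg).
    move=> hu; rewrite hs1 e0 //; split=> [[E|]//|]; last by right.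
    by case: (lt_irr HN (x := y)); rewrite -{1}E.
  have y0 : ~ elem y s0 by move=> /hs0 [/(lt_irr HN)].
  have y1 : elem y s1 by apply/hs1; left.
  have low s' : (forall u, u ≺ y -> (elem u s' <-> elem u sg)) ->
      forall z, z ≺ y -> (elem z s' <-> one s' z).
    move=> h z hz; rewrite h // h1 //.
    have hu u : u ≺ z -> u ≺ y by move=> hu; apply: (lt_trans HN hu hz).
    by split; apply: one_ext => u /hu hu'; rewrite h.
  have [g1|g1] := EM (good s1 (S y)).
    exists s1; split=> // z /(leS HN)/(le_eq HN) [->|/low]; last by apply.
    by split=> // _; exists s1.
  exists s0; split.
    move=> z /(leS HN)/(le_eq HN) [->|/low]; last by apply.
    split=> // -[s' [h3 h4 h5]]; case: g1; apply: good_ext h5 => u /(leS HN)/(le_eq HN) [->|hu] //.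
    by rewrite e1 // h3 // e0.
  (* If setting bit [y] leaves a bounded set, every suitable [t] beyond that bound has the bit
     cleared. *)
  have [b0 hb0] : exists b0, forall t, b0 ≼ t -> ~ (X t /\ forall z, z ≺ S y -> (A z t <-> elem z s1)).
    apply: contrapT => H; apply: g1 => b; apply: contrapT => H'; apply: H; exists b => t bt ht.
    by apply: H'; exists t.
  move=> b; have [t bt [Xt ht]] := h2 (b ⊕ b0).
  exists t; first exact: (le_trans HN (le_addr b b0)).
  split=> // z /(leS HN)/(le_eq HN) [->|hz]; last by rewrite e0 // ht.
  split=> // hA; case: (hb0 t); first exact: (le_trans HN (le_addl HN b0 b)).
  by split=> // u /(leS HN)/(le_eq HN) [->|hu] //; rewrite e1 // ht.
have cand_uniq sg sg' y y' : cand sg y -> cand sg' y' -> forall z, z ≺ y -> z ≺ y' ->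
    (elem z sg <-> elem z sg').
  move=> [h1 _] [h2 _]; apply: (N_sind HN) => [|z IH hy hy']; first by ddt.
  have h u : u ≺ z -> (elem u sg <-> elem u sg').
    by move=> hu; apply: IH => //; apply: (lt_trans HN hu).
  by rewrite h1 // h2 //; split; apply: one_ext => u /h ->.
pose s z := exists sg, cand sg (S z) /\ elem z sg.
exists s; split; first by rewrite /s; ddt.
move=> y b; have [sg hsg] := cand_ex y; have [h1 h2] := hsg.
have [t bt [Xt ht]] := h2 b; exists t => //; split=> // z hz; rewrite ht //.
split=> [h|[sg' [hc he]]]; last by apply/(cand_uniq _ _ _ _ hsg hc) => //; apply: (ltS HN).
exists sg; split=> //; split=> [u /(leS HN) hu|c].
  by apply: h1; apply: (le_lt_trans HN hu).
have [t' bt' [Xt' ht']] := h2 c; exists t' => //; split=> // u /(leS HN) hu.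
by apply: ht'; apply: (le_lt_trans HN hu).
Qed.

(** A member of [X'] is the least [t] above some [y] with the right trace below [y]. The trace can
    be wrong at [z] only for [y] up to [z], and these give a bounded set of [t]. *)
Lemma cohesive (X : N -> Prop) (A : N -> N -> Prop) : D1 X -> D2 A -> unbounded X ->
  exists X' s, [/\ D1 X', unbounded X', forall t, X' t -> X t, D1 s &
    forall y, exists b, forall t, X' t -> b ≼ t -> (A y t <-> s y)].
Proof.
move=> dX dA uX; have [s [ds hs]] := trace dX dA uX.
pose P y t := y ≼ t /\ (X t /\ forall z, z ≺ y -> (A z t <-> s z)).
have dP : D2 P by rewrite /P; ddt.
pose V y t := P y t /\ forall u, u ≺ t -> ~ P y u.
have Vex y : exists t, V y t.
  have [t h1 h2] := hs y y.
  have [||t' [h3 _ h4]] := @N_least N HN (P y) t; [by ddt|by []|].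
  by exists t'.
have Vfun y t t' : V y t -> V y t' -> t = t'.
  move=> [h1 h2] [h1' h2']; have [h|/(le_eq HN) [//|h]] := lt_total HN t t'.
    by case: (h2' _ h).
  by case: (h2 _ h).
have dV : D2 V by rewrite /V; ddt.
exists (fun t => exists y, V y t), s; split=> //.
- by ddt.
- by move=> b; have [t ht] := Vex b; exists t; [case: ht => [[]]|exists b].
- by move=> t [y [[_ []]]].
move=> z; have [b hb] : exists b, forall y t, y ≼ z -> V y t -> t ≺ b.
  move: z; apply: (N_ind HN) => [||z [b hb]].
  - by ddt.
  - have [t ht] := Vex 0; exists (S t) => y t' /(le_eq HN) [->|/(lt0 HN)//] h.
    by rewrite (Vfun _ _ _ h ht); apply: (ltS HN).
  - have [t ht] := Vex (S z); exists (b ⊕ S t) => y t' /(le_eq HN) [->|/(leS HN) hy] h.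
      rewrite (Vfun _ _ _ h ht); exact: (lt_le_trans HN (ltS HN t) (le_addl HN _ _)).
    by apply: (lt_le_trans HN (hb _ _ hy h)); apply: le_addr.
exists b => t [y hy] bt; have [zy|yz] := lt_total HN z y; first by case: hy => [[_ [_]]] + _; apply.
by case: (lt_irr HN (x := t)); apply: (lt_le_trans HN (hb _ _ yz hy)).
Qed.

(** The definability of largeness along a definable family is what makes the ultrapower an end
    extension and conservative. *)
Lemma cohesive_ultrafilter : enumerable N -> exists U : set (set N), [/\ UltraFilter U,
  forall b, U (fun t => b ≼ t) &
  forall A, D2 A -> exists2 s, D1 s & forall y, U (A y) <-> s y].
Proof.
move=> hN; have [gA hgA] := D2_enumeration hN.
pose good X := D1 X /\ unbounded X.
have step : forall ns : nat * {X | good X}, exists X' : {X | good X},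
    (forall t, sval X' t -> sval ns.2 t) /\ (D2 (gA ns.1) -> exists s, D1 s /\
      forall y, exists b, forall t, sval X' t -> b ≼ t -> (gA ns.1 y t <-> s y)).
  move=> [n [X [dX uX]]] /=.
  have [dA|nA] := EM (D2 (gA n)); last by exists (exist _ X (conj dX uX)); split.
  have [X' [s [h1 h2 h3 h4 h5]]] := cohesive dX dA uX.
  by exists (exist _ X' (conj h1 h2)); split=> // _; exists s.
have /choice [f hf] := step.
have g0 : good (fun _ => True) by split; [ddt|move=> b; exists b => //; apply: (le_refl HN)].
pose s := fix s n : {X | good X} := if n is n.+1 then f (n, s n) else exist _ _ g0.
have mono m n t : m <= n -> sval (s n) t -> sval (s m) t.
  move=> /subnK <-; elim: (n - m) => [//|k IH] h; apply: IH.
  exact: (hf (k + m, s (k + m))).1 h.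
pose F : set (set N) := fun B => exists n b, forall t, sval (s n) t -> b ≼ t -> B t.
have FF : ProperFilter F.
  split.
    case=> n [b h]; have [_ uX] := svalP (s n).
    by have [t bt Xt] := uX b; apply: h Xt bt.
  split.
  - by exists 0%N, 0.
  - move=> B B' [n [b h]] [n' [b' h']]; exists (maxn n n'), (b ⊕ b') => t Xt bt; split.
      by apply: h; [apply: mono Xt; apply: leq_maxl|apply: (le_trans HN (le_addr b b'))].
    by apply: h'; [apply: mono Xt; apply: leq_maxr|apply: (le_trans HN (le_addl HN b' b))].
  - by move=> B B' BB [n [b h]]; exists n, b => t Xt bt; apply/BB/h.
have [U [UU hU]] := ultraFilterLemma FF.
exists U; split=> // [b|A dA]; first by apply: hU; exists 0%N, b.
have [n hn] := hgA A dA.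
have [s' [ds' hs']] := (hf (n, s n)).2 (eq_ind_r _ dA hn : D2 (gA (n, s n).1)).
exists s' => // y; have [b hb] := hs' y.
have h : U (fun t => A y t <-> s' y) by apply: hU; exists n.+1, b => t Xt bt; rewrite -hn; apply: hb.
split=> [hA|hs]; last by apply: (ultra_mono UU) h => t; tauto.
by have [t [h1 h2]] := filter_ex (ultra_and UU h hA); apply/h1.
Qed.
End Cohesive.

(** * The ultrapower by definable functions *)

Section DefinableUltrapower.
Variable N : pre.
Hypothesis HN : ipre N.
Hypothesis hN : enumerable N.
Implicit Types x y z a b i t : N.
Local Notation "0" := (@zero (car N)) : arith_scope.
Local Notation S := succ.

Definition definable_fun (f : N -> N) : Prop := D2 (fun t y => y = f t).

Lemma definable_const a : definable_fun (fun _ => a).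
Proof. by rewrite /definable_fun; ddt. Qed.

(** Only [bnd p] of the functions matter; they are eliminated one by one by quantifying over their
    values. *)
Lemma definable_subst p (f : nat -> N -> N) : (forall k, definable_fun (f k)) ->
  D3 (fun t a b => Sat p (sc a (sc b (fun k => f k t)))).
Proof.
move=> hf.
have key n q m : cD (Dn N) (fun _ e => Sat q (pcat (mkseq (fun k => f k (e m)) n) e)).
  elim: n q m => [|n IH] q m.
    by apply/Dn_spec; exists [::], q => e; rewrite pcat_nil.
  apply: (@cD_ext _ _ _ (fun _ (e : nat -> N) => exists y, y = f n (e m) /\
      Sat q (pcat (mkseq (fun k => f k (e m)) n) (sc y e)))).
    have E (e : nat -> N) : mkseq (fun k => f k (e m)) n.+1 = rcons (mkseq (fun k => f k (e m)) n) (f n (e m)).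
      by rewrite /mkseq -addn1 iotaD map_cat cats1.
    move=> j e; rewrite E pcat_rcons; split; first by case=> y [->].
    by exists (f n (e m)).
  apply: cD_ex; apply: cD_and; first by have hn : D2 (fun t y => y = f n t) := hf n; have h := D2_app hn (cT_var (Dn N) (m + 1)) (cT_var (Dn N) 0%N); exact: h.
  apply: cD_ext (IH q m.+1) => j e; rewrite sc_sh1.
  by rewrite (_ : sh 1 e m = e m.+1) // /sh addn1.
pose n := bnd p.
apply: cD_ext (key n (LSub [:: LV n.+1, LV n.+2 & mkseq LV n] 0 p) 0%N) => j e.
rewrite Sat_sub; set l := mkseq (fun k => f k _) n.
have sl : size l = n by rewrite size_mkseq.
have E (i : nat) : i < bnd p -> senv cc [:: LV n.+1, LV n.+2 & mkseq LV n] 0 (pcat l e) i =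
    sc (e 1%N) (sc (e 2%N) (fun k => f k (e 0%N))) i.
  move=> hi; rewrite /senv /= size_mkseq.
  have -> : i < n.+2 by rewrite ltnW // ltnW.
  case: i hi => [|[|i]] hi /=; rewrite /pcat ?sl.
  - by rewrite ltnNge leqnSn /= subSnn.
  - have -> : n.+2 - n = 2 by rewrite -addn2 addKn.
    by rewrite ltnNge (leq_trans (leqnSn n)).
  - have hb : i < n by do 2!apply: ltnW.
    by rewrite nth_mkseq //= ?sl hb nth_mkseq.
by split; apply: Sat_dep => i hi; rewrite E.
Qed.

Lemma definable_skolem p (f : nat -> N -> N) : (forall k, definable_fun (f k)) ->
  exists2 g, definable_fun g & forall t a, Sat p (sc a (fun k => f k t)) -> Sat p (sc (g t) (fun k => f k t)).
Proof.
move=> hf; pose P t a := Sat p (sc a (fun k => f k t)).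
have dP : D2 P.
  have h := definable_subst (LSub [:: LV 0] 2 p) hf.
  have {}h : D2 (fun t a => Sat (LSub [:: LV 0] 2 p) (sc a (sc 0 (fun k => f k t)))) by ddt.
  apply: cD_ext h => j e; rewrite /P Sat_sub.
  rewrite (_ : senv _ _ _ _ = sc (e 1%N) (fun k => f k (e 0%N))) //; apply/funext => -[|i] //.
  by rewrite /senv /= subSS subn0 addn2.
pose R t a := (P t a /\ forall c, c ≺ a -> ~ P t c) \/ (~ (exists c, P t c) /\ a = 0).
have dR : D2 R by rewrite /R; ddt.
have Rex t : exists a, R t a.
  have [[a ha]|h] := EM (exists a, P t a); last by exists 0; right.
  have [||a' [h1 _ h2]] := @N_least N HN (P t) a; [by ddt|by []|].
  by exists a'; left.
have Rfun t a a' : R t a -> R t a' -> a = a'.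
  case=> [[h1 h2]|[h1 ->]] [[h1' h2']|[h1' ->]] //.
  - have [h|/(le_eq HN) [//|h]] := lt_total HN a a'; first by case: (h2' _ h).
    by case: (h2 _ h).
  - by case: h1'; exists a.
  - by case: h1; exists a'.
have /choice [g hg] := Rex.
exists g.
  apply: cD_ext dR => j e; split=> [h|->//]; exact: Rfun h (hg _).
by move=> t a ha; case: (hg t) => [[]//|[[]]]; exists a.
Qed.

Lemma conservative_end_extension : exists (N' : pre) (j : N -> N'),
  [/\ enumerable N' /\ elem_map j, forall (b : N') a, le_of b (j a) -> exists a', b = j a',
      exists b : N', forall a, b <> j a &
      forall F : N' -> N' -> Prop, D2 F -> D2 (fun x y => F (j x) (j y))].
Proof.
have [U [UU Ub Us]] := cohesive_ultrafilter HN hN.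
pose F (f : forall t : N, N) := definable_fun f.
have hF : forall p (f : nat -> forall t : N, N), (forall k, F (f k)) ->
  exists2 g, F g & forall t a, Sat p (sc a (fun k => f k t)) -> Sat p (sc (g t) (fun k => f k t)).
  exact: definable_skolem.
pose N' := upre (Ns := fun _ => N) UU hF (definable_const 0).
pose j a : N' := ucls U (definable_const a : F _).
have jrep a : U (fun t => urep (j a) t = a) by apply: urep_cls.
have hj : elem_map j.
  move=> p e; have -> : Sat p (j \o e) <-> U (fun t => Sat p e).
    by apply: (usat_cls (f := fun k _ => e k) UU) => k _; apply: jrep.
  by split=> [h|h]; [apply: ultra_true|have [t] := filter_ex h].
exists N', j; split.
- split=> //; have [gA hgA] := D2_enumeration hN.
  have /choice [g hg] : forall n, exists a : N', forall f (hf : F f), gA n = (fun t y => y = f t) -> ucls U hf = a.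
    move=> n; have [[f [hf E]]|h] := EM (exists f, exists hf : F f, gA n = (fun t y => y = f t)).
      exists (ucls U hf) => f' hf'; rewrite E => E'.
      apply/(ucls_eq UU); apply: ultra_true => t.
      by have := congr1 (fun h => h t (f' t)) E' => /= ->.
    by exists (zero : N') => f hf E; case: h; exists f, hf.
  exists g => a; have [n hn] := hgA (fun t y => y = urep a t) (urepF a).
  by exists n; rewrite -(hg n _ (urepF a) hn) ucls_rep.
- move=> b a hb; set f := urep b; have hf : definable_fun f := urepF b.
  have le_U u c : le_of (u : N') c <-> U (fun t => urep u t ≼ urep c t).
    have hle : cD UD (fun N e => le_of (e 0%N) (e 1%N)) by dt.
    by apply: (upre_UD (f := fun k => if k is 0 then urep u else urep c) (e := sc u (fun _ => c)) hle) => -[|k];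
      apply: ultra_true.
  have fa : U (fun t => f t ≼ a).
    by apply: (ultra_mono UU) (ultra_and UU ((le_U b (j a)).1 hb) (jrep a)) => t [h1 h2]; rewrite -h2.
  (* The bounds valid almost everywhere form a definable set. At its least element the function is
     almost everywhere equal to the bound, hence constant. *)
  have [|s ds hs] := Us (fun y t => f t ≼ y).
    apply: (@cD_ext _ _ _ (fun _ e => exists y, y = f (e 1%N) /\ y ≼ e 0%N)); last first.
      have hf' : D2 (fun t y => y = f t) := hf.
      apply: cD_ex; apply: cD_and; last by dt.
      by have h := D2_app hf' (cT_var (Dn N) 2) (cT_var (Dn N) 0%N); exact: h.
    by move=> _ e; split; [case=> y [->]|exists (f (e 1%N))].
  have [||y [sy _ hy]] := @N_least N HN s a; [by ddt|exact/hs|].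
  exists y; rewrite -(ucls_rep b); apply/(ucls_eq UU).
  have [y0|[y' Ey]] := zero_or_succ HN y.
    apply: (ultra_mono UU) ((hs y).2 sy) => t; rewrite y0 => h.
    exact: (le_anti HN h (le0 HN _)).
  have h2 : U (fun t => ~ f t ≼ y').
    by apply/(ultra_not UU) => /hs; apply: hy; rewrite Ey; apply: (ltS HN).
  apply: (ultra_mono UU) (ultra_and UU h2 ((hs y).2 sy)) => t [h3 h4].
  have [//|h5] := le_eq HN h4.
  by case: h3; apply/(leS HN); rewrite -Ey.
(* The identity differs from every constant because the ultrafilter contains all final segments. *)
- have hid : F id by rewrite /F /definable_fun; ddt.
  exists (ucls U hid) => a /(ucls_eq UU) h.
  have [t [/= -> h2]] := filter_ex (ultra_and UU h (Ub (S a))).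
  by apply: (lt_irr HN (x := a)); apply/(ltSle HN).
- move=> G /D2_env [q [e hq]].
  pose f k := urep (e k).
  have d3 := definable_subst q (fun k => urepF (e k) : definable_fun (f k)).
  (* Pairing turns the binary trace into a unary one, to which the definability of the ultrafilter
     applies. *)
  have [|s ds hs] := Us (fun y t => exists i z, y = pr i z /\ Sat q (sc i (sc z (fun k => f k t)))).
    by ddt.
  apply: (@cD_ext _ _ _ (fun _ e => s (pr (e 0%N) (e 1%N)))); last by ddt.
  move=> _ E; rewrite hq -hs.
  have -> : Sat q (sc (j (E 0%N)) (sc (j (E 1%N)) e)) <->
      U (fun t => Sat q (sc (E 0%N) (sc (E 1%N) (fun k => f k t)))).
    rewrite (_ : (fun t => _) = (fun t => Sat q (fun k =>
      (if k is k'.+1 then (if k' is k''.+1 then f k'' else fun _ => E 1%N) else fun _ => E 0%N) t))).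
      by apply: (usat_cls UU) => -[|[|k]] _ //; [apply: jrep|apply: jrep|apply: ultra_true].
    by apply/funext => t; congr (Sat q _); apply/funext => -[|[|k]].
  split; apply: (ultra_mono UU) => t; last by exists (E 0%N), (E 1%N).
  by case=> i [z [/(pr_inj HN) [-> ->]]].
Qed.
End DefinableUltrapower.

(** * Transfer along elementary maps *)

(** Lifting along a map acts on a formula and its parameters rather than on a predicate, hence this
    presentation of definable predicates. *)
Definition def2 (N : pre) q (e : nat -> N) x y : Prop := Sat q (sc x (sc y e)).

Lemma D2_def2 (N : pre) (A : N -> N -> Prop) : D2 A -> exists q e, A = def2 q e.
Proof.
move=> /D2_env [q [e h]]; exists q, e.
by apply/funext => x; apply/funext => y; apply/propext.
Qed.

Lemma def2_dep (N : pre) q (e e' : nat -> N) : (forall i, i < bnd q -> e i = e' i) -> def2 q e = def2 q e'.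
Proof.
move=> H; apply/funext => x; apply/funext => y; apply/propext.
have E i : i < bnd q -> sc x (sc y e) i = sc x (sc y e') i.
  by case: i => [|[|i]] //= hi; apply: H; do 2!apply: ltnW.
by split; apply: Sat_dep => i /E.
Qed.

Lemma comp_scons (T T' : Type) (j : T -> T') a e : j \o sc a e = sc (j a) (j \o e).
Proof. by apply/funext => -[]. Qed.

Section Transfer.
Variables (N N' : pre) (j : N -> N').
Hypothesis hj : elem_map j.

Lemma emap_def2 q e x y : def2 q e x y <-> def2 q (j \o e) (j x) (j y).
Proof. by rewrite /def2 -!comp_scons; apply: hj. Qed.

Lemma emap_Inv q e : Inv (def2 q e) <-> Inv (def2 q (j \o e)).
Proof.
apply: (emap_UD hj e (R := fun N e => Inv (def2 q e))).
by apply: (cD_Inv (X := fun N r => def2 q r) (r := fun N e => e)) (UD_P2 q) _; dsh.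
Qed.

Lemma emap_Comp_at q e z : Comp_at (def2 q e) z <-> Comp_at (def2 q (j \o e)) (j z).
Proof.
have := emap_UD hj (sc z e) (R := fun N e => Comp_at (def2 q (sh 1 e)) (e 0%N)).
by rewrite comp_scons !sh1_sc; apply; unfold def2; dt.
Qed.

Lemma emap_eq_at q e q' e' z : eq_at (def2 q e) (def2 q' e') z <->
  eq_at (def2 q (j \o e)) (def2 q' (j \o e')) (j z).
Proof.
(* Both parameter environments are packed into one, the first being cut to its relevant part. *)
pose b := bnd q; pose E := pcat (mkseq e b) e'.
have hE i : i < b -> e i = E i by move=> hi; rewrite /E /pcat size_mkseq hi nth_mkseq.
have E' : e' = sh b E by apply/funext => i; rewrite /E /sh /pcat size_mkseq ltnNge leq_addl /= addnK.
rewrite (def2_dep hE) (def2_dep (e' := j \o E)); last by move=> i hi /=; rewrite hE.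
rewrite E'; have := emap_UD hj (sc z E) (R := fun N e => eq_at (def2 q (sh 1 e)) (def2 q' (sh b (sh 1 e))) (e 0%N)).
by rewrite comp_scons !sh1_sc; apply; unfold def2, eq_at; dt.
Qed.

(** Removing the listed points one at a time leaves an empty definable set, and emptiness is
    preserved by elementarity. *)
Lemma emap_finite q e l : (forall z, Sat q (sc z e) -> List.In z l) ->
  forall z, Sat q (sc z (j \o e)) -> List.In z (map j l).
Proof.
elim: l q e => [|a l IH] q e h z /= hz.
  have [|_ [|y /h //]] := emap_UD hj e (R := fun N e => exists z, Sat q (sc z e)); first by dt.
  by exists z.
have [->|ne] := EM (z = j a); [by left|right].
have [r hr] : cD UD (fun N e => Sat q (sc (e 0%N) (sh 2 e)) /\ e 0%N <> e 1%N) by dt.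
have {}hr (N1 : pre) (y b : N1) e1 : Sat q (sc y e1) /\ y <> b <-> Sat r (sc y (sc b e1)).
  by rewrite -hr -(sh_sh 1 1) !sh1_sc.
apply: (IH r (sc a e)); last by rewrite comp_scons -hr.
by move=> y /hr [/h [->|//]].
Qed.

Lemma emap_finite_level q e n l : (forall z, def2 q e (num N n) z -> List.In z l) ->
  forall z, def2 q (j \o e) (num N' n) z -> List.In z (map j l).
Proof.
move=> h; have [r hr] : cD UD (fun N e => Sat q (sc (e 1%N) (sc (e 0%N) (sh 2 e)))) by dt.
have {}hr (N1 : pre) (y b : N1) e1 : def2 q e1 b y <-> Sat r (sc y (sc b e1)).
  by rewrite -hr -(sh_sh 1 1) !sh1_sc.
move=> z /hr; rewrite -(emap_num hj) -comp_scons.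
by apply: emap_finite => y /hr; apply: h.
Qed.

Lemma emap_direct_subformula y x : direct_subformula y x <-> direct_subformula (j y) (j x).
Proof.
have := emap_UD hj (sc y (sc x (fun _ => x))) (R := fun N e => direct_subformula (e 0%N) (e 1%N)).
by apply; unfold direct_subformula; dt.
Qed.

Lemma emap_family q e : family (def2 q e) -> family (def2 q (j \o e)).
Proof.
case=> _ h1 h2 h3; split; first exact: D2_Sat.
- have [|h _] := emap_UD hj e (R := fun N e => forall i z, def2 q e i z -> def2 q e (succ i) z).
    by unfold def2; dt.
  exact: h h1.
- have [|h _] := emap_UD hj e (R := fun N e => forall i z z', def2 q e i z ->
    direct_subformula z' z -> def2 q e (succ i) z').
    by unfold def2, direct_subformula; dt.
  exact: h h2.
- by move=> n; have [l hl] := h3 n; exists (map j l); apply: emap_finite_level.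
Qed.

Lemma emap_core q e z : core (def2 q e) z <-> core (def2 q (j \o e)) (j z).
Proof.
split=> -[n]; first by rewrite emap_def2 (emap_num hj) => h; exists n.
by rewrite -(emap_num hj) -emap_def2 => h; exists n.
Qed.

(** Standard levels are finite, so lifting adds nothing to them. *)
Lemma core_range q e z : family (def2 q e) -> core (def2 q (j \o e)) z -> exists z', z = j z'.
Proof.
case=> _ _ _ h3 [n h]; have [l hl] := h3 n.
have /List.in_map_iff [z' [<- _]] := emap_finite_level hl h; by exists z'.
Qed.

(** Pointwise extension would be too weak: an old skeleton acquires new formulas and new
    assignments, whose values are dictated by the lifted definition. *)
Definition transfers (S : N -> N -> Prop) (S' : N' -> N' -> Prop) : Prop :=
  forall q e z, eq_at S (def2 q e) z -> eq_at S' (def2 q (j \o e)) (j z).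
End Transfer.

Lemma finite_preimage (T T' : Type) (j : T -> T') : injective j ->
  forall l : seq T', exists l', forall z, List.In (j z) l -> List.In z l'.
Proof.
move=> hj; elim=> [|a l [l' IH]]; first by exists [::].
have [[z hz]|h] := EM (exists z, j z = a).
  by exists (z :: l') => y /= [E|/IH]; [left; apply: hj; rewrite hz|right].
by exists l' => y /= [E|/IH //]; case: h; exists y.
Qed.

Lemma family_pullback (N N' : pre) (j : N -> N') F : elem_map j -> family F ->
  D2 (fun x y => F (j x) (j y)) -> family (fun x y => F (j x) (j y)).
Proof.
move=> hj [_ f2 f3 f4]; split=> // [i z /f2|i z z' /f3 h /(emap_direct_subformula hj) /h|n].
- by rewrite (emap_succ hj).
- by rewrite (emap_succ hj).
- have [l hl] := f4 n; have [l' hl'] := finite_preimage (emap_inj hj) l.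
  by exists l' => z; rewrite (emap_num hj) => /hl /hl'.
Qed.

(** The family is pulled back, resolved by a definable predicate below, and lifted again; the lifted
    core is the part of the original core in the range of [j]. *)
Lemma transfer_local (N N' : pre) (j : N -> N') S S' F : elem_map j -> transfers j S S' ->
  locally_definable S -> family F -> D2 (fun x y => F (j x) (j y)) ->
  exists H A, [/\ family H, forall z, core H z <-> core F z /\ exists z', z = j z',
    D2 A /\ Inv A, forall z, core H z -> Comp_at A z & forall z, core H z -> eq_at S' A z].
Proof.
move=> hj trS hS hF dF; have hH := family_pullback hj hF dF.
have [q [e E]] := D2_def2 dF.
have [A [dA iA cA eA]] := hS _ hH; have [r [e' EA]] := D2_def2 dA; rewrite {}EA in iA cA eA.
rewrite E in hH cA eA.
have coreE z : core (def2 q e) z <-> core F (j z).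
  by rewrite -E; split=> -[n h]; exists n; rewrite ?(emap_num hj) // -(emap_num hj).
have hr z : core (def2 q (j \o e)) z -> exists2 z', z = j z' & core (def2 q e) z'.
  by move=> h; have [z' E'] := core_range hj hH h; exists z' => //; apply/(emap_core hj); rewrite -E'.
exists (def2 q (j \o e)), (def2 r (j \o e')); split.
- exact: emap_family.
- move=> z; split=> [/hr [z' -> /coreE]|[h [z' E']]].
    by split=> //; exists z'.
  by rewrite E' -(emap_core hj) coreE -E'.
- by split; [exact: D2_Sat|apply/(emap_Inv hj)].
- by move=> z /hr [z' -> h]; apply/(emap_Comp_at hj); apply: cA.
- by move=> z /hr [z' -> h]; apply: trS; apply: eA.
Qed.

(** The values are the union of all lifted local definitions. Any two of them can be compared in one
    structure of the system, where both agree with its class at the skeleton concerned. *)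
Lemma amalgam (I : Type) (Ns : I -> pre) (N' : pre) (j : forall i, Ns i -> N')
  (S : forall i, Ns i -> Ns i -> Prop) :
  ipre N' -> (forall i, elem_map (@j i)) ->
  (forall i i', (exists2 k : Ns i -> Ns i', transfers k (@S i) (@S i') & forall x, j i' (k x) = j i x) \/
    (exists2 k : Ns i' -> Ns i, transfers k (@S i') (@S i) & forall x, j i (k x) = j i' x)) ->
  exists S', forall i, transfers (@j i) (@S i) S'.
Proof.
move=> HN' hj dir; have inj i := emap_inj (hj i).
exists (fun x al => exists i z q e, [/\ shape x (j i z), eq_at (@S i) (def2 q e) z & def2 q (j i \o e) x al]).
have lift i i' (k : Ns i -> Ns i') z z' q e q' e' : transfers k (@S i) (@S i') ->
    (forall x, j i' (k x) = j i x) -> j i z = j i' z' -> eq_at (@S i) (def2 q e) z ->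
    eq_at (@S i') (def2 q' e') z' -> eq_at (def2 q (j i \o e)) (def2 q' (j i' \o e')) (j i z).
  move=> hk jk E h h'; have kz : k z = z' by apply: (inj i'); rewrite jk.
  have -> : j i \o e = j i' \o (k \o e) by apply/funext => n /=; rewrite jk.
  rewrite -[j i z]jk; apply/(emap_eq_at (hj i')) => x al hx.
  by rewrite -(hk _ _ _ h) // h' // -kz.
move=> i q e z h x al hx; split=> [[i' [z' [q' [e' [hx' h' hA]]]]]|?]; last by exists i, z, q, e.
have E := shape_fun HN' hx hx'.
have [[k hk jk]|[k hk jk]] := dir i i'.
  by apply/(lift _ _ _ _ _ _ _ _ _ hk jk E h h').
by apply/(lift _ _ _ _ _ _ _ _ _ hk jk (esym E) h' h).
Qed.

(** * Direct limits *)

Section DirectLimit.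
Variables (I : Type) (Ns : I -> pre) (i0 : I) (U : Type) (j : forall i, Ns i -> U).
Arguments j : clear implicits.
Hypothesis jinj : forall i, injective (j i).
Hypothesis jsurj : forall u, exists i x, j i x = u.
Hypothesis dir : forall i i',
  (exists2 k : Ns i -> Ns i', elem_map k & forall x, j i' (k x) = j i x) \/
  (exists2 k : Ns i' -> Ns i, elem_map k & forall x, j i (k x) = j i' x).

Lemma limit_const (c : forall N : pre, N) :
  (forall (N N' : pre) (k : N -> N'), elem_map k -> k (c N) = c N') ->
  forall i i', j i (c (Ns i)) = j i' (c (Ns i')).
Proof. by move=> hc i i'; case: (dir i i') => -[k hk <-]; rewrite hc. Qed.

Lemma limit_un (h : forall N : pre, N -> N) :
  (forall (N N' : pre) (k : N -> N'), elem_map k -> forall x, k (h N x) = h N' (k x)) ->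
  forall i i' x x', j i x = j i' x' -> j i (h _ x) = j i' (h _ x').
Proof.
move=> hh i i' x x'; case: (dir i i') => -[k hk jk].
  by rewrite -jk => /jinj <-; rewrite -jk hh.
by rewrite -[j i' x']jk => /jinj ->; rewrite -[RHS]jk hh.
Qed.

Lemma limit_bin (h : forall N : pre, N -> N -> N) :
  (forall (N N' : pre) (k : N -> N'), elem_map k -> forall x y, k (h N x y) = h N' (k x) (k y)) ->
  forall i i' x x' y y', j i x = j i' x' -> j i y = j i' y' -> j i (h _ x y) = j i' (h _ x' y').
Proof.
move=> hh i i' x x' y y'; case: (dir i i') => -[k hk jk].
  by rewrite -!jk => /jinj <- /jinj <-; rewrite -hh // !jk.
by rewrite -[j i' x']jk -[j i' y']jk => /jinj -> /jinj ->; rewrite -[RHS]jk hh.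
Qed.

Lemma limit_env (e : nat -> U) b : exists i (e' : nat -> Ns i), forall n, n < b -> j i (e' n) = e n.
Proof.
elim: b => [|b [i [e' IH]]]; first by exists i0, (fun _ => zero).
have [i' [x hx]] := jsurj (e b).
have [[k hk jk]|[k hk jk]] := dir i i'.
  exists i', (fun n => if n < b then k (e' n) else x) => n; rewrite ltnS leq_eqVlt.
  by case: ltnP => [h _|_ /orP [/eqP ->|]] //; rewrite jk IH.
exists i, (fun n => if n < b then e' n else k x) => n; rewrite ltnS leq_eqVlt.
by case: ltnP => [h _|_ /orP [/eqP ->|]] //; rewrite ?jk ?IH.
Qed.

Definition lim_zero : U := j i0 zero.
Definition lim_cc : U := j i0 cc.

Lemma lim_succ_ex u : exists w, forall i x, j i x = u -> j i (succ x) = w.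
Proof.
have [i [x <-]] := jsurj u; exists (j i (succ x)) => i' x'.
by apply: (limit_un (h := fun N => @succ N)) => N N' k hk y; apply: emap_succ.
Qed.

Lemma lim_bin_ex (h : forall N : pre, N -> N -> N) :
  (forall (N N' : pre) (k : N -> N'), elem_map k -> forall x y, k (h N x y) = h N' (k x) (k y)) ->
  exists g : U -> U -> U, forall i x y, j i (h _ x y) = g (j i x) (j i y).
Proof.
move=> hh; have /choice [g hg] : forall p : U * U, exists w, forall i x y,
    j i x = p.1 -> j i y = p.2 -> j i (h _ x y) = w.
  move=> [u v] /=; have [i [e he]] := limit_env (fun n => if n is 0 then u else v) 2.
  exists (j i (h _ (e 0) (e 1))) => i' x y hx hy.
  by apply: limit_bin; rewrite ?he.
by exists (fun u v => g (u, v)) => i x y; apply: hg.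
Qed.

Lemma limit_structure : exists (L : arith) (c : L) (g : forall i, Ns i -> L) (f : L -> U),
  [/\ injective f, forall i x, f (g i x) = j i x, forall i, g i cc = c, forall i, g i zero = zero &
  [/\ forall i x, g i (succ x) = succ (g i x),
      forall i x y, g i (add x y) = add (g i x) (g i y) &
      forall i x y, g i (mul x y) = mul (g i x) (g i y)]].
Proof.
have /choice [sf hs] := lim_succ_ex.
have [af ha] := @lim_bin_ex (fun N => @add N) (fun N N' k hk => emap_add hk).
have [mf hm] := @lim_bin_ex (fun N => @mul N) (fun N N' k hk => emap_mul hk).
exists (Arith lim_zero sf af mf), lim_cc, j, id; split=> //.
- by move=> i; apply: (limit_const (c := fun N => @cc N)) => N N' k hk; apply: emap_cc.
- by move=> i; apply: (limit_const (c := fun N => @zero N)) => N N' k hk; apply: emap_zero.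
- by split=> //= i x; apply: hs.
Qed.
End DirectLimit.

Section DirectLimitSat.
Variables (I : Type) (Ns : I -> pre) (i0 : I) (L : arith) (c : L) (j : forall i, Ns i -> L).
Arguments j : clear implicits.
Hypothesis jinj : forall i, injective (j i).
Hypothesis jsurj : forall u, exists i x, j i x = u.
Hypothesis dir : forall i i',
  (exists2 k : Ns i -> Ns i', elem_map k & forall x, j i' (k x) = j i x) \/
  (exists2 k : Ns i' -> Ns i, elem_map k & forall x, j i (k x) = j i' x).
Hypothesis jc : forall i, j i cc = c.
Hypothesis jz : forall i, j i zero = zero.
Hypothesis jsucc : forall i x, j i (succ x) = succ (j i x).
Hypothesis jadd : forall i x y, j i (add x y) = add (j i x) (j i y).
Hypothesis jmul : forall i x y, j i (mul x y) = mul (j i x) (j i y).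

Lemma lim_lval i t e : lval c (j i \o e) t = j i (lval cc e t).
Proof.
by elim: t => //= [t ->|s -> t ->|s -> t ->]; rewrite ?jsucc ?jadd ?jmul.
Qed.

(** An infinite environment need not come from a single structure, so only its first [bnd p] values
    are matched. *)
Definition lsat p (e : nat -> L) : Prop :=
  exists i (e' : nat -> Ns i), (forall n, n < bnd p -> j i (e' n) = e n) /\ Sat p e'.

Lemma lsat_map i p e : lsat p (j i \o e) <-> Sat p e.
Proof.
split=> [[i' [e' [h he]]]|h]; last by exists i, e.
have [[k hk jk]|[k hk jk]] := dir i i'.
  apply/(hk p); apply: Sat_dep he => n /h /= hn.
  by apply: (@jinj i'); rewrite jk.
move/(hk p): he; apply: Sat_dep => n /h /= hn.
by apply: (@jinj i); rewrite jk.
Qed.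

Lemma lsat_dep p e e' : (forall i, i < bnd p -> e i = e' i) -> lsat p e -> lsat p e'.
Proof. by move=> H [i [e1 [h he]]]; exists i, e1; split=> // n hn; rewrite h ?H. Qed.

Lemma lim_env (e : nat -> L) b : exists i (e' : nat -> Ns i), forall n, n < b -> e n = (j i \o e') n.
Proof. by have [i [e' h]] := limit_env i0 jsurj dir e b; exists i, e' => n /h. Qed.

Lemma lsat_eq s t e : lsat (LEq s t) e <-> lval c e s = lval c e t.
Proof.
have [i [e' h]] := lim_env e (bnd (LEq s t)).
have -> : lsat (LEq s t) e <-> Sat (LEq s t) e'.
  by rewrite -lsat_map; split; apply: lsat_dep => n /h.
rewrite Sat_eq !(@lval_dep _ c _ e (j i \o e')) ?lim_lval; first by split=> [->//|/jinj].
  by move=> n hn; apply: h; rewrite /= leq_max hn orbT.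
by move=> n hn; apply: h; rewrite /= leq_max hn.
Qed.

Lemma lsat_neg p e : lsat (LNeg p) e <-> ~ lsat p e.
Proof.
have [i [e' h]] := lim_env e (bnd p).
have E q : bnd q = bnd p -> lsat q e <-> Sat q e'.
  by move=> hq; rewrite -lsat_map; split; apply: lsat_dep => n; rewrite hq => /h.
by rewrite !E // Sat_neg.
Qed.

Lemma lsat_and p q e : lsat (LAnd p q) e <-> lsat p e /\ lsat q e.
Proof.
have [i [e' h]] := lim_env e (bnd (LAnd p q)).
have E r : bnd r <= bnd (LAnd p q) -> lsat r e <-> Sat r e'.
  by move=> hr; rewrite -lsat_map; split; apply: lsat_dep => n hn; rewrite h //; apply: leq_trans hr.
by rewrite !E ?Sat_and //= ?leq_maxl ?leq_maxr.
Qed.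

Lemma lsat_ex p e : lsat (LEx p) e <-> exists a, lsat p (sc a e).
Proof.
split=> [[i [e' [h /Sat_ex [a ha]]]]|[a [i [e' [h he]]]]].
  exists (j i a), i, (sc a e'); split=> // -[|n] //= hn; apply: h => /=.
  by case: (bnd p) hn.
exists i, (sh 1 e'); split; last by apply/Sat_ex; exists (e' 0); rewrite sc_sh1.
by move=> n /= hn; rewrite /sh addn1 h //; case: (bnd p) hn.
Qed.

Lemma lsat_sub ts k p e : lsat (LSub ts k p) e <-> lsat p (senv c ts k e).
Proof.
have [i [e' h]] := lim_env e (bnd (LSub ts k p)).
have -> : lsat (LSub ts k p) e <-> Sat (LSub ts k p) e'.
  by rewrite -lsat_map; split; apply: lsat_dep => n /h.
rewrite Sat_sub -lsat_map.
have E n : n < bnd p -> senv c ts k e n = (j i \o senv cc ts k e') n.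
  move=> hn; rewrite (senv_dep _ h) //= /senv; case: ifP => // _; exact: lim_lval.
by split; apply: lsat_dep => n /E.
Qed.

Definition limit : pre := Pre lsat_eq lsat_neg lsat_and lsat_ex lsat_sub lsat_dep.

Lemma limit_emap i : @elem_map (Ns i) limit (j i).
Proof. by move=> p e; rewrite /= lsat_map. Qed.
End DirectLimitSat.

Lemma direct_limit (I : Type) (Ns : I -> pre) (i0 : I) (U : Type) (j : forall i, Ns i -> U) :
  (forall i, injective (j i)) -> (forall u, exists i x, j i x = u) ->
  (forall i i',
    (exists2 k : Ns i -> Ns i', elem_map k & forall x, j i' (k x) = j i x) \/
    (exists2 k : Ns i' -> Ns i, elem_map k & forall x, j i (k x) = j i' x)) ->
  exists (N : pre) (g : forall i, Ns i -> N) (f : N -> U),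
    [/\ injective f, forall i x, f (g i x) = j i x & forall i, elem_map (g i)].
Proof.
move=> jinj jsurj dir.
have [L [c [g [f [finj fg gc gz [gs ga gm]]]]]] := limit_structure i0 jinj jsurj dir.
have ginj i : injective (g i) by move=> x y E; apply: (jinj i); rewrite -!fg E.
have gsurj u : exists i x, g i x = u.
  by have [i [x hx]] := jsurj (f u); exists i, x; apply: finj; rewrite fg.
have gdir i i' : (exists2 k : Ns i -> Ns i', elem_map k & forall x, g i' (k x) = g i x) \/
    (exists2 k : Ns i' -> Ns i, elem_map k & forall x, g i (k x) = g i' x).
  by have [[k hk jk]|[k hk jk]] := dir i i'; [left|right]; exists k => // x; apply: finj; rewrite !fg.
exists (limit i0 ginj gsurj gdir gc gz gs ga gm), g, f; split=> //.
exact: limit_emap.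
Qed.

(** * Chains of end extensions *)

Lemma countable_range (T T' : Type) (f : T -> T') (A : set T) : countable A -> countable (f @` A).
Proof. by apply: sub_countable; apply: card_image_le. Qed.

Lemma countable_subset (T : Type) (A B : set T) : A `<=` B -> countable B -> countable A.
Proof. by move=> /subset_card_le; apply: sub_countable. Qed.

Lemma countable_setU (T : Type) (A B : set T) : countable A -> countable B -> countable (A `|` B).
Proof.
move=> hA hB; rewrite -bigcup2E; apply: bigcup_countable; first exact: countableP.
by move=> [|[|n]] _ //=; apply: countable0.
Qed.

Lemma countable_preimage_inj (T T' : Type) (f : T -> T') (A : set T) : injective f ->
  countable (f @` A) -> countable A.
Proof.
move=> hf /countable_injP [g hg]; apply/countable_injP; exists (g \o f) => x y.
rewrite !inE => hx hy E; apply: hf; apply: hg => //; rewrite inE.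
  by exists x.
by exists y.
Qed.

Lemma nat_injection (T : Type) (A : set T) : ~ countable A ->
  exists g : nat -> T, injective g /\ forall n, A (g n).
Proof.
move=> hA; have /choice [f hf] : forall l : seq T, exists y, A y /\ ~ List.In y l.
  move=> l; apply: contrapT => h; apply: hA.
  have [[x0 _]|hx] := EM (exists x, A x); last first.
    by rewrite (_ : A = set0) ?countable0 //; apply/seteqP; split=> // x Ax; case: hx; exists x.
  apply: (countable_subset (B := nth x0 l @` setT)); last exact: countable_range (countableP _).
  move=> y Ay; have /(@List.In_nth _ _ _ x0) [n [_ <-]] : List.In y l.
    by apply: contrapT => hy; apply: h; exists y.
  by exists n => //; elim: {Ay} l n {h} => [|a l IH] [|n] //=.
pose L := fix L n := if n is n.+1 then f (L n) :: L n else [::].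
have hL m n : m < n -> List.In (f (L m)) (L n).
  elim: n => // n IH; rewrite ltnS leq_eqVlt => /orP [/eqP ->|/IH] /=; by [left|right].
exists (fun n => f (L n)); split=> [m n E|n]; last by case: (hf (L n)).
case: (ltngtP m n) => // /hL h.
- by rewrite E in h; case: (hf (L n)).
- by rewrite -E in h; case: (hf (L m)).
Qed.

Lemma emap_le (N N' : pre) (j : N -> N') (hj : elem_map j) x y :
  le_of x y <-> le_of (j x) (j y).
Proof.
have := emap_UD hj (sc x (fun _ => y)) (R := fun N e => le_of (e 0) (e 1)).
by apply; dt.
Qed.

Section Chains.
Variables (M : arith) (hPA : models_PA M) (T : Type).

(* The elements carry labels in a fixed set, so that chains have unions. *)
Record state := State {
  st :> pre; lbl : st -> T; tr : st -> st -> Prop;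
  lbl_inj : injective lbl; st_good : good M st;
  st_seg : forall x : st, countable [set y | le_of y x];
  st_loc : locally_definable tr }.

(** The end-extension clause is what keeps initial segments countable in unions of chains of any
    length. *)
Definition ext (s s' : state) : Prop := exists j : s -> s',
  [/\ forall x, lbl (j x) = lbl x, elem_map j,
      forall b a, le_of b (j a) -> exists a', b = j a' & transfers j (@tr s) (@tr s')].

Lemma ext_refl s : ext s s.
Proof. by exists id; split=> // b a _; exists b. Qed.

Lemma ext_trans s1 s2 s3 : ext s1 s2 -> ext s2 s3 -> ext s1 s3.
Proof.
move=> [j [j1 j2 j3 j4]] [k [k1 k2 k3 k4]]; exists (k \o j); split=> [x|p e|b a|q e z].
- by rewrite /= k1.
- by rewrite (j2 p e) (k2 p).
- move=> /[dup] /k3 [b' ->] /(emap_le k2) /j3 [a' ->]; by exists a'.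
- by move=> /j4 /k4.
Qed.

Lemma ext_step (s : state) : enumerable s -> ~ countable [set: T] ->
  exists2 s', ext s s' & exists b : s', forall x : s, lbl b <> lbl x.
Proof.
move=> hs hT; have HN := good0_ipre hPA (st_good s).1.
have [N' [j [[eN' hj] hend [b0 hb0] hcons]]] := conservative_end_extension HN hs.
have gN' := emap_good hj (st_good s); have HN' := good0_ipre hPA gN'.1.
have cs : countable [set: s] by apply/(countable_enumerable zero).
have cN' : countable [set: N'] by apply/(countable_enumerable zero).
have [S' hS'] : exists S', transfers j (@tr s) S'.
  have [|S' h] := amalgam (I := unit) (Ns := fun _ => st s) (j := fun _ => j) (S := fun _ => @tr s) HN' (fun _ => hj).
    by left; exists id.
  by exists S'; apply: h tt.
have lb : local_base (fun z => exists z', z = j z') S'.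
  move=> F hF; have [dF _ _ _] := hF.
  by apply: transfer_local hj hS' (@st_loc s) hF _; apply: hcons.
have [S [lS eS]] := local_extension HN' (fun p q e => good0_it hPA p q e gN'.1) gN'.2 eN' lb.
(* Removing the countably many labels in use leaves an uncountable set, from which the new elements
   are labelled. *)
have [g [ginj gA]] : exists g : nat -> T, injective g /\ forall n, ~ (@lbl s @` setT) (g n).
  apply: (nat_injection (A := ~` (@lbl s @` setT))) => h; apply: hT; rewrite -(setUv (@lbl s @` setT)).
  by apply: countable_setU => //; apply: countable_range.
have /countable_injP [c cinj] := cN'.
have /choice [l hl] : forall b, exists t, (forall a, b = j a -> t = lbl a) /\
    ((forall a, b <> j a) -> t = g (c b)).
  move=> b; have [[a ->]|h] := EM (exists a, b = j a).
    exists (lbl a); split=> [a' /(emap_inj hj) -> //|h]; by case: (h a).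
  exists (g (c b)); split=> // a E; by case: h; exists a.
have hlj a : l (j a) = lbl a by apply: (hl (j a)).1.
have linj : injective l.
  have lc b : (exists a, b = j a) \/ (forall a, b <> j a) /\ l b = g (c b).
    have [|h] := EM (exists a, b = j a); first by left.
    have h' a : b <> j a by move=> E; apply: h; exists a.
    by right; split=> //; apply: (hl b).2.
  move=> x y; case: (lc x) => [[a ->]|[_ ->]]; case: (lc y) => [[a' ->]|[_ ->]].
  - by rewrite !hlj => /lbl_inj ->.
  - by rewrite hlj => E; case: (gA (c y)); rewrite -E; exists a.
  - by rewrite hlj => E; case: (gA (c x)); rewrite E; exists a'.
  - by move=> /ginj /cinj; apply; rewrite inE.
have hseg (x : N') : countable [set y | le_of y x] by apply: countable_subset cN'.
exists (State linj gN' hseg lS).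
  exists j; split=> // q e z /hS' h x al hx.
  by rewrite -h //; apply: eS hx; exists z.
exists b0 => x /= E; apply: (hb0 x); apply: linj; by rewrite hlj.
Qed.

(** A definable family of the union has its parameters in one member of the chain. It is a lift from
    that member, so its core lies there and the class of that member decides it. *)
Lemma ext_chain (C : set state) s0 : total_on C ext -> C s0 -> exists s, forall s', C s' -> ext s' s.
Proof.
move=> hC Cs0; pose I := {s : state | C s}; pose Ns (i : I) := st (sval i).
pose i0 : I := exist _ s0 Cs0.
pose U := {t : T | exists (i : I) (x : Ns i), lbl x = t}.
pose jl (i : I) (x : Ns i) : U := exist _ (lbl x) (ex_intro _ i (ex_intro _ x erefl)).
have jlE i i' (x : Ns i) (x' : Ns i') : jl i x = jl i' x' <-> lbl x = lbl x'.
  split=> [/(congr1 sval) //|E]; exact: eq_exist.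
have jinj i : injective (jl i) by move=> x y /jlE /lbl_inj.
have jsurj u : exists i x, jl i x = u.
  by case: u => t [i [x hx]]; exists i, x; apply: eq_exist.
have dir (i i' : I) : ext (sval i) (sval i') \/ ext (sval i') (sval i).
  by apply: hC; apply: svalP.
have [|N [g [f [finj fg hg]]]] := direct_limit i0 jinj jsurj.
  by move=> i i'; case: (dir i i') => -[k [k1 k2 _ _]]; [left|right]; exists k => // x; apply/jlE.
have gE i i' (x : Ns i) (x' : Ns i') : lbl x = lbl x' -> g i x = g i' x'.
  by move=> E; apply: finj; rewrite !fg; apply/jlE.
have gsurj u : exists i x, g i x = u.
  by have [i [x hx]] := jsurj (f u); exists i, x; apply: finj; rewrite fg.
have gN : good M N := emap_good (hg i0) (st_good s0).
have HN := good0_ipre hPA gN.1.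
have [S hS] : exists S, forall i, transfers (g i) (@tr (sval i)) S.
  apply: amalgam => // i i'.
  by case: (dir i i') => -[k [k1 _ _ k4]]; [left|right]; exists k => // x; apply: gE.
have gend i b a : le_of b (g i a) -> exists a', b = g i a'.
  have [i' [b' <-]] := gsurj b; case: (dir i i') => -[k [k1 k2 k3 _]].
    have -> : g i a = g i' (k a) by apply: gE.
    by move=> /(emap_le (hg i')) /k3 [a' ->]; exists a'; apply: gE.
  by move=> _; exists (k b'); apply: gE.
pose l u := sval (f u).
have lE i x : l (g i x) = lbl x by rewrite /l fg.
have linj : injective l.
  move=> u v; have [i [x <-]] := gsurj u; have [i' [y <-]] := gsurj v.
  by rewrite !lE; apply: gE.
have lseg (x : N) : countable [set y | le_of y x].
  have [i [x' <-]] := gsurj x.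
  apply: (countable_subset (B := g i @` [set y | le_of y x'])).
    by move=> y /= /[dup] /gend [y' ->] /(emap_le (hg i)) h; exists y'.
  by apply: countable_range; apply: st_seg.
have lS : locally_definable S.
  move=> F hF; have [dF _ _ _] := hF; have [q [e E]] := D2_def2 dF.
  have [i [e' he]] : exists i (e' : nat -> Ns i), forall n, n < bnd q -> g i (e' n) = e n.
    apply: (limit_env i0 gsurj (Ns := Ns)) => i i'.
    by case: (dir i i') => -[k [k1 k2 _ _]]; [left|right]; exists k => // x; apply: gE.
  have {}E : F = def2 q (g i \o e') by rewrite E; apply: def2_dep => n /he.
  have dP : D2 (fun x y => F (g i x) (g i y)).
    have -> : (fun x y => F (g i x) (g i y)) = def2 q e'; last exact: D2_Sat.
    by apply/funext => x; apply/funext => y; apply/propext; rewrite E -(emap_def2 (hg i)).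
  have fP := family_pullback (hg i) hF dP.
  have [H [A [_ cH [dA iA] cA eA]]] := transfer_local (hg i) (hS i) (@st_loc (sval i)) hF dP.
  have hr z : core F z -> core H z.
    move=> hz; apply/cH; split=> //; move: hz; rewrite E.
    apply: (core_range (hg i)); rewrite (_ : def2 q e' = fun x y => F (g i x) (g i y)) //.
    by apply/funext => x; apply/funext => y; apply/propext; rewrite E -(emap_def2 (hg i)).
  by exists A; split=> // z /hr; [apply: cA|apply: eA].
exists (State linj gN lseg lS) => s Cs; pose i : I := exist _ s Cs.
exists (g i); split; [exact: lE i|exact: hg i|exact: gend i|exact: hS i].
Qed.

(** A countable maximal extension would be enlarged by [ext_step] with an element bearing a new
    label. The fixed label set lets Zorn's lemma replace a recursion of length omega_1. *)
Lemma uncountable_ext s0 : ~ countable [set: T] -> exists2 s, ext s0 s & ~ countable [set: s].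
Proof.
move=> hT; pose P := {s | ext s0 s}; pose R (a b : P) := `[< ext (sval a) (sval b) >].
have [||C tC|[s hs] smax] := ZL_preorder (exist _ s0 (ext_refl s0) : P) (R := R).
- by move=> a; apply/asboolP; apply: ext_refl.
- by move=> b a c /asboolP h1 /asboolP h2; apply/asboolP; apply: ext_trans h1 h2.
- have [[[s1 h1] C1]|nC] := EM (exists a, C a); last first.
    by exists (exist _ s0 (ext_refl s0)) => a Ca; case: nC; exists a.
  have [||s hs] := @ext_chain [set s | exists2 h : ext s0 s, C (exist _ s h) & True] s1.
  + move=> a b [ha Ca _] [hb Cb _]; have [/asboolP h|/asboolP h] := tC _ _ Ca Cb; by [left|right].
  + by exists h1.
  exists (exist _ s (ext_trans h1 (hs s1 (ex_intro2 _ _ h1 C1 I)))) => -[a ha] Ca.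
  by apply/asboolP; apply: hs; exists ha.
exists s => // cs; have es : enumerable s by apply/(countable_enumerable zero).
have [s' h' [b hb]] := ext_step es hT.
have /asboolP [/= k [k1 _ _ _]] : R (exist _ s' (ext_trans hs h')) (exist _ s hs).
  by apply: smax; apply/asboolP.
by apply: (hb (k b)); rewrite k1.
Qed.
End Chains.

(** * The satisfaction class *)

Section SatisfactionClass.
Variable N : pre.
Hypothesis HN : ipre N.
Variable S : N -> N -> Prop.
Hypothesis hS : locally_definable S.
Implicit Types (x y z phi psi al be v : N) (A : N -> N -> Prop).

(** Local definability says nothing about codes without a skeleton; the restriction also makes the
    domain exactly [Form]. *)
Definition truth phi al : Prop := [/\ Form phi, Asn phi al & S phi al].

Lemma shape_subformula psi phi z : direct_subformula psi phi -> Form phi -> shape phi z ->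
  exists z', direct_subformula z' z /\ shape psi z'.
Proof.
case=> [->|[eta E]|[eta E]|[q [i ->]]] hF.
- by move=> /(shape_neg HN) [z' -> h]; exists z'; split=> //; apply: Or41.
- case: E => ->; move=> /(shape_bin HN _ _ _ (or_introl erefl)) [z1 [z2 [-> [h1 h2]]]].
    by exists z1; split=> //; apply: Or42; exists z2; left.
  by exists z2; split=> //; apply: Or42; exists z1; right.
- case: E => ->; move=> /(shape_bin HN _ _ _ (or_intror erefl)) [z1 [z2 [-> [h1 h2]]]].
    by exists z1; split=> //; apply: Or43; exists z2; left.
  by exists z2; split=> //; apply: Or43; exists z1; right.
- by move=> /(shape_qu HN) [z' -> h]; exists z'; split=> //; apply: Or44; exists q, zero.
Qed.

(** A neighbourhood of the skeleton of [phi] also contains the skeletons of its direct subformulas,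
    so one definable predicate serves for all of them. *)
Lemma local_truth phi : Form phi -> exists2 A, Inv A &
  [/\ forall al, S phi al <-> A phi al, forall al, A phi al <-> Comp A phi al &
      forall psi al, direct_subformula psi phi -> S psi al <-> A psi al].
Proof.
move=> hF; have [z hz] := shape_Form HN hF.
have [G fG [n hn]] := neighbourhood HN z.
have [A [_ iA cA eA]] := hS fG; have Gz : core G z by exists n.
exists A => //; split=> [al|al|psi al hp]; [exact: eA hz|exact: cA hz|].
have [z' [hz' hp']] := shape_subformula hp hF hz.
by apply: (eA z') => //; exists n.+1; case: fG => _ _ h _; apply: h hn hz'.
Qed.

(** If [be] is undefined at [v], then [v] is not free in [psi], and the default value zero there
    changes nothing by invariance. *)
Lemma agree_off_upds A psi v al be : Inv A -> is_fun al -> Asn psi be -> agree_off v be al ->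
  exists a be', upds al v a be' /\ (A psi be <-> A psi be').
Proof.
move=> [hA _ _ _] fal [fbe hbe] hag.
have [[a ha]|h] := EM (exists a, elem2 v a be).
  exists a, be; split=> //; split=> // i m; split.
    move=> h; have [E|ne] := EM (i = v); [left|by right; split=> //; apply/hag].
    by rewrite E in h *; split=> //; case: fbe => _ _ hf; apply: hf h ha.
  by case=> [[-> ->]|[ne /(hag _ _ ne)]].
have [be' [fbe' hb]] := extend_ex HN v zero fal.
exists zero, be'; split=> //; apply: hA; split=> //; split=> // i hi a.
have ne : i <> v by move=> E; apply: h; rewrite -E; apply: hbe.
rewrite hb hag //; split; first by right.
by case=> [[]|[]].
Qed.

Lemma upds_Asn q v psi al a be : Asn (qu q v psi) al -> upds al v a be ->
  Asn psi be /\ agree_off v be al.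
Proof.
move=> [_ hal] [fbe hb]; split.
  split=> // i hi; have [->|ne] := EM (i = v); first by exists a; apply/hb; left.
  have [|m hm] := hal i; first by apply: (free_qu HN) => // /esym.
  by exists m; apply/hb; right.
move=> i m ne; rewrite hb; split; first by case=> [[]|[]].
by right.
Qed.

Lemma truth_compositional phi : Form phi -> compositional truth phi.
Proof.
move=> hF al hal; have [A iA [eA cA sA]] := local_truth hF.
have fal : is_fun al by case: hal.
have -> : truth phi al <-> Comp A phi al by rewrite -cA -eA; split=> [[]|].
have E psi be : direct_subformula psi phi -> Asn psi be -> truth psi be <-> A psi be.
  move=> hp hb; rewrite -sA //; split=> [[]//|h]; split=> //; exact: (Form_sub HN hF).
have Abin o psi eta : phi = bin o psi eta -> Asn psi al /\ Asn eta al.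
  case: hal => _ hal hE; split; split=> // i hi; apply: hal; rewrite hE; apply/(free_bin HN); by [left|right].
have Aneg psi : phi = un UNeg psi -> Asn psi al.
  by case: hal => _ hal hE; split=> // i hi; apply: hal; rewrite hE; apply/(free_un HN).
split.
- case=> [[s [t [hE h]]]|[[psi [hE h]]|[[psi [eta [hE h]]]|[[psi [eta [hE h]]]|[[v [psi [hE h]]]|[v [psi [hE h]]]]]]]].
  + by left; exists s, t; rewrite hE in hF; have [? ?] := Form_eq HN hF.
  + right; left; exists psi; rewrite ?E //; [exact: Or41|exact: Aneg].
  + have [h1 h2] := Abin _ _ _ hE; do 2!right; left; exists psi, eta.
    by rewrite !E //; apply: Or43; [exists psi; right|exists eta; left].
  + have [h1 h2] := Abin _ _ _ hE; do 3!right; left; exists psi, eta.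
    by rewrite !E //; apply: Or42; [exists psi; right|exists eta; left].
  + do 4!right; left; exists v, psi; split=> //; case: h => a [be [hb h]].
    rewrite hE in hal; have [h1 h2] := upds_Asn hal hb; exists be; split=> //.
    by apply/E => //; apply: Or44; exists QEx, v.
  + do 5!right; exists v, psi; split=> // be h1 h2.
    have [a [be' [hb hA]]] := agree_off_upds iA fal h1 h2.
    by apply/E => //; [apply: Or44; exists QAll, v|apply/hA; apply: h hb].
- case=> [[s [t [_ _ hE h]]]|[[psi hE h]|[[psi [eta [hE h]]]|[[psi [eta [hE h]]]|[[v [psi [hE h]]]|[v [psi [hE h]]]]]]]].
  + by left; exists s, t.
  + right; left; exists psi; rewrite -E //; [exact: Or41|exact: Aneg].
  + have [h1 h2] := Abin _ _ _ hE; do 2!right; left; exists psi, eta.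
    by rewrite -!E //; apply: Or43; [exists psi; right|exists eta; left].
  + have [h1 h2] := Abin _ _ _ hE; do 3!right; left; exists psi, eta.
    by rewrite -!E //; apply: Or42; [exists psi; right|exists eta; left].
  + do 4!right; left; exists v, psi; split=> //; case: h => be [h1 h2 h3].
    have [a [be' [hb hA]]] := agree_off_upds iA fal h1 h2.
    exists a, be'; split=> //; apply/hA; apply/E => //; by apply: Or44; exists QEx, v.
  + do 5!right; exists v, psi; split=> // a be hb.
    rewrite hE in hal; have [h1 h2] := upds_Asn hal hb.
    by apply/E; [apply: Or44; exists QAll, v|by []|apply: h].
Qed.

Lemma truth_admissible : admissible_domain truth (@Form N).
Proof.
split=> //.
- by move=> phi psi; apply: (Form_sub HN).
- exact: truth_compositional.
- move=> phi al hF [fal hal]; have [|h] := EM (truth phi al); [by left|right].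
  have hN : Form (un UNeg phi) by apply/(Form_neg HN).
  apply/(truth_compositional hN); last by right; left; exists phi.
  by split=> // i /(free_un HN) /hal.
- by move=> phi [al [[]//|[/(Form_neg HN)]]].
Qed.

Lemma truth_full : full truth.
Proof. by split; [exact: truth_admissible|move=> D []]. Qed.

(** Similar formulas share their skeleton, hence a neighbourhood, and are judged by the same
    invariant predicate. *)
Lemma truth_regular : syntactically_regular truth.
Proof.
move=> phi psi al be hphi hpsi hal hbe hsim.
have fal : is_fun al by case: hal.
have fbe : is_fun be by case: hbe.
have [z hz] := shape_Form HN hphi.
have hz' : shape psi z by apply/(similar_invariant HN (shape_Inv HN z) fal fbe hsim).
have [G fG Gz] := neighbourhood HN z; have [A [_ iA _ eA]] := hS fG.
have E : S phi al <-> S psi be.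
  by rewrite (eA z Gz _ _ hz) (eA z Gz _ _ hz'); apply: (similar_invariant HN iA).
by split=> -[_ _ /E h].
Qed.
End SatisfactionClass.

(** * A set of size aleph_1 *)

Lemma well_order_preimage (T T' : Type) (f : T -> T') (R : rel T') : injective f ->
  well_order R -> well_order (relpre f R).
Proof.
move=> hf hR A [a Aa]; pose B : {pred T'} := fun y => `[< exists2 x, x \in A & f x = y >].
have BP x : x \in A -> f x \in B by move=> Ax; apply/asboolP; exists x.
have [|y [[/asboolP [x Ax <-] xm] yu]] := hR B; first by exists (f a); apply: BP.
exists x; split=> [|x' [Ax' xm']]; first by split=> // x' Ax'; apply: xm; apply: BP.
apply: hf; apply: yu; split; first exact: BP.
by move=> _ /asboolP [x2 Ax2 <-]; apply: xm'.
Qed.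

Lemma uncountable_power : ~ countable [set: nat -> Prop].
Proof.
move=> /(countable_enumerable (fun _ => True)) [g hg].
have [n hn] := hg (fun n => ~ g n n).
have : g n n <-> ~ g n n by rewrite {1}hn.
tauto.
Qed.

Lemma power_well_order : exists R : rel (nat -> Prop), well_order R.
Proof.
by have [R hR] := well_ordering_principle {classic (nat -> Prop)}; exists R.
Qed.

(** If some point of a well-ordered continuum has uncountably many predecessors, the part strictly
    below the least such point has countable segments; otherwise the whole order has. *)
Lemma omega1 : exists (T : Type) (R : rel T),
  [/\ ~ countable [set: T], well_order R & forall x, countable [set y | R y x]].
Proof.
have [R hR] := power_well_order.
have [h|/existsNP [x0 hx0]] := EM (forall x, countable [set y | R y x]).
  by exists (nat -> Prop), R; split=> //; apply: uncountable_power.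
pose A : {pred nat -> Prop} := fun x => `[< ~ countable [set y | R y x] >].
have [|x [[/asboolP hx xm] _]] := hR A; first by exists x0; apply/asboolP.
(* Antisymmetry comes from the uniqueness of the least element of a set of two points. *)
have anti : forall u v, R u v -> R v u -> u = v.
  move=> u v uv vu; pose B : {pred nat -> Prop} := fun w => `[< w = u \/ w = v >].
  have Bu : u \in B by apply/asboolP; left.
  have Bv : v \in B by apply/asboolP; right.
  have [|w [[/asboolP hw wm] wu]] := hR B; first by exists u.
  have refl t : R t t.
    have [|t' [[/asboolP <- tm] _]] := hR (fun w => `[< w = t >]); first by exists t; apply/asboolP.
    by apply: tm; apply/asboolP.
  have <- : w = u by apply: wu; split=> // t /asboolP [->|->].
  by apply: wu; split=> // t /asboolP [->|->].
exists {y | R y x /\ y <> x}, (relpre sval R); split.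
- move=> h; apply: hx; apply: (countable_subset (B := (sval @` [set: {y | R y x /\ y <> x}]) `|` [set x])).
    move=> y hy; have [->|ne] := EM (y = x); [by right|left].
    by exists (exist _ y (conj hy ne)).
  by apply: countable_setU; [apply: countable_range|apply: finite_set_countable; apply: finite_set1].
- by apply: well_order_preimage hR => -[y hy] [y' hy'] /= E; apply: eq_exist.
- move=> [y [hy ne]]; apply: (countable_preimage_inj (f := sval)).
    by move=> [u hu] [v hv] /= E; apply: eq_exist.
  apply: (countable_subset (B := [set z | R z y])); first by move=> _ [z hz <-].
  apply: contrapT => hc; apply: ne; apply: anti hy _; apply: xm.
  exact/asboolP.
Qed.

Theorem theorem22 (M : arith) (hPA : models_PA M) (hM : countable [set: M]) :
  exists (M' : arith) (f : M -> M'),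
    [/\ elementary f, omega1_like M' &
        exists S : M' -> M' -> Prop,
          [/\ satisfaction_class S, full S & syntactically_regular S]].
Proof.
have eM : enumerable M by apply/(countable_enumerable zero).
have [N [gN eN [j hj]]] := stage0 hPA eM.
have HN := good0_ipre hPA gN.1.
have cN : countable [set: N] by apply/(countable_enumerable zero).
(* With nothing prescribed, the extension lemma produces the first class. *)
have [S0 [lS0 _]] : exists S, locally_definable S /\ forall z : N, False -> eq_at S (fun _ _ => False) z.
  apply: (local_extension HN (fun p q e => good0_it hPA p q e gN.1) gN.2 eN) => F hF.
  exists (fun _ _ => False), (fun _ _ => False); split=> //.
  - by split=> // [|n]; [ddt|exists [::]].
  - by move=> z; split=> [[]|[]].
  - by split; [ddt|apply: (Inv_comb (X := fun _ _ => False))].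
  - by move=> z [].
have [T [R [hT wR sR]]] := omega1.
have [l [linj _]] := nat_injection hT.
have /countable_injP [c cinj] := cN.
have clinj : injective (l \o c).
  by move=> x y /linj /cinj; apply; rewrite inE.
have seg (x : N) : countable [set y | le_of y x] by apply: countable_subset cN.
have [s [k [_ hk _ _]] us] := uncountable_ext hPA (State clinj gN seg lS0) hT.
have gs := st_good s; have Hs := good0_ipre hPA gs.1.
exists s, (k \o j); split.
- by move=> p e; rewrite hj (emap_sat hk).
- split; first exact: good0_PA gs.1.
    (* The labels embed the model into a well-order with countable segments, which bounds its
       cardinality by that of omega_1; uncountability comes from the maximal extension. *)
    split=> //; exists (relpre (@lbl M T s) R); split; first exact: well_order_preimage (@lbl_inj _ _ s) wR.
    move=> x; apply: (countable_preimage_inj (@lbl_inj _ _ s)).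
    by apply: countable_subset (sR (lbl x)) => _ [y hy <-].
  move=> I hI nI; have [x nx] : exists x, ~ I x.
    by apply: contrapT => h; apply: nI; apply/seteqP; split=> // x _; apply: contrapT => ?; apply: h; exists x.
  apply: countable_subset (st_seg x) => y Iy /=.
  case: (le_total Hs y x) => // xy; case: nx; exact: hI Iy xy.
- exists (truth (@tr _ _ s)); split; last exact: truth_regular (@st_loc _ _ s).
    by exists (@Form s); apply: truth_admissible (@st_loc _ _ s).
  exact: truth_full (@st_loc _ _ s).
Qed.
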